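(* Let $M\subseteq\mathbb{E}^3$ be an ovaloid. If $M$ is a critical point of the $\mathrm{II}$-area functional $\mathrm{Area}_{\mathrm{II}}$ with respect to deformations under which the integral mean curvature $\int H\,\mathrm{d}\Omega$ is preserved, then $M$ is a sphere.
   Context: $\mathbb{E}^{3}$ is Euclidean three-space with scalar product $\langle\cdot,\cdot\rangle$ and standard connection $\overline{\mathrm{D}}$. Surfaces are smooth and connected. For a surface $M\subseteq\mathbb{E}^{3}$ with unit normal vector field $N$, $\mathrm{d}\Omega$ is the area element of the induced metric, the shape operator is $A(V)=-\overline{\mathrm{D}}_V N$, the second fundamental form is $\mathrm{II}(V,W)=\langle A(V),W\rangle$, the mean curvature is $H=\frac{1}{2}\mathrm{trace}\,A$, and the Gaussian curvature is $K=\det A$. An ovaloid is a compact (without boundary) surface $M\subseteq\mathbb{E}^3$ whose second fundamental form is positive-definite, where $N$ is chosen to be the interior unit normal. The $\mathrm{II}$-area of $M$ is the area of $M$ with respect to the Riemannian metric $\mathrm{II}$: $\mathrm{Area}_{\mathrm{II}}(M)=\int_M\mathrm{d}\Omega_{\mathrm{II}}=\int_M\sqrt{K}\,\mathrm{d}\Omega$. A deformation of a compact surface $M$ is a smooth map $\mu:\,]-\varepsilon,\varepsilon[\,\times M\to\mathbb{E}^3$, $(t,n)\mapsto\mu_t(n)$, for some $\varepsilon>0$, with $\mu_0(n)=n$ for all $n\in M$ (for small $|t|$ the image $\mu_t(M)$ is again an ovaloid). $M$ is a critical point of $\mathrm{Area}_{\mathrm{II}}$ with respect to deformations preserving $\int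 H\,\mathrm{d}\Omega$ if $\frac{\partial}{\partial t}\big|_{t=0}\mathrm{Area}_{\mathrm{II}}(\mu_t(M))=0$ for every deformation $\mu$ of $M$ such that $\int_{\mu_t(M)}H\,\mathrm{d}\Omega=\int_M H\,\mathrm{d}\Omega$ for all sufficiently small $|t|$. A sphere is a round Euclidean sphere of some centre and radius. *)

(* Defs.v *)
(* E^3 is the space of row vectors 'rV[R]_3. *)
From HB Require Import structures.
From mathcomp Require Import all_boot all_order all_algebra.
From mathcomp Require Import all_classical all_reals all_analysis.

Set Implicit Arguments.
Unset Strict Implicit.
Unset Printing Implicit Defensive.

Import Order.TTheory GRing.Theory Num.Theory.
Import numFieldNormedType.Exports.

Local Open Scope classical_set_scope.
Local Open Scope ring_scope.

(* The norm carried by 'rV[R]_3 is the sup norm; it only provides the topology.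
   Euclidean geometry is expressed with [dot]. *)
Definition dot (R : realType) (u v : 'rV[R]_3) : R := (u *m v^T) 0 0.

Definition iter_derive (R : realType) (V W : normedModType R)
    (l : seq V) (f : V -> W) : V -> W :=
  foldr (fun v g => fun q => 'D_v g q) f l.

(* C^oo on the open set U of a finite-dimensional V: all iterated directional
   derivatives are Frechet differentiable. *)
Definition smooth_on (R : realType) (V W : normedModType R)
    (U : set V) (f : V -> W) : Prop :=
  forall (l : seq V) (q : V), U q -> differentiable (iter_derive l f) q.

(* Local parametrizations. The rows of the Jacobian matrix 'J x q are the
   partial derivatives of x at q; the last condition says that x is an open
   map onto its image for the subspace topology of M, so that x is a
   homeomorphism of U onto a relatively open part of M. *)
Definition chart (R : realType) (M : set 'rV[R]_3)
    (U : set 'rV[R]_2) (x : 'rV[R]_2 -> 'rV[R]_3) : Prop :=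
  [/\ open U,
      smooth_on U x,
      {in U &, injective x},
      (forall q, U q -> row_free ('J x q)) &
      (forall V, open V -> V `<=` U ->
         exists2 W : set 'rV[R]_3, open W & x @` V = M `&` W)].

Definition surface (R : realType) (M : set 'rV[R]_3) : Prop :=
  [/\ M !=set0,
      connected M &
      (forall p, M p -> exists U x q, [/\ chart M U x, U q & x q = p])].

Definition tangent (R : realType) (M : set 'rV[R]_3) (p v : 'rV[R]_3) : Prop :=
  exists U x q, [/\ chart M U x, U q, x q = p & (v <= 'J x q)%MS].

(* The bounded part of the complement of M. *)
Definition inside (R : realType) (M : set 'rV[R]_3) : set 'rV[R]_3 :=
  [set p | ~ M p /\ bounded_set (connected_component (~` M) p)].

Definition is_inner_normal (R : realType) (M : set 'rV[R]_3)
    (p n : 'rV[R]_3) : Prop :=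
  [/\ dot n n = 1,
      (forall v, tangent M p v -> dot v n = 0) &
      \forall s \near (0 : R)^'+, inside M (p + s *: n)].

(* On a compact surface there is exactly one such n at each point p. *)
Definition inner_normal (R : realType) (M : set 'rV[R]_3)
    (p : 'rV[R]_3) : 'rV[R]_3 :=
  xget 0 [set n | is_inner_normal M p n].

Definition first_form (R : realType)
    (x : 'rV[R]_2 -> 'rV[R]_3) (q : 'rV[R]_2) : 'M[R]_2 :=
  'J x q *m ('J x q)^T.

(* The matrix S of the shape operator A(V) = - D_V N of the tangent plane at
   x q, in the basis x_1, x_2 of partial derivatives of x:
     A(x_i) = - d_i (N o x) = \sum_j S i j *: x_j,
   since u *m pinvmx J is the row of coordinates of u on the rows of J. *)
Definition shape_mx (R : realType) (M : set 'rV[R]_3)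
    (x : 'rV[R]_2 -> 'rV[R]_3) (q : 'rV[R]_2) : 'M[R]_2 :=
  - 'J (inner_normal M \o x) q *m pinvmx ('J x q).

(* The (i, j) entry is II(x_i, x_j) = <A(x_i), x_j>. *)
Definition second_form (R : realType) (M : set 'rV[R]_3)
    (x : 'rV[R]_2 -> 'rV[R]_3) (q : 'rV[R]_2) : 'M[R]_2 :=
  shape_mx M x q *m first_form x q.

(* H(p) = trace(A) / 2; the value does not depend on the chart around p. *)
Definition mean_curvature (R : realType) (M : set 'rV[R]_3)
    (p : 'rV[R]_3) : R :=
  xget 0 [set h | exists U x q,
    [/\ chart M U x, U q, x q = p & h = \tr (shape_mx M x q) / 2]].

Definition ovaloid (R : realType) (M : set 'rV[R]_3) : Prop :=
  [/\ surface M,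
      compact M &
      forall U x q, chart M U x -> U q ->
        forall w : 'rV[R]_2, w != 0 -> 0 < (w *m second_form M x q *m w^T) 0 0].

Definition plane (R : realType) (z : R * R) : 'rV[R]_2 :=
  \row_(j < 2) (if j == 0 then z.1 else z.2).

(* Integral over M of f against the area element sqrt(det g) du dv of the
   metric with Gram matrix g x q in the chart x. The surface is cut into
   finitely many disjoint pieces, each the image by a chart of a measurable
   set of parameters; the result does not depend on the pieces. *)
Definition is_surface_integral (R : realType) (M : set 'rV[R]_3)
    (g : ('rV[R]_2 -> 'rV[R]_3) -> 'rV[R]_2 -> 'M[R]_2)
    (f : 'rV[R]_3 -> R) (a : R) : Prop :=
  exists (n : nat) (U : 'I_n -> set 'rV[R]_2)
    (x : 'I_n -> 'rV[R]_2 -> 'rV[R]_3)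
    (B : 'I_n -> set (measurableTypeR R * measurableTypeR R)),
    [/\ (forall i, chart M (U i) (x i)),
        (forall i, measurable (B i) /\ @plane R @` B i `<=` U i),
        (forall i j, i != j ->
           x i @` (@plane R @` B i) `&` x j @` (@plane R @` B j) = set0),
        M = \bigcup_i (x i @` (@plane R @` B i)) &
        a = \sum_(i < n)
              Rintegral (@lebesgue_measure R \x @lebesgue_measure R)%E (B i)
                (fun z => f (x i (plane z)) *
                          Num.sqrt (\det (g (x i) (plane z))))].

Definition surface_integral (R : realType) (M : set 'rV[R]_3)
    (g : ('rV[R]_2 -> 'rV[R]_3) -> 'rV[R]_2 -> 'M[R]_2)
    (f : 'rV[R]_3 -> R) : R :=
  xget 0 [set a | is_surface_integral M g f a].

Definition total_mean_curvature (R : realType) (M : set 'rV[R]_3) : R :=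
  surface_integral M (@first_form R) (mean_curvature M).

(* The area of M for the Riemannian metric II. *)
Definition area_II (R : realType) (M : set 'rV[R]_3) : R :=
  surface_integral M (second_form M) (fun=> 1).

(* The map mu : ]-e, e[ x M -> E^3 is smooth when it is so in the charts of M;
   values of mu outside ]-e, e[ x M play no role. *)
Definition deformation (R : realType) (M : set 'rV[R]_3)
    (mu : R -> 'rV[R]_3 -> 'rV[R]_3) : Prop :=
  (forall n, M n -> mu 0 n = n) /\
  exists2 e : R, 0 < e &
    forall U x, chart M U x ->
      smooth_on [set z : R * 'rV[R]_2 | `|z.1| < e /\ U z.2]
                (fun z : R * 'rV[R]_2 => mu z.1 (x z.2)).

Definition critical_area_II (R : realType) (M : set 'rV[R]_3) : Prop :=
  forall mu : R -> 'rV[R]_3 -> 'rV[R]_3, deformation M mu ->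
    (\forall t \near (0 : R),
       total_mean_curvature (mu t @` M) = total_mean_curvature M) ->
    is_derive (0 : R) (1 : R) (fun t : R => area_II (mu t @` M)) (0 : R).

Definition sphere (R : realType) (c : 'rV[R]_3) (r : R) : set 'rV[R]_3 :=
  [set p | dot (p - c) (p - c) = r ^+ 2].

(* Main.v *)
Require Import Defs.
From HB Require Import structures.
From mathcomp Require Import all_boot all_order all_algebra.
From mathcomp Require Import ring lra.
From mathcomp Require Import all_classical all_reals all_analysis.
From mathcomp Require Import measurable_realfun.

Set Implicit Arguments.
Unset Strict Implicit.
Unset Printing Implicit Defensive.

Import Order.TTheory GRing.Theory Num.Theory.
Import numFieldNormedType.Exports.

Local Open Scope classical_set_scope.
Local Open Scope ring_scope.

(** An ovaloid M that is critical for the II-area under preservation of the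
    total mean curvature is umbilic, because one explicit deformation already
    tests this. Write h, a, k and b for the integrals over M of H, sqrt K, K
    and H sqrt K, and let the deformation send the point n to
    (1 + t k / h) n + t N(n): it consists of the parallel surfaces of M,
    rescaled. With l = 1 + t k / h, the shape operator S becomes
    S (l - t S)^-1 and the area element is multiplied by det (l - t S), so
    that the total mean curvature of the deformed surface is
    l h - t k = h, and its II-area is the integral of
    sqrt K sqrt (l^2 - 2 l t H + t^2 K). As K <= H^2, the latter is at most
    the integral of sqrt K (l - t H), that is a + t (k a / h - b). The
    derivative of the II-area vanishes, so t > 0 gives b h <= k a
    ([critical_umbilic]). On the other hand sqrt K <= H gives k <= b and
    a <= h, so k = b, and by continuity H = sqrt K everywhere: M is umbilic.
    By the Codazzi equations the curvature H of an umbilic surface is locally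
    constant, hence so is N + H p, and M is contained in a sphere
    ([umbilic_in_sphere]). It is the whole sphere, as a sphere with a missing
    point does not separate the space and would leave no room for an interior
    normal ([punctured_sphere_inside]).

    Two points have to be settled before these formulas make sense.

    Integrals are sums over charts cut into measurable pieces. They do not
    depend on the pieces ([decomp_indep]), by a change of variables formula
    for planar maps that are differentiable with a differentiable inverse
    ([change_of_variables]). It compares two measures on rectangles: their
    difference is additive, so if it is not zero it can be traced by bisection
    down to a point, where it contradicts the differentiability of the maps.
    Transition maps between charts are differentiable because charts are open
    onto their images ([transition]).

    Curvatures are taken with respect to the interior normal, which is defined
    through the bounded components of the complement. It has to be shown that
    the deformed surface has the interior normal N(n) at the image of n
    ([par_normal]). The normal field is Lipschitz ([normal_lipschitz]), so the
    deformation extends to a homeomorphism of the space close to a homothety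
    ([par_homeo]); it maps the inside of M to the inside of the deformed
    surface and short normal segments into narrow cones around the normal,
    which lie on one side of the surface by tangency ([cone_inside]). That N
    and - N cannot both be interior follows from connectedness and from the
    consideration of a farthest point ([outer_not_inside]). *)

(** * Differentials and Jacobian matrices *)

Section Differentials.
Variables (R : realType).

Lemma diff_bound (V W : normedModType R) (f : V -> W) (a : V) (e : R) :
  differentiable f a -> 0 < e ->
  \forall b \near a, `|f b - f a - 'd f a (b - a)| <= e * `|b - a|.
Proof.
move=> [[_ /(eqaddoP _ _ _ _) df]] e0; have := df _ e0.
apply: filterS => b /=; rewrite lim_id //=.
by rewrite -[X in `|X|]/(f b - (f a + 'd f a (b - a))) opprD addrA.
Qed.

Lemma diff_crit (V W : normedModType R) (f : V -> W) (a : V) (L : {linear V -> W}) :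
  continuous L ->
  (forall e, 0 < e -> \forall b \near a, `|f b - f a - L (b - a)| <= e * `|b - a|) ->
  differentiable f a /\ 'd f a = L :> (V -> W).
Proof.
move=> cL H.
have H2 : f \o shift a = cst (f a) + L +o_ 0 id.
  apply/(eqaddoP _ _ _ _) => e e0; have := H _ e0; rewrite (near_shift 0 a) subr0 /=.
  apply: filterS => b /=; rewrite addrK.
  by rewrite -[X in _ -> is_true (`|X| <= _)]/(f (b + a) - (f a + L b)) opprD addrA.
have dE : 'd f a = L :> (V -> W) by exact: diff_unique.
split=> //; apply/diff_locallyP; split; first by rewrite dE.
by rewrite dE.
Qed.

(** The differential is a choice among the linear maps that satisfy the
    definition; if there is none, the default value is the zero map. *)
Lemma diff_nondiff (V W : normedModType R) (f : V -> W) (a v : V) :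
  ~ differentiable f a -> 'd f a v = 0.
Proof.
move=> nd.
rewrite /diff (getPN _) // => L HL; apply: nd; apply/diffP.
have [cg Hg] := @getPex _ (fun (df : {linear V -> W}) => continuous df /\
  forall y, f y = f (lim (nbhs a)) + df (y - lim (nbhs a))
                  +o_(y \near a) (y - lim (nbhs a))) (ex_intro _ L HL).
by split.
Qed.

End Differentials.

Section Rows.
Variables (R : realType) (n m : nat).
Implicit Types (f : 'rV[R]_n -> 'rV[R]_m).

Lemma diffJ f a v : 'd f a v = v *m 'J f a.
Proof. by rewrite /jacobian mul_rV_lin1. Qed.

Lemma rV_norm_le k (v : 'rV[R]_k) (e : R) : 0 <= e -> (forall i, `|v 0 i| <= e) -> `|v| <= e.
Proof.
move=> e0 H; rewrite [X in X <= _]/Num.Def.normr/= mx_normrE bigmax_le //= => -[i j] _ /=.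
by rewrite ord1.
Qed.

Lemma rV_coord_le k (v : 'rV[R]_k) i : `|v 0 i| <= `|v|.
Proof.
rewrite [X in _ <= X]/Num.Def.normr/= mx_normrE.
exact: (@le_bigmax _ _ _ _ (fun ij : 'I_1 * 'I_k => `|v ij.1 ij.2|) (0, i)).
Qed.

Lemma mulmx_norm_le (A : 'M[R]_(n, m)) :
  exists2 k, 0 < k & forall v : 'rV[R]_n, `|v *m A| <= k * `|v|.
Proof.
exists (1 + \sum_i \sum_j `|A i j|).
  by rewrite ltr_pwDl// sumr_ge0// => i _; exact: sumr_ge0.
move=> v; apply: rV_norm_le => [|j].
  rewrite mulr_ge0// ltW// ltr_pwDl// sumr_ge0// => i _; exact: sumr_ge0.
rewrite mxE (le_trans (ler_norm_sum _ _ _))//.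
apply: (@le_trans _ _ (\sum_i `|v| * \sum_j `|A i j|)).
  apply: ler_sum => i _; rewrite normrM ler_pM// ?rV_coord_le//.
  by rewrite (bigD1 j)//= lerDl sumr_ge0.
by rewrite -mulr_sumr mulrC ler_wpM2r// lerDr.
Qed.

Lemma mulmxr_continuous (A : 'M[R]_(n, m)) : continuous (mulmxr A : 'rV[R]_n -> 'rV[R]_m).
Proof.
have [k k0 kA] := mulmx_norm_le A.
move=> v; have F : Filter (nbhs v) by exact: nbhs_filter.
apply/(cvgrPdist_le (F := nbhs v)) => e e0; near=> w.
rewrite -linearB (le_trans (kA _))// -ler_pdivlMl//.
near: w; apply: cvgr_dist_le => //; by rewrite mulr_gt0// invr_gt0.
Unshelve. all: by end_near. Qed.

Lemma diffJ_bound f a e : differentiable f a -> 0 < e ->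
  \forall b \near a, `|f b - f a - (b - a) *m 'J f a| <= e * `|b - a|.
Proof. by move=> df e0; have := diff_bound df e0; apply: filterS => b; rewrite diffJ. Qed.

Lemma diffJ_crit f a (A : 'M[R]_(n, m)) :
  (forall e, 0 < e -> \forall b \near a, `|f b - f a - (b - a) *m A| <= e * `|b - a|) ->
  differentiable f a /\ 'J f a = A.
Proof.
move=> H.
have [df dE] := @diff_crit R _ _ f a (mulmxr A : {linear 'rV[R]_n -> 'rV[R]_m}) (@mulmxr_continuous A) H.
split=> //; apply/row_matrixP => i; rewrite !rowE -diffJ dE //.
Qed.

Lemma nondiffJ f a : ~ differentiable f a -> 'J f a = 0.
Proof.
by move=> nd; apply/row_matrixP => i; rewrite rowE -diffJ row0 diff_nondiff.
Qed.

End Rows.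

(** * Functions of class C^k *)

Section Smooth.
Variables (R : realType).

Lemma near_eq_diff (V W : normedModType R) (f g : V -> W) a :
  (\forall b \near a, f b = g b) -> differentiable f a ->
  differentiable g a /\ 'd g a = 'd f a :> (V -> W).
Proof.
move=> fg df; apply: diff_crit => [|e e0]; first exact: diff_continuous.
have fga := nbhs_singleton fg; have := diff_bound df e0.
by move: fg; apply: filterS2 => b fgb; rewrite fgb fga.
Qed.

Lemma derive_mulR (V : normedModType R) (f g : V -> R) q v :
  derivable f q v -> derivable g q v ->
  'D_v (fun x => f x * g x) q = f q * 'D_v g q + g q * 'D_v f q.
Proof. exact: deriveM. Qed.

(** A grading of [smooth_on], adapted to inductions on the order of
    differentiation. *)
Fixpoint Ck (V W : normedModType R) n (U : set V) (f : V -> W) : Prop :=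
  (forall q, U q -> differentiable f q) /\
  (if n is n'.+1 then forall v, Ck n' U (fun q => 'D_v f q) else True).

Section CkTheory.
Variables (V : normedModType R) (U : set V).
Hypothesis oU : open U.
Implicit Types (W : normedModType R).

Lemma Ck_diff W n (f : V -> W) q : Ck n U f -> U q -> differentiable f q.
Proof. by case: n => [|n] [H _]; exact: H. Qed.

Lemma CkS W n (f : V -> W) : Ck n.+1 U f -> Ck n U f.
Proof.
elim: n f => [|n IH] f [H1 H2]; split => // v; exact/IH/H2.
Qed.

Lemma Ck_smooth W (f : V -> W) : smooth_on U f <-> forall n, Ck n U f.
Proof.
split=> [H n|H l q Uq].
  elim: n f H => [|n IH] f H; split=> //; first exact: (H [::]).
  - exact: (H [::]).
  - move=> v; apply: IH => l q Uq.
    have := H (rcons l v) q Uq; rewrite /iter_derive foldr_rcons; exact.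
have {H} := H (size l); elim/last_ind: l f => [|l v IH] f.
  by move=> [H _]; exact: H.
rewrite size_rcons => -[_ H]; rewrite /iter_derive foldr_rcons; exact/IH/H.
Qed.

Lemma Ck_eq W n (f g : V -> W) : (forall q, U q -> f q = g q) -> Ck n U f -> Ck n U g.
Proof.
elim: n f g => [|n IH] f g fg [H1 H2].
  split=> // q Uq; apply: (proj1 (near_eq_diff _ (H1 q Uq))).
  by apply: filterS (open_nbhs_nbhs (conj oU Uq)) => b; exact: fg.
split=> [q Uq|v].
  apply: (proj1 (near_eq_diff _ (H1 q Uq))).
  by apply: filterS (open_nbhs_nbhs (conj oU Uq)) => b; exact: fg.
apply: IH (H2 v) => q Uq; apply: near_eq_derive.
by apply: filterS (open_nbhs_nbhs (conj oU Uq)) => b; exact: fg.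
Qed.

Lemma Ck_cst W n (c : W) : Ck n U (fun=> c).
Proof.
elim: n c => [|n IH] c; split=> // v.
by apply: Ck_eq (IH 0) => q _; rewrite derive_cst.
Qed.

Lemma Ck_add W n (f g : V -> W) : Ck n U f -> Ck n U g -> Ck n U (fun q => f q + g q).
Proof.
elim: n f g => [|n IH] f g [f1 f2] [g1 g2]; split=> //.
- by move=> q Uq; apply: differentiableD; [exact: f1|exact: g1].
- by move=> q Uq; apply: differentiableD; [exact: f1|exact: g1].
move=> v; apply: Ck_eq (IH _ _ (f2 v) (g2 v)) => q Uq.
by rewrite deriveD //; apply: diff_derivable; [exact: f1|exact: g1].
Qed.

Lemma Ck_opp W n (f : V -> W) : Ck n U f -> Ck n U (fun q => - f q).
Proof.
elim: n f => [|n IH] f [f1 f2]; split=> //.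
- by move=> q Uq; apply: differentiableN; exact: f1.
- by move=> q Uq; apply: differentiableN; exact: f1.
move=> v; apply: Ck_eq (IH _ (f2 v)) => q Uq.
by rewrite deriveN //; apply: diff_derivable; exact: f1.
Qed.

Lemma Ck_mul n (f g : V -> R) : Ck n U f -> Ck n U g -> Ck n U (fun q => f q * g q).
Proof.
elim: n f g => [|n IH] f g Cf Cg.
  by move: Cf Cg => [f1 f2] [g1 g2]; split=> // q Uq; apply: differentiableM; [exact: f1|exact: g1].
move: (Cf) (Cg) => [f1 f2] [g1 g2]; split=> [q Uq|v].
  by apply: differentiableM; [exact: f1|exact: g1].
have h1 := IH _ _ (CkS Cf) (g2 v); have h2 := IH _ _ (CkS Cg) (f2 v).
apply: Ck_eq (Ck_add h1 h2) => q Uq.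
by rewrite (@derive_mulR V f g) //; apply: diff_derivable; [exact: f1|exact: g1].
Qed.

Lemma Ck_sum W n (I : Type) (r : seq I) (P : pred I) (F : I -> V -> W) :
  (forall i, P i -> Ck n U (F i)) -> Ck n U (fun q => \sum_(i <- r | P i) F i q).
Proof.
move=> H; elim: r => [|i r IH].
  by apply: Ck_eq (Ck_cst n 0) => q _; rewrite big_nil.
case Pi : (P i).
  by apply: Ck_eq (Ck_add (H i Pi) IH) => q _; rewrite big_cons Pi.
by apply: Ck_eq IH => q _; rewrite big_cons Pi.
Qed.

(** Differentiating g^2 c = 1 gives Dg = - g^3 Dc / 2, so that g inherits
    the regularity of c one order at a time. *)
Lemma Ck_inv_sqrt n (c g : V -> R) :
  (forall q, U q -> differentiable g q) ->
  (forall q, U q -> g q ^+ 2 * c q = 1) -> Ck n U c -> Ck n U g.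
Proof.
move=> dg gc; elim: n => [|n IH] Cc; first by split.
split=> // v; have Cg := IH (CkS Cc); have c1 := Cc.1; have Dc : Ck n U (fun q => 'D_v c q) := Cc.2 v.
have := Ck_mul (Ck_cst n (- 2^-1 : R)) (Ck_mul Dc (Ck_mul Cg (Ck_mul Cg Cg))).
apply: Ck_eq => q Uq.
have : 'D_v (fun q => g q * g q * c q) q = 0.
  rewrite -(derive_cst (1 : R) q v); apply: near_eq_derive.
  by apply: filterS (open_nbhs_nbhs (conj oU Uq)) => b Ub; rewrite -(gc b Ub) expr2.
have gd : derivable g q v by apply: diff_derivable; exact: dg.
have cd : derivable c q v by apply: diff_derivable; exact: c1.
rewrite (derive_mulR (derivableM gd gd) cd) (derive_mulR gd gd).
move: ('D_v g q : R) ('D_v c q : R) => G C H.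
have {}H : g q * g q * C + c q * (g q * G + g q * G) = 0 by exact: H.
transitivity (G * (g q ^+ 2 * c q)); last by rewrite gc// mulr1.
apply/eqP; rewrite -subr_eq0; apply/eqP.
transitivity (- (g q / 2) * (g q * g q * C + c q * (g q * G + g q * G))); first by field.
by rewrite H mulr0.
Qed.

End CkTheory.
End Smooth.

Section Rows.
Variables (R : realType).

Lemma diff_rowP (V : normedModType R) m (f : V -> 'rV[R]_m) a :
  differentiable f a <-> forall j, differentiable (fun q => f q 0 j) a.
Proof.
split=> [df j|H].
  apply: (@differentiable_comp _ _ _ _ f (fun w : 'rV[R]_m => w 0 j)) => //.
  exact: differentiable_coord.
rewrite (_ : f = (fun q => \sum_(j < m) (f q 0 j) *: delta_mx 0 j)); last first.
  by apply/funext => q; rewrite -row_sum_delta.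
have : differentiable (\sum_(j < m) (fun q => f q 0 j *: (delta_mx 0 j : 'rV[R]_m))) a.
  apply: differentiable_sum => j.
  exact: (@differentiableZl _ _ _ (fun q => f q 0 j)).
congr (differentiable _ _).
by apply/funext => q; rewrite fct_sumE.
Qed.

Lemma derive_coord (V : normedModType R) m (f : V -> 'rV[R]_m) a v j :
  derivable f a v -> ('D_v f a) 0 j = 'D_v (fun q => f q 0 j) a.
Proof. by move=> df; rewrite derive_mx // mxE. Qed.

Section Fix.
Variables (V : normedModType R) (U : set V).
Hypothesis oU : open U.

Lemma Ck_rowP n m (f : V -> 'rV[R]_m) :
  Ck n U f <-> forall j, Ck n U (fun q => f q 0 j).
Proof.
split.
  elim: n f => [|n IH] f [f1 f2] j; split=> //.
  - by move=> q /f1 /diff_rowP /(_ j).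
  - by move=> q /f1 /diff_rowP /(_ j).
  - move=> v; apply: (Ck_eq oU) (IH _ (f2 v) j) => q Uq.
    by rewrite derive_coord //; apply: diff_derivable; exact: f1.
elim: n f => [|n IH] f H; split=> //.
- by move=> q Uq; apply/diff_rowP => j; exact: (H j).1.
- by move=> q Uq; apply/diff_rowP => j; exact: (H j).1.
move=> v; apply: IH => j.
apply: (Ck_eq oU) ((H j).2 v) => q Uq.
rewrite derive_coord //; apply: diff_derivable; apply/diff_rowP => i; exact: (H i).1.
Qed.

Lemma Ck_scale n m (g : V -> R) (f : V -> 'rV[R]_m) :
  Ck n U g -> Ck n U f -> Ck n U (fun q => g q *: f q).
Proof.
move=> Cg /Ck_rowP Cf; apply/Ck_rowP => j.
by apply: (Ck_eq oU) (Ck_mul oU Cg (Cf j)) => q _; rewrite mxE.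
Qed.

End Fix.

Lemma Ck_linear (V W : normedModType R) (U : set V) n (L : {linear V -> W}) :
  open U -> continuous L -> Ck n U L.
Proof.
move=> oU cL; case: n => [|n].
  by split=> // q _; exact: linear_differentiable.
split=> [q _|v]; first exact: linear_differentiable.
apply: (Ck_eq oU) (Ck_cst oU n (L v)) => q _.
by rewrite deriveE ?diff_lin//; exact: linear_differentiable.
Qed.

Lemma Ck_lin_comp (V V' W : normedModType R) (U : set V) n (L : {linear V' -> V}) (f : V -> W) :
  open U -> continuous L -> Ck n U f -> Ck n (L @^-1` U) (f \o L).
Proof.
move=> oU cL.
have oU' : open (L @^-1` U) by apply: open_comp => // x _; exact: cL.
have dL q : differentiable L q by exact: linear_differentiable.
elim: n f => [|n IH] f [f1 f2]; split=> //.
- by move=> q Uq; apply: differentiable_comp => //; exact: f1.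
- by move=> q Uq; apply: differentiable_comp => //; exact: f1.
move=> v; apply: (Ck_eq oU') (IH _ (f2 (L v))) => q Uq /=.
rewrite !deriveE //; [|by apply: differentiable_comp => //; exact: f1|exact: f1].
by rewrite (diff_comp (dL q) (f1 _ Uq)) /= (diff_lin q cL).
Qed.

Lemma is_derive_line (V W : normedModType R) (f : V -> W) a v (s : R) :
  derivable f (a + s *: v) v ->
  is_derive s 1 (fun u => f (a + u *: v)) ('D_v f (a + s *: v)).
Proof.
have E : (fun h : R => h^-1 *: (f (a + (h *: 1 + s) *: v) - f (a + s *: v))) =
    (fun h => h^-1 *: (f (h *: v + (a + s *: v)) - f (a + s *: v))).
  apply/funext => h; congr (_ *: (f _ - _)).
  by rewrite scalerDl addrCA [h *: 1]mulr1.
by move=> H; split; rewrite /derivable /derive /= E.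
Qed.

Lemma MVT_line (V : normedModType R) (f : V -> R) (a b : V) :
  (forall s, 0 <= s <= 1 -> differentiable f (a + s *: (b - a))) ->
  exists2 s, 0 <= s <= 1 & f b - f a = 'D_(b - a) f (a + s *: (b - a)).
Proof.
move=> H.
have [s]: exists2 s, s \in `[0, 1]%R &
    f (a + 1 *: (b - a)) - f (a + (0 : R) *: (b - a)) = 'D_(b - a) f (a + s *: (b - a)) * (1 - 0).
  apply: (MVT_segment (f := fun u => f (a + u *: (b - a)))) => // [x xI|].
    apply: is_derive_line; apply: diff_derivable; apply: H.
    by move: xI; rewrite in_itv/= => /andP[? ?]; rewrite !ltW.
  apply: derivable_within_continuous => x xI.
  have [//|h _] := @is_derive_line _ _ f a (b - a) x _; last exact: h.
  by apply: diff_derivable; apply: H; move: xI; rewrite in_itv.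
rewrite in_itv/= => s01; rewrite scale1r scale0r addr0 subr0 mulr1 [a + (b - a)]addrC subrK => E.
by exists s.
Qed.

End Rows.

(** * Strict differentiability and mixed partial derivatives *)

Section Strict.
Variables (R : realType).

Lemma seg_ball (V : normedModType R) (c a b : V) (r s : R) : `|a - c| < r -> `|b - c| < r ->
  0 <= s <= 1 -> `|a + s *: (b - a) - c| < r.
Proof.
move=> ar br /andP[s0 s1].
have -> : a + s *: (b - a) - c = (1 - s) *: (a - c) + s *: (b - c).
  rewrite -[b - a](subrKA c) -[c - a]opprB addrAC scalerBl scale1r.
  by rewrite [s *: (_ - (_ - _))]scalerBr -[RHS]addrA [- _ + _]addrC.
rewrite (le_lt_trans (ler_normD _ _))// !normrZ !ger0_norm// ?subr_ge0//.
have [->|sn0] := eqVneq s 0; first by rewrite subr0 mul1r mul0r addr0.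
have sp : 0 < s by rewrite lt_neqAle eq_sym sn0.
have : s * `|b - c| < s * r by rewrite ltr_pM2l.
have : (1 - s) * `|a - c| <= (1 - s) * r by rewrite ler_wpM2l ?subr_ge0// ltW.
lra.
Qed.

Lemma diff_row_sum n (f : 'rV[R]_n -> R) q v : differentiable f q ->
  'd f q v = \sum_i v 0 i * 'D_(delta_mx 0 i) f q.
Proof.
move=> df; rewrite {1}[v]row_sum_delta linear_sum; apply: eq_bigr => i _.
by rewrite linearZ /= deriveE.
Qed.

(** The mean value theorem on the segment from a to b, along which the
    differential stays close to its value at q0. *)
Lemma strict_diffR n (U : set 'rV[R]_n) (f : 'rV[R]_n -> R) q0 e :
  open U -> U q0 -> Ck 1 U f -> 0 < e ->
  exists2 r, 0 < r & forall a b, `|a - q0| < r -> `|b - q0| < r ->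
   `|f b - f a - 'd f q0 (b - a)| <= e * `|b - a|.
Proof.
move=> oU Uq0 [f1 f2] e0.
have n0 : 0 < n.+1%:R :> R by [].
have : \forall q \near q0, U q /\ (forall i, `|'D_(delta_mx 0 i) f q0 - 'D_(delta_mx 0 i) f q| <= e / n.+1%:R).
  near=> q; split; first by near: q; exact: open_nbhs_nbhs.
  near: q; apply: filter_forall => i.
  have /differentiable_continuous /cvgrPdist_le := (f2 (delta_mx 0 i)).1 q0 Uq0.
  by apply; rewrite divr_gt0.
move=> /nbhs_ballP[r r0 H]; exists r => // a b ar br.
have inb s : 0 <= s <= 1 -> ball q0 r (a + s *: (b - a)).
  by move=> s01; rewrite -ball_normE /= distrC seg_ball.
have [s s01 ->] : exists2 s, 0 <= s <= 1 & f b - f a = 'D_(b - a) f (a + s *: (b - a)).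
  by apply: MVT_line => s s01; apply: f1; exact: (H _ (inb _ s01)).1.
have [Us Hs] := H _ (inb _ s01).
move: (a + s *: (b - a)) Us Hs => p Up Hp; move: (b - a) => v.
have -> : 'D_v f p = \sum_i v 0 i * 'D_(delta_mx 0 i) f p.
  by rewrite -(diff_row_sum _ (f1 _ Up)) deriveE //; exact: f1.
have -> : 'd f q0 v = \sum_i v 0 i * 'D_(delta_mx 0 i) f q0.
  exact: (diff_row_sum _ (f1 _ Uq0)).
rewrite -sumrB (le_trans (ler_norm_sum _ _ _))//.
apply: (@le_trans _ _ (\sum_(i < n) `|v| * (e / n.+1%:R))).
  apply: ler_sum => i _; rewrite -mulrBr normrM ler_pM// ?rV_coord_le//.
  by rewrite distrC.
rewrite sumr_const card_ord -[_ *+ n]mulr_natr -mulrA mulrC ler_wpM2r//.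
by rewrite -mulrA ler_piMr ?(ltW e0)// [_^-1 * _]mulrC ler_pdivrMr// mul1r ler_nat.
Unshelve. all: by end_near. Qed.

Lemma strict_diff n m (U : set 'rV[R]_n) (f : 'rV[R]_n -> 'rV[R]_m) q0 e :
  open U -> U q0 -> Ck 1 U f -> 0 < e ->
  exists2 r, 0 < r & forall a b, `|a - q0| < r -> `|b - q0| < r ->
   `|f b - f a - (b - a) *m 'J f q0| <= e * `|b - a|.
Proof.
move=> oU Uq0 Cf e0; have /(Ck_rowP oU) Cfj := Cf.
have df : differentiable f q0 by exact: Ck_diff Cf Uq0.
have H : \forall r \near (0 : R)^'+, forall j a b, `|a - q0| < r -> `|b - q0| < r ->
   `|f b 0 j - f a 0 j - 'd (fun q => f q 0 j) q0 (b - a)| <= e * `|b - a|.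
  apply: filter_forall => j.
  have [r r0 H] := strict_diffR oU Uq0 (Cfj j) e0.
  near=> t => a b /= at_ bt; apply: H; [apply: lt_trans at_ _|apply: lt_trans bt _];
    by near: t; exact: nbhs_right_lt.
have [r [r0 Hr]] : exists r, 0 < r /\ forall j a b, `|a - q0| < r -> `|b - q0| < r ->
   `|f b 0 j - f a 0 j - 'd (fun q => f q 0 j) q0 (b - a)| <= e * `|b - a|.
  near (0 : R)^'+ => r; exists r; split; first by near: r; exact: nbhs_right_gt.
  by near: r.
exists r => // a b ar br; apply: rV_norm_le => [|j]; first by rewrite mulr_ge0// ltW.
have := Hr j a b ar br; congr (`|_| <= _); rewrite !mxE; congr (_ - _).
have dj : differentiable (fun q => f q 0 j) q0 by exact: Ck_diff (Cfj j) Uq0.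
rewrite -deriveE // -derive_coord; last exact: diff_derivable.
by rewrite deriveE // diffJ mxE.
Unshelve. all: by end_near. Qed.

Section Clairaut.
Variables (V : normedModType R).

Lemma derive_shift_arg (W : normedModType R) (f : V -> W) p w v :
  'D_v (fun p => f (p + w)) p = 'D_v f (p + w).
Proof.
rewrite /derive (_ : (fun h => h^-1 *: _) =
    (fun h => h^-1 *: (f (h *: v + (p + w)) - f (p + w)))) //.
by apply/funext => h /=; rewrite addrA.
Qed.

(** The mean value theorem in the direction s v for the increment
    p |-> f (p + s u) - f p. *)
Lemma second_difference (U : set V) (f : V -> R) q u v e :
  open U -> U q -> Ck 1 U f -> 0 < e ->
  \forall s \near (0 : R)^'+,
   `|f (q + s *: u + s *: v) - f (q + s *: u) - f (q + s *: v) + f q - s ^+ 2 * 'D_u (fun p => 'D_v f p) q| <= e * s ^+ 2.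
Proof.
move=> oU Uq [f1 f2] e0; pose g := fun p => 'D_v f p.
have dg : differentiable g q by exact: (f2 v).1.
pose k := 2 * (`|u| + `|v|) + 1.
have k0 : 0 < k by rewrite ltr_wpDl// mulr_ge0// addr_ge0.
have ek0 : 0 < e / k by rewrite divr_gt0.
have : \forall p \near q, U p /\ `|g p - g q - 'd g q (p - q)| <= e / k * `|p - q|.
  near=> p; split; near: p; first exact: open_nbhs_nbhs.
  exact: diff_bound.
move=> /nbhs_ballP[r /= r0 H].
near=> s.
have s0 : 0 < s by near: s; exact: nbhs_right_gt.
have sr : s * (`|u| + `|v|) < r.
  have : s * k < r by rewrite -ltr_pdivlMr//; near: s; apply: nbhs_right_lt; rewrite divr_gt0.
  apply: le_lt_trans; rewrite ler_wpM2l ?(ltW s0)// /k mulrDl mul1r.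
  have := normr_ge0 u; have := normr_ge0 v; lra.
have inb t w : 0 <= t <= 1 -> (w = 0 \/ w = s *: u) -> `|w + t *: (s *: v)| <= s * (`|u| + `|v|).
  move=> /andP[t0 t1] wE; rewrite (le_trans (ler_normD _ _))// mulrDr lerD//.
    by case: wE => ->; rewrite ?normr0 ?mulr_ge0 ?normrZ ?gtr0_norm// ltW.
  by rewrite scalerA normrZ ger0_norm ?mulr_ge0 ?(ltW s0)// ler_wpM2r// ler_piMl// ltW.
have inr t w : 0 <= t <= 1 -> (w = 0 \/ w = s *: u) -> ball q r (q + (w + t *: (s *: v))).
  move=> t01 wE; rewrite -ball_normE /= distrC addrC addKr.
  exact: le_lt_trans (inb _ _ t01 wE) sr.
pose F p := f (p + s *: u) - f p.
have dF t : 0 <= t <= 1 -> differentiable (fun p => f (p + s *: u)) (q + t *: (s *: v)) /\ differentiable f (q + t *: (s *: v)).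
  move=> t01; split.
    apply: (@differentiable_comp _ _ _ _ (fun p => p + s *: u) f) => //.
    apply: f1; apply: (H _ _).1; rewrite -addrA [_ + s *: u]addrC.
    by apply: inr => //; right.
  apply: f1; apply: (H _ _).1; rewrite -[t *: _]add0r; by apply: inr => //; left.
have [t t01] : exists2 t, 0 <= t <= 1 & F (q + s *: v) - F q = 'D_(s *: v) F (q + t *: (s *: v)).
  have qv w : q + w - q = w by rewrite addrC addKr.
  have [t t01|t t01] := @MVT_line R V F q (q + s *: v).
    by rewrite qv; have [? ?] := dF _ t01; exact: differentiableB.
  by rewrite qv => E; exists t.
have [d1 d2] := dF _ t01.
have -> : 'D_(s *: v) F (q + t *: (s *: v)) = s * (g (q + (s *: u + t *: (s *: v))) - g (q + (0 + t *: (s *: v)))).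
  rewrite deriveB; [|exact: diff_derivable|exact: diff_derivable].
  rewrite mulrBr; congr (_ - _).
    rewrite deriveE // linearZ /= -deriveE // derive_shift_arg /g.
    by rewrite [s *: u + _]addrC addrA.
  by rewrite add0r deriveE // linearZ /= -deriveE.
set A := _ + (_ + _); set B := _ + (0 + _).
have [_ HA] := H A (inr _ _ t01 (or_intror erefl)).
have [_ HB] := H B (inr _ _ t01 (or_introl erefl)).
have Aq : `|A - q| <= s * (`|u| + `|v|).
  by rewrite /A addrC addKr; apply: inb => //; right.
have Bq : `|B - q| <= s * (`|u| + `|v|).
  by rewrite /B addrC addKr; apply: inb => //; left.
have ABE : 'd g q (A - q) - 'd g q (B - q) = s * 'D_u g q.
  have qv w : q + w - q = w by rewrite addrC addKr.
  by rewrite -linearB /= /A /B !qv add0r addrK linearZ /= -deriveE.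
move=> E.
have -> : f (q + s *: u + s *: v) - f (q + s *: u) - f (q + s *: v) + f q = s * (g A - g B).
  rewrite -E /F [q + s *: u + _]addrAC; ring.
have -> : s * (g A - g B) - s ^+ 2 * 'D_u g q = s * ((g A - g q - 'd g q (A - q)) - (g B - g q - 'd g q (B - q))).
  by rewrite expr2 -mulrA -ABE; ring.
rewrite normrM gtr0_norm// expr2 mulrCA ler_pM2l// (le_trans (ler_normB _ _))//.
apply: (@le_trans _ _ (e / k * (s * (`|u| + `|v|)) + e / k * (s * (`|u| + `|v|)))).
  by rewrite lerD// (le_trans HA, le_trans HB)// ler_wpM2l// ltW.
rewrite -mulrDr -mulrA ler_wpM2l ?(ltW e0)// mulrC ler_pdivrMr// -mulr2n -mulrnAr.
rewrite ler_wpM2l ?(ltW s0)// /k -mulr_natl; lra.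
Unshelve. all: by end_near. Qed.

(** The second difference is symmetric in u and v. *)
Lemma clairaut (U : set V) (f : V -> R) q u v :
  open U -> U q -> Ck 1 U f ->
  'D_u (fun p => 'D_v f p) q = 'D_v (fun p => 'D_u f p) q.
Proof.
move=> oU Uq Cf; apply/eqP; rewrite -subr_eq0 -normr_le0; apply/ler_addgt0Pr => e e0; rewrite add0r.
have e2 : 0 < e / 2 by rewrite divr_gt0.
have H1 := second_difference u v oU Uq Cf e2.
have H2 := second_difference v u oU Uq Cf e2.
move: ('D_u (fun p => 'D_v f p) q) ('D_v (fun p => 'D_u f p) q) H1 H2 => D1 D2 H1 H2.
have H0 : \forall s \near (0 : R)^'+, 0 < s by exact: nbhs_right_gt.
have [s [[/= h1 h2] s0]] := filter_ex (filterI (filterI H1 H2) H0).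
have s20 : 0 < s ^+ 2 by rewrite exprn_gt0.
rewrite -(ler_pM2l s20) -[X in X * `|_|](gtr0_norm s20) -normrM mulrBr.
set X := _ - f (q + s *: v) + f q in h1; set X' := _ - f (q + s *: u) + f q in h2.
have XX' : X = X' by rewrite /X /X' [q + s *: u + _]addrAC addrAC -!addrA; congr +%R; rewrite addrCA.
have -> : s ^+ 2 * D1 - s ^+ 2 * D2 = (X' - s ^+ 2 * D2) - (X - s ^+ 2 * D1).
  by rewrite XX'; ring.
rewrite (le_trans (ler_normB _ _))// (le_trans (lerD h2 h1))// -mulrDl -splitr mulrC //.
Qed.

End Clairaut.
End Strict.

(** * Planar Lebesgue measure under affine maps *)

Section Plane.
Variable R : realType.
Local Notation RR := (measurableTypeR R * measurableTypeR R)%type.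
Local Notation l1 := (@lebesgue_measure R).
Local Notation l2 := (l1 \x l1)%E.
Local Open Scope ereal_scope.

Lemma measurable_affine1 (k c : R) :
  measurable_fun setT (fun u : measurableTypeR R => (k * u + c)%R : measurableTypeR R).
Proof.
apply: measurable_funD => //; exact: measurable_funM.
Qed.

(** Both sides are measures of X, so it suffices to compare them on
    intervals. *)
Lemma lebesgue_affine (k c : R) (X : set (measurableTypeR R)) : k != 0%R -> measurable X ->
  l1 ((fun u => (k * u + c)%R) @^-1` X) = `|k|^-1%:E * l1 X.
Proof.
move=> k0 mX; have nk0 : (0 < `|k|)%R by rewrite normr_gt0.
have mf := measurable_affine1 k c.
pose f : {mfun measurableTypeR R >-> measurableTypeR R} := HB.pack (fun u => (k * u + c)%R) (isMeasurableFun.Build _ _ _ _ _ mf).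
suff -> : l1 X = `|k|%:E * l1 (f @^-1` X).
  by rewrite muleA -EFinM mulVf ?mul1e// gt_eqF.
pose m := mscale (NngNum (ltW nk0)) (pushforward l1 f).
have mff : measurable_fun [set: measurableTypeR R] f by [].
apply: (lebesgue_measure_unique (mu := m mff)) => // _ [[a b]] /= _ <-.
rewrite /m /mscale /= /pushforward.
have [kp|kn] := ltrP 0 k.
  have -> : (fun u : R => (k * u + c)%R) @^-1` `]a, b] = `]((a - c) / k)%R, ((b - c) / k)%R]%classic.
    apply/seteqP; split => u /=; rewrite !in_itv /= ltr_pdivrMr// ler_pdivlMr// mulrC ltrBlDr lerBrDr//.
  rewrite !lebesgue_measure_itv /= !lte_fin ltr_pM2r ?invr_gt0// ltrD2r.
  case: ifPn => _; last by rewrite mule0.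
  by rewrite -!EFinB -EFinM gtr0_norm// -mulrBl opprB addrA subrK mulrCA divff// mulr1.
have {}kn : (k < 0)%R by rewrite lt_neqAle k0.
have -> : (fun u : R => (k * u + c)%R) @^-1` `]a, b] = `[((b - c) / k)%R, ((a - c) / k)%R[%classic.
  by apply/seteqP; split => u /=; rewrite !in_itv /= ltr_ndivlMr// ler_ndivrMr// mulrC ltrBlDr lerBrDr andbC.
rewrite !lebesgue_measure_itv /= !lte_fin ltr_nM2r ?invr_lt0// ltrD2r.
case: ifPn => _; last by rewrite mule0.
rewrite -!EFinB -EFinM ltr0_norm// -mulrBl mulNr mulrCA divff// mulr1; congr (_%:E); ring.
Qed.

Lemma l2E (X : set RR) : measurable X -> l2 X = (l1 \x^ l1) X.
Proof.
by move=> mX; apply: product_measure_unique => // A B mA mB; exact: product_measure2E.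
Qed.

Definition aff (a b c d e f : R) (z : RR) : RR :=
  ((a * z.1 + b * z.2 + e)%R, (c * z.1 + d * z.2 + f)%R).

Lemma measurable_aff a b c d e f : measurable_fun setT (aff a b c d e f).
Proof.
apply: measurable_fun_pair; (apply: measurable_funD => //; apply: measurable_funD => //; apply: measurable_funM => //).
Qed.

Lemma measurable_aff_pre a b c d e f (X : set RR) : measurable X ->
  measurable (aff a b c d e f @^-1` X).
Proof. by move=> mX; rewrite -[X in measurable X]setTI; exact: measurable_aff. Qed.

Lemma l2_shear1 a b e X : a != 0%R -> measurable X ->
  l2 (aff a b 0 1 e 0 @^-1` X) = `|a|^-1%:E * l2 X.
Proof.
move=> a0 mX; rewrite !l2E//; last exact: measurable_aff_pre.
rewrite /product_measure2 -ge0_integralZl//; last exact: measurable_fun_ysection.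
apply: eq_integral => y _ /=.
rewrite -(lebesgue_affine (b * y + e) a0); last exact: measurable_ysection.
congr (l1 _); apply/seteqP; split => u; rewrite /ysection /= !inE /aff /=;
  by rewrite mul0r mul1r add0r addr0 addrA.
Qed.

Lemma l2_shear2 c d f X : d != 0%R -> measurable X ->
  l2 (aff 1 0 c d 0 f @^-1` X) = `|d|^-1%:E * l2 X.
Proof.
move=> a0 mX.
rewrite /product_measure1 -ge0_integralZl//; last exact: measurable_fun_xsection.
apply: eq_integral => y _ /=.
rewrite -(lebesgue_affine (c * y + f) a0); last exact: measurable_xsection.
congr (l1 _); apply/seteqP; split => u; rewrite /xsection /= !inE /aff /=;
  by rewrite mul0r mul1r !addr0 addrCA addrA.
Qed.

Lemma preimage_factor (T1 T2 T3 : Type) (h : T1 -> T3) (f : T1 -> T2) (g : T2 -> T3) Y :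
  (forall z, h z = g (f z)) -> h @^-1` Y = f @^-1` (g @^-1` Y).
Proof. by move=> H; apply/seteqP; split => z /=; rewrite H. Qed.

(** An affine map with a nonzero first entry is a composition of two
    triangular ones, for which Fubini's theorem reduces the claim to
    dimension one; the other case is brought to this one by a shear. *)
Lemma l2_aff a b c d e f X : (a * d - b * c != 0)%R -> measurable X ->
  l2 (aff a b c d e f @^-1` X) = `|a * d - b * c|^-1%:E * l2 X.
Proof.
move=> D0 mX.
have main a' b' c' d' e' f' Y : a' != 0%R -> (a' * d' - b' * c' != 0)%R -> measurable Y ->
  l2 (aff a' b' c' d' e' f' @^-1` Y) = `|a' * d' - b' * c'|^-1%:E * l2 Y.
  move=> a0 D'0 mY.
  have d1 : (d' - b' * c' / a' = (a' * d' - b' * c') / a')%R by field.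
  have d0 : (d' - b' * c' / a' != 0)%R by rewrite d1 mulf_neq0// invr_neq0.
  have -> : aff a' b' c' d' e' f' @^-1` Y = aff a' b' 0 1 e' 0 @^-1`
     (aff 1 0 (c' / a') (d' - b' * c' / a') 0 (f' - c' * e' / a') @^-1` Y).
    apply: preimage_factor => z.
    rewrite /aff /=; congr (_, _); first by ring.
    by field.
  rewrite l2_shear1//; last exact: measurable_aff_pre.
  rewrite l2_shear2// muleA -EFinM d1 normrM normfV invfM invrK.
  by rewrite mulrCA mulVf ?mulr1// normr_eq0.
have [a0|a0] := eqVneq a 0%R; last exact: main.
have c0 : c != 0%R by apply: contra_neq D0 => ->; rewrite a0; ring.
have -> : aff a b c d e f @^-1` X = aff (a + c) (b + d) c d (e + f) f @^-1` (aff 1 (-1) 0 1 0 0 @^-1` X).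
  apply: preimage_factor => z.
  by rewrite /aff /=; congr (_, _); ring.
rewrite main //; first 1 last.
- by rewrite a0 add0r.
- by rewrite (_ : _ - _ = a * d - b * c)%R//; ring.
- exact: measurable_aff_pre.
rewrite (_ : (a + c) * d - (b + d) * c = a * d - b * c)%R; last by ring.
by rewrite l2_shear1 ?oner_eq0// normr1 invr1 mul1e.
Qed.

End Plane.

(** * Planar measures are determined by small rectangles *)

(** Compactness, in terms of the filter of large constants C. *)
Lemma compact_locbound (T : topologicalType) (R : realType) (K : set T) (f : T -> R) :
  compact K ->
  (forall p, K p -> exists C, \forall p' \near p, K p' -> f p' <= C) ->
  exists C, forall p, K p -> f p <= C.
Proof.
move=> /compact_near_coveringP cK H.
have := cK _ (pinfty_nbhs R) (fun C p => K p -> f p <= C) _.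
move=> /(_ _) [].
  move=> p /H[C HC].
  exists ([set p' | K p' -> f p' <= C], [set C' | C <= C']).
    by split=> //=; apply: nbhs_pinfty_ge; exact: num_real.
  by move=> [p' C'] /= [h1 h2] Kp'; exact: le_trans (h1 Kp') h2.
move=> C [_ HC]; exists (C + 1) => p Kp; apply: HC => //; by rewrite ltrDl.
Qed.

Section Plane.
Variable R : realType.
Local Notation RR := (measurableTypeR R * measurableTypeR R)%type.
Local Notation l1 := (@lebesgue_measure R).
Local Notation l2 := (l1 \x l1)%E.
Local Notation rect a b c d := (`]a, b]%classic `*` `]c, d]%classic : set RR).

Definition unplane (q : 'rV[R]_2) : RR := (q 0 0, q 0 1).

Lemma unplaneK q : plane (unplane q) = q.
Proof.
apply/rowP => j; rewrite mxE; case: j => [[|[|j]] Hj] //=; congr (q _ _); exact: val_inj.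
Qed.

Lemma planeK (z : RR) : unplane (plane z) = z.
Proof. by case: z => a b; rewrite /unplane !mxE /=. Qed.

Lemma plane_dist (z w : RR) e : 0 <= e -> `|z.1 - w.1| <= e -> `|z.2 - w.2| <= e ->
  `|plane z - plane w| <= e.
Proof.
move=> e0 h1 h2; apply: rV_norm_le => // j; rewrite !mxE.
by case: ifP.
Qed.

Lemma plane_coord1 (q p : 'rV[R]_2) : `|(unplane q).1 - (unplane p).1| <= `|q - p|.
Proof. by have := rV_coord_le (q - p) 0; rewrite !mxE. Qed.

Lemma plane_coord2 (q p : 'rV[R]_2) : `|(unplane q).2 - (unplane p).2| <= `|q - p|.
Proof. by have := rV_coord_le (q - p) 1; rewrite !mxE. Qed.

(** Squares with rational centre and half side: countably many of them
    exhaust an open set. *)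
Definition rational_square (i : rat * rat * rat) : set RR :=
  rect (ratr i.1.1 - ratr i.2) (ratr i.1.1 + ratr i.2) (ratr i.1.2 - ratr i.2) (ratr i.1.2 + ratr i.2).
Definition closed_rational_square (i : rat * rat * rat) : set RR :=
  `[(ratr i.1.1 - ratr i.2), (ratr i.1.1 + ratr i.2)]%classic `*` `[(ratr i.1.2 - ratr i.2), (ratr i.1.2 + ratr i.2)]%classic.

Lemma measurable_rect (a b c d : R) : measurable (rect a b c d).
Proof. by apply: measurableX; exact: measurable_itv. Qed.

Lemma open_rational_square (U : set 'rV[R]_2) z : open U -> U (plane z) ->
  exists i, [/\ 0 < (ratr i.2 : R), closed_rational_square i `<=` (@plane R) @^-1` U & rational_square i z].
Proof.
move=> oU Uz.
have /nbhs_ballP[e /= e0 He] := open_nbhs_nbhs (conj oU Uz).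
have e2 : 0 < e / 2 by rewrite divr_gt0.
have /rat_in_itvoo[r] := e2; rewrite in_itv/= => /andP[r0 re].
have h (x : R) : x - ratr r < x + ratr r by lra.
have /rat_in_itvoo[p] := h z.1; rewrite in_itv/= => /andP[p1 p2].
have /rat_in_itvoo[q] := h z.2; rewrite in_itv/= => /andP[q1 q2].
exists (p, q, r); split=> //=; last first.
  by rewrite /rational_square /=; split => /=; rewrite in_itv /=; apply/andP; split; lra.
move=> w [/=]; rewrite !in_itv/= => /andP[w1 w2] /andP[w3 w4].
apply: He; rewrite -ball_normE /=; apply: (@le_lt_trans _ _ (ratr r + ratr r)); last lra.
by apply: plane_dist; rewrite ?ler_norml; try (apply/andP; split); lra.
Qed.

Lemma open_plane_measurable (U : set 'rV[R]_2) : open U -> measurable (@plane R @^-1` U : set RR).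
Proof.
move=> oU.
have -> : @plane R @^-1` U = \bigcup_i (if `[< closed_rational_square i `<=` (@plane R) @^-1` U >] then rational_square i else set0).
  apply/seteqP; split => [z Uz|z [i _]].
    have [i [_ iU iz]] := open_rational_square oU Uz.
    by exists i => //; case: asboolP.
  case: asboolP => // H [/=]; rewrite !in_itv/= => /andP[w1 w2] /andP[w3 w4].
  by apply: H; split => /=; rewrite in_itv/=; apply/andP; split => //; exact: ltW.
apply: countable_bigcupT_measurable; first exact: countableP.
by move=> i; case: asboolP => // _; exact: measurable_rect.
Qed.

Lemma continuous_plane_measurable (U : set 'rV[R]_2) (f : 'rV[R]_2 -> R) : open U ->
  (forall q, U q -> {for q, continuous f}) ->
  measurable_fun (@plane R @^-1` U : set RR) (fun z => f (plane z)).
Proof.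
move=> oU cf; apply: (measurability _ (RGenOInfty.measurableE R)).
move=> _ [_ [x ->] <-].
rewrite (_ : _ `&` _ = @plane R @^-1` [set q | U q /\ x < f q]); last first.
  by apply/seteqP; split => z /=; rewrite in_itv /= andbT.
apply: open_plane_measurable; rewrite openE => q [Uq xq].
rewrite /interior; near=> p; split; near: p; first exact: open_nbhs_nbhs.
by apply: cvgr_gt xq; exact: cf.
Unshelve. all: by end_near. Qed.

Lemma rect_sigma : @measurable _ RR = <<s [set X | exists a b c d : R, X = rect a b c d] >>.
Proof.
set G := [set X | _].
apply/seteqP; split; last first.
  by apply: smallest_sub; [exact: sigma_algebra_measurable|move=> _ [a [b [c [d ->]]]]; exact: measurable_rect].
pose T' := g_sigma_algebraType G.
have mid : measurable_fun setT (fun z : T' => (z.1, z.2) : RR).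
  apply: measurable_fun_pair; (apply: (measurability (@ocitv R)) => //) => _ [_ [[a b]] _ <- <-]; rewrite setTI /=.
  - rewrite (_ : _ @^-1` _ = \bigcup_n (rect a b (- n%:R) n%:R)).
      by apply: bigcupT_measurable => n; apply: sub_sigma_algebra; exists a, b, (- n%:R), n%:R.
    apply/seteqP; split => [z /= zab|z [n _ []]//].
    exists (Num.bound `|z.2|) => //; split => //=; rewrite in_itv /=.
    have := archi_boundP (normr_ge0 z.2); rewrite ltr_norml => /andP[-> /ltW]; exact.
  - rewrite (_ : _ @^-1` _ = \bigcup_n (rect (- n%:R) n%:R a b)).
      by apply: bigcupT_measurable => n; apply: sub_sigma_algebra; exists (- n%:R), n%:R, a, b.
    apply/seteqP; split => [z /= zab|z [n _ []]//].
    exists (Num.bound `|z.1|) => //; split => //=; rewrite in_itv /=.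
    have := archi_boundP (normr_ge0 z.1); rewrite ltr_norml => /andP[-> /ltW]; exact.
move=> X mX; have := mid measurableT X mX; rewrite setTI.
by rewrite (_ : _ @^-1` X = X)//; apply/seteqP; split=> -[].
Qed.

Lemma rectI (a b c d a' b' c' d' : R) :
  rect a b c d `&` rect a' b' c' d' =
  rect (Num.max a a') (Num.min b b') (Num.max c c') (Num.min d d').
Proof.
rewrite -setXI; congr (_ `*` _); apply/seteqP; split => u /=; rewrite !in_itv /= ?gt_max ?le_min.
- by move=> [/andP[-> ->] /andP[-> ->]].
- by move=> /andP[/andP[-> ->] /andP[-> ->]].
- by move=> [/andP[-> ->] /andP[-> ->]].
- by move=> /andP[/andP[-> ->] /andP[-> ->]].
Qed.

(** The rectangles form a pi-system that generates the Borel sets, so that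
    two measures that agree on small rectangles agree inside each square
    contained in U, and countably many such squares exhaust U. *)
Lemma rect_measure_unique (U : set 'rV[R]_2) (m1 m2 : {measure set RR -> \bar R}) :
  open U ->
  (forall a b c d : R, `[a, b]%classic `*` `[c, d]%classic `<=` @plane R @^-1` U ->
     (m1 (rect a b c d) = m2 (rect a b c d) /\ m1 (rect a b c d) < +oo)%E) ->
  forall S : set RR, measurable S -> S `<=` @plane R @^-1` U -> m1 S = m2 S.
Proof.
move=> oU H S mS SU.
have local i (X : set RR) : closed_rational_square i `<=` (@plane R) @^-1` U -> measurable X ->
    m1 (X `&` rational_square i) = m2 (X `&` rational_square i).
  move=> iU mX; have mq : measurable (rational_square i) by exact: measurable_rect.
  have mrect a b c d : mrestr m1 mq (rect a b c d) = mrestr m2 mq (rect a b c d) /\ (mrestr m1 mq (rect a b c d) < +oo)%E.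
    rewrite /mrestr /rational_square rectI; apply: H => -[u v] /= []; rewrite !in_itv /= !ge_max !le_min.
    move=> /andP[/andP[_ h1] /andP[_ h2]] /andP[/andP[_ h3] /andP[_ h4]].
    by apply: iU; split => /=; rewrite in_itv/= ?h1 ?h2 ?h3 ?h4.
  apply: (measure_unique [set X | exists a b c d : R, X = rect a b c d] (fun n : nat => rect (- n%:R) n%:R (- n%:R) n%:R) _ _ _ _ (mrestr m1 mq) (mrestr m2 mq)) => //.
  - exact: rect_sigma.
  - move=> _ _ [a [b [c [d ->]]]] [a' [b' [c' [d' ->]]]]; rewrite rectI.
    by do 4!eexists.
  - by move=> n; exists (- n%:R), n%:R, (- n%:R), n%:R.
  - apply/seteqP; split => // z _; exists (Num.bound (`|z.1| + `|z.2|)) => //.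
    have := archi_boundP (addr_ge0 (normr_ge0 z.1) (normr_ge0 z.2)) => hb.
    have := normr_ge0 z.1; have := normr_ge0 z.2 => h1 h2.
    have := ler_norm z.1; have := ler_norm z.2; have := ler_norm (- z.1); have := ler_norm (- z.2).
    by rewrite !normrN => *; split => /=; rewrite in_itv /=; apply/andP; split; lra.
  - by move=> _ [a [b [c [d ->]]]]; exact: (mrect a b c d).1.
  - by move=> k; exact: (mrect _ _ _ _).2.
have [pk [upk pkK]] : exists (pk : rat * rat * rat -> nat) upk, pcancel pk upk.
  by exists pickle, unpickle; exact: pickleK.
pose F (n : nat) : set RR := if upk n is Some i then if `[< closed_rational_square i `<=` (@plane R) @^-1` U >] then rational_square i else set0 else set0.
have mF n : measurable (F n).
  by rewrite /F; case: (upk n) => // i; case: asboolP => // _; exact: measurable_rect.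
have mD n : measurable (seqDU F n) by apply: measurableD => //; exact: bigsetU_measurable.
have SE : S = \bigcup_n (S `&` seqDU F n).
  rewrite -setI_bigcupr -seqDU_bigcup_eq; apply/seteqP; split => [z Sz|z []//]; split=> //.
  have [i [_ iU iz]] := open_rational_square oU (SU _ Sz).
  by exists (pk i) => //; rewrite /F pkK; case: asboolP.
have tD : trivIset setT (fun n => S `&` seqDU F n) by apply: trivIset_setIl; exact: trivIset_seqDU.
rewrite SE !measure_bigcup//; try by move=> n _; exact: measurableI.
apply: eq_eseriesr => n _.
have -> : S `&` seqDU F n = (S `&` seqDU F n) `&` F n.
  by rewrite -setIA; congr (_ `&` _); apply/esym/setIidPl; exact: subDsetl.
rewrite /F; case: (upk n) => [i|]; last by rewrite setI0 !measure0.
case: asboolP => [iU|_]; last by rewrite setI0 !measure0.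
by apply: local => //; exact: measurableI.
Qed.

End Plane.

(** * Bisection of rectangles *)

(** The number [dl x y s] stands for the value of an additive function of sets
    on the rectangle with corner (x, y) and sides w s and h s. *)
Section BisectAbstract.
Variables (R : realType) (a c w h : R) (dl : R -> R -> R -> R).
Hypotheses (w0 : 0 < w) (h0 : 0 < h).
Let inside x y s := [/\ a <= x, x + w * s <= a + w, c <= y & y + h * s <= c + h].
Hypothesis dl_add : forall x y s, 0 < s -> inside x y s ->
  dl x y s = dl x y (s / 2) + dl (x + w * (s / 2)) y (s / 2)
    + dl x (y + h * (s / 2)) (s / 2) + dl (x + w * (s / 2)) (y + h * (s / 2)) (s / 2).

Lemma bisect_limit (x : nat -> R) (l : R) : 0 < l ->
  (forall n, x n <= x n.+1) -> (forall n, x n.+1 + l * 2^-1 ^+ n.+1 <= x n + l * 2^-1 ^+ n) ->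
  exists X, forall n, x n <= X <= x n + l * 2^-1 ^+ n.
Proof.
move=> l0 inc dec.
have incr n m : (n <= m)%N -> x n <= x m.
  elim: m => [|m IH]; first by rewrite leqn0 => /eqP->.
  by rewrite leq_eqVlt => /orP[/eqP->//|]; rewrite ltnS => /IH /le_trans; apply.
have decr n m : (n <= m)%N -> x m + l * 2^-1 ^+ m <= x n + l * 2^-1 ^+ n.
  elim: m => [|m IH]; first by rewrite leqn0 => /eqP->.
  by rewrite leq_eqVlt => /orP[/eqP->//|]; rewrite ltnS => /IH; apply: le_trans.
have bound n m : x m <= x n + l * 2^-1 ^+ n.
  apply: (@le_trans _ _ (x (maxn n m))); first by apply: incr; exact: leq_maxr.
  apply: (le_trans _ (decr n (maxn n m) (leq_maxl _ _))).
  by rewrite lerDl mulr_ge0 ?exprn_ge0// ltW.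
have ub n : ubound (range x) (x n + l * 2^-1 ^+ n) by move=> _ [m _ <-].
have hs : has_sup (range x) by split; [exists (x 0%N), 0%N|exists (x 0%N + l * 2^-1 ^+ 0)].
exists (sup (range x)) => n; apply/andP; split.
  by apply: ub_le_sup; [exact: hs.2|exists n].
by apply: ge_sup; [exact: hs.1|exact: ub].
Qed.

(** One of the four quarters of a rectangle carries at least a quarter of
    the value of an additive function. Iterating this choice gives nested
    rectangles that shrink to a point (X, Y) and on which the function is at
    least proportional to the area. *)
Lemma bisection : dl a c 1 != 0 ->
  exists X Y, [/\ a <= X <= a + w, c <= Y <= c + h & forall n, exists x y,
    [/\ inside x y (2^-1 ^+ n), x <= X <= x + w * 2^-1 ^+ n, y <= Y <= y + h * 2^-1 ^+ n
      & `|dl a c 1| * (2^-1 ^+ n) ^+ 2 <= `|dl x y (2^-1 ^+ n)|]].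
Proof.
move=> d0.
have step (np : nat * (R * R)) : exists p' : R * R, inside np.2.1 np.2.2 (2^-1 ^+ np.1) ->
   [/\ inside p'.1 p'.2 (2^-1 ^+ np.1.+1),
     np.2.1 <= p'.1 /\ p'.1 + w * 2^-1 ^+ np.1.+1 <= np.2.1 + w * 2^-1 ^+ np.1,
     np.2.2 <= p'.2 /\ p'.2 + h * 2^-1 ^+ np.1.+1 <= np.2.2 + h * 2^-1 ^+ np.1 &
     `|dl np.2.1 np.2.2 (2^-1 ^+ np.1)| <= 4 * `|dl p'.1 p'.2 (2^-1 ^+ np.1.+1)|].
  case: np => n [x y] /=.
  have [ins|] := pselect (inside x y (2^-1 ^+ n)); last by exists (0, 0).
  have s0 : 0 < 2^-1 ^+ n :> R by rewrite exprn_gt0.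
  have := dl_add s0 ins.
  rewrite exprS [2^-1 * _]mulrC; set t := (2^-1 ^+ n / 2 : R).
  have tE : 2^-1 ^+ n = t + t :> R by rewrite -splitr.
  have t0 : 0 < t by rewrite divr_gt0.
  have [i1 i2 i3 i4] := ins; rewrite tE in i2 i4 *.
  have wt : 0 < w * t by rewrite mulr_gt0.
  have ht : 0 < h * t by rewrite mulr_gt0.
  rewrite !mulrDr in i2 i4 * => E.
  have [H1|H1] := leP `|dl x y (t + t)| (4 * `|dl x y t|).
    by exists (x, y) => _; split => //=; do ?split; lra.
  have [H2|H2] := leP `|dl x y (t + t)| (4 * `|dl (x + w * t) y t|).
    by exists (x + w * t, y) => _; split => //=; do ?split; lra.
  have [H3|H3] := leP `|dl x y (t + t)| (4 * `|dl x (y + h * t) t|).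
    by exists (x, y + h * t) => _; split => //=; do ?split; lra.
  exists (x + w * t, y + h * t) => _; split => //=; do ?split; try lra.
  have := ler_normD (dl x y t + dl (x + w * t) y t + dl x (y + h * t) t) (dl (x + w * t) (y + h * t) t).
  have := ler_normD (dl x y t + dl (x + w * t) y t) (dl x (y + h * t) t).
  have := ler_normD (dl x y t) (dl (x + w * t) y t).
  rewrite -E; lra.
have [f Hf] := choice step.
pose p := fix p n := if n is n'.+1 then f (n', p n') else (a, c).
have pins n : inside (p n).1 (p n).2 (2^-1 ^+ n).
  elim: n => [|n IH] /=; first by rewrite expr0 /inside !mulr1; split.
  by have [] := Hf (n, p n) IH.
have pstep n := Hf (n, p n) (pins n).
have [X HX] : exists X, forall n, (p n).1 <= X <= (p n).1 + w * 2^-1 ^+ n.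
  by apply: bisect_limit => // n; have [_ [? ?] _ _] := pstep n.
have [Y HY] : exists Y, forall n, (p n).2 <= Y <= (p n).2 + h * 2^-1 ^+ n.
  by apply: bisect_limit => // n; have [_ _ [? ?] _] := pstep n.
exists X, Y; split.
- by have := HX 0%N; rewrite expr0 mulr1.
- by have := HY 0%N; rewrite expr0 mulr1.
move=> n; exists (p n).1, (p n).2; split => //.
elim: n => [|n IH]; first by rewrite expr0 expr1n mulr1.
have [_ _ _ /=] := pstep n.
have E : 2^-1 ^+ n.+1 = 2^-1 * 2^-1 ^+ n :> R by rewrite exprS.
rewrite -[(p n.+1).1]/(f (n, p n)).1 -[(p n.+1).2]/(f (n, p n)).2.
move: IH; rewrite E; move: (2^-1 ^+ n : R) => s H1 H2.
have := le_trans H1 H2; move: `|dl _ _ _| `|dl a c 1| => u v.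
rewrite (_ : v * (2^-1 * s) ^+ 2 = v * s ^+ 2 / 4); last by field.
by rewrite ler_pdivrMr// [u * _]mulrC.
Qed.

End BisectAbstract.

(** * Change of variables in the plane *)

Section Density.
Variables (R : realType).
Local Notation RR := (measurableTypeR R * measurableTypeR R)%type.
Local Notation l1 := (@lebesgue_measure R).
Local Notation l2 := (l1 \x l1)%E.
Variable u : RR -> R.
Hypotheses (mu_ : measurable_fun setT u) (u0 : forall z, 0 <= u z).
Local Open Scope ereal_scope.

Definition mdens (S : set RR) : \bar R := \int[l2]_(z in S) (u z)%:E.

Let mdens0 : mdens set0 = 0. Proof. by rewrite /mdens integral_set0. Qed.
Let mdens_ge0 S : 0 <= mdens S.
Proof. by apply: integral_ge0 => z _; rewrite lee_fin. Qed.
Let mdens_sigma : semi_sigma_additive mdens.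
Proof.
move=> F mF tF mUF; rewrite /mdens ge0_integral_bigcup//; last 2 first.
- by apply/measurable_EFinP; exact: measurable_funTS.
- by move=> z _; rewrite lee_fin.
apply: is_cvg_ereal_nneg_natsum_cond => n _ _; exact: mdens_ge0.
Qed.
HB.instance Definition _ := isMeasure.Build _ _ _ mdens mdens0 mdens_ge0 mdens_sigma.
Definition mdens_measure : {measure set RR -> \bar R} := mdens.
End Density.

Section RectMeasure.
Variables (R : realType).
Local Notation RR := (measurableTypeR R * measurableTypeR R)%type.
Local Notation l1 := (@lebesgue_measure R).
Local Notation l2 := (l1 \x l1)%E.

Definition rect (a b c d : R) : set RR := `]a, b]%classic `*` `]c, d]%classic.

Lemma l2_rect a b c d : a <= b -> c <= d -> l2 (rect a b c d) = ((b - a) * (d - c))%:E.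
Proof.
move=> ab cd; rewrite /rect.
transitivity (l1 `]a, b]%classic * l1 `]c, d]%classic)%E.
  by apply: product_measure1E; exact: measurable_itv.
rewrite !lebesgue_measure_itv/= !lte_fin.
move: ab cd; rewrite !le_eqVlt => /orP[/eqP->|ab] /orP[/eqP->|cd]; rewrite ?ltxx ?subrr ?mul0r ?mulr0 ?mul0e ?mule0//.
by rewrite ab cd -!EFinB -EFinM.
Qed.

Lemma measure_itv_split (m : {measure set RR -> \bar R}) (a b c d e f : R) :
  a <= b <= c -> d <= e <= f -> (m (rect a c d f) < +oo)%E ->
  fine (m (rect a c d f)) = fine (m (rect a b d e)) + fine (m (rect b c d e))
   + fine (m (rect a b e f)) + fine (m (rect b c e f)).
Proof.
move=> /andP[ab bc] /andP[de ef] fin.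
have mr w x y z : measurable (rect w x y z) by exact: measurable_rect.
have sub (X : set RR) : measurable X -> X `<=` rect a c d f -> m X \is a fin_num.
  move=> mX XA; rewrite ge0_fin_numE//; apply: le_lt_trans fin.
  by apply: le_measure; rewrite ?inE.
have E1 : rect a c d f = (rect a b d e `|` rect b c d e) `|` (rect a b e f `|` rect b c e f).
  apply/seteqP; split => [[x y] /= []|[x y] /=]; rewrite /rect /= !in_itv/=.
    move=> /andP[x1 x2] /andP[y1 y2].
    rewrite x1 x2 y1 y2 /= !andbT; case: (leP x b); case: (leP y e) => ? ?; by [left; left|left; right|right; left|right; right].
  by case=> -[] [/andP[x1 x2] /andP[y1 y2]]; split; apply/andP; split => //; lra.
rewrite E1 measureU; [|exact: measurableU|exact: measurableU|]; last first.
  by apply/seteqP; split => [[x y] /=|//]; rewrite /rect /= !in_itv/= => -[[] [? /andP[? ?]] [] [? /andP[? ?]]]; lra.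
rewrite measureU//; last first.
  by apply/seteqP; split => [[x y] /=|//]; rewrite /rect /= !in_itv/= => -[[/andP[? ?] ?] [/andP[? ?] ?]]; lra.
rewrite measureU//; last first.
  by apply/seteqP; split => [[x y] /=|//]; rewrite /rect /= !in_itv/= => -[[/andP[? ?] ?] [/andP[? ?] ?]]; lra.
have f1 : m (rect a b d e) \is a fin_num by apply: sub => //; rewrite E1 => z Hz; left; left.
have f2 : m (rect b c d e) \is a fin_num by apply: sub => //; rewrite E1 => z Hz; left; right.
have f3 : m (rect a b e f) \is a fin_num by apply: sub => //; rewrite E1 => z Hz; right; left.
have f4 : m (rect b c e f) \is a fin_num by apply: sub => //; rewrite E1 => z Hz; right; right.
by rewrite fineD ?fin_numD ?f1 ?f2 ?f3 ?f4// !fineD// addrA.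
Qed.
End RectMeasure.

Section Ext.
Context d d' (T : measurableType d) (T' : measurableType d').
Lemma measurable_ext (D : set T) (f : T -> T') (c : T') : measurable D ->
  measurable_fun D f -> measurable_fun setT (fun z => if z \in D then f z else c).
Proof.
move=> mD mf _ Y mY; rewrite setTI.
have [cY|cY] := pselect (Y c).
  rewrite (_ : _ @^-1` _ = (D `&` f @^-1` Y) `|` ~` D).
    by apply: measurableU; [exact: mf|exact: measurableC].
  apply/seteqP; split=> z /=; case: ifPn => [/set_mem Dz|/negP nD].
  - by left.
  - by right=> Dz; apply: nD; exact: mem_set.
  - by case=> [[]|].
  - by case=> [[Dz _]|]; [case: nD; exact: mem_set|].
rewrite (_ : _ @^-1` _ = (D `&` f @^-1` Y)); first exact: mf.
apply/seteqP; split=> z /=; case: ifPn => [/set_mem Dz|/negP nD]; first by [].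
- by move/cY.
- by case.
- by case=> Dz; case: nD; exact: mem_set.
Qed.
End Ext.

Section CoV.
Variables (R : realType).
Local Notation RR := (measurableTypeR R * measurableTypeR R)%type.
Local Notation l1 := (@lebesgue_measure R).
Local Notation l2 := (l1 \x l1)%E.

Lemma mdens_le (f : RR -> R) (S : set RR) C : measurable_fun setT f -> (forall z, 0 <= f z) ->
  measurable S -> (forall z, S z -> f z <= C) -> (mdens f S <= C%:E * l2 S)%E.
Proof.
move=> mf f0 mS fC; rewrite /mdens -integral_cst//; apply: ge0_le_integral => //.
- by move=> z _; rewrite lee_fin.
- by apply/measurable_EFinP; exact: measurable_funTS.
Qed.

Lemma mdens_ge (f : RR -> R) (S : set RR) C : measurable_fun setT f -> (forall z, 0 <= f z) ->
  measurable S -> (forall z, S z -> C <= f z) -> (C%:E * l2 S <= mdens f S)%E.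
Proof.
move=> mf f0 mS fC; have [C0|C0] := leP 0 C.
  rewrite /mdens -integral_cst//; apply: ge0_le_integral => //.
  by apply/measurable_EFinP; exact: measurable_funTS.
apply: (@le_trans _ _ 0%E); first by rewrite mule_le0_ge0// lee_fin ltW.
by apply: integral_ge0 => z _; rewrite lee_fin.
Qed.

Lemma det22 (A : 'M[R]_2) : \det A = A 0 0 * A 1 1 - A 0 1 * A 1 0.
Proof.
rewrite (expand_det_row _ 0) !big_ord_recl big_ord0 /cofactor !det_mx11 !mxE /=.
have -> : lift ord0 ord0 = 1 :> 'I_2 by exact: val_inj.
have -> : lift 1 0 = 0 :> 'I_2 by exact: val_inj.
by rewrite /bump /= expr0 expr1 mul1r addr0 mulN1r mulrN.
Qed.

Lemma rect_near (p z : RR) x y w h s : 0 < w * s -> 0 < h * s ->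
  x <= p.1 <= x + w * s -> y <= p.2 <= y + h * s ->
  rect x (x + w * s) y (y + h * s) z -> `|plane z - plane p| <= s * (w + h).
Proof.
move=> ws hs /andP[? ?] /andP[? ?]; rewrite /rect /= !in_itv/= => -[/andP[z1 z2] /andP[z3 z4]].
apply: plane_dist; first by rewrite mulrDr ![s * _]mulrC; lra.
- by rewrite ler_norml; apply/andP; split; lra.
- by rewrite ler_norml; apply/andP; split; lra.
Qed.

Lemma plane_coords (z z' : RR) e : `|plane z - plane z'| <= e ->
  [/\ z'.1 - e <= z.1, z.1 <= z'.1 + e, z'.2 - e <= z.2 & z.2 <= z'.2 + e].
Proof.
move=> H; have := plane_coord1 (plane z) (plane z'); have := plane_coord2 (plane z) (plane z').
rewrite !planeK => /le_trans /(_ H) + /le_trans /(_ H).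
by rewrite !ler_norml => /andP[? ?] /andP[? ?]; split; lra.
Qed.

Lemma l2_rectD x y w h e : 0 <= w + 2 * e -> 0 <= h + 2 * e ->
  l2 (rect (x - e) (x + w + e) (y - e) (y + h + e)) = ((w + 2 * e) * (h + 2 * e))%:E.
Proof. by move=> w0 h0; rewrite l2_rect; [congr (_%:E); ring|lra|lra]. Qed.

Lemma l2_rectB x y w h e : 0 <= w - 2 * e -> 0 <= h - 2 * e ->
  l2 (rect (x + e) (x + w - e) (y + e) (y + h - e)) = ((w - 2 * e) * (h - 2 * e))%:E.
Proof. by move=> w0 h0; rewrite l2_rect; [congr (_%:E); ring|lra|lra]. Qed.

Lemma l2_rect0 x y w h : 0 <= w -> 0 <= h -> l2 (rect x (x + w) y (y + h)) = (w * h)%:E.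
Proof. by move=> w0 h0; rewrite l2_rect; [congr (_%:E); ring|lra|lra]. Qed.

Lemma rect_empty (a b c d : R) : b <= a \/ d <= c -> rect a b c d = set0.
Proof.
move=> H; apply/seteqP; split => // z []; rewrite /= !in_itv/= => /andP[? ?] /andP[? ?].
by case: H => ?; lra.
Qed.

Lemma rect_sub (a b c d a' b' c' d' : R) : a' <= a -> b <= b' -> c' <= c -> d <= d' ->
  rect a b c d `<=` rect a' b' c' d'.
Proof.
move=> ? ? ? ? z; rewrite /rect /= !in_itv/= => -[/andP[? ?] /andP[? ?]].
by split; apply/andP; split; lra.
Qed.

Lemma quarter_le (e a : R) : 0 < e -> 4 * e <= a -> 0 <= a - 2 * e.
Proof. lra. Qed.

Lemma rect_grow (z z' : RR) x y w h e : `|plane z - plane z'| <= e ->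
  rect x (x + w) y (y + h) z' -> 0 < e -> rect (x - e) (x + w + e) (y - e) (y + h + e) z.
Proof.
move=> /plane_coords[? ? ? ?]; rewrite /rect /= !in_itv/= => -[/andP[? ?] /andP[? ?]] ?.
by split; apply/andP; split; lra.
Qed.

Lemma rect_shrink (z z' : RR) x y w h e : `|plane z - plane z'| <= e ->
  rect (x + e) (x + w - e) (y + e) (y + h - e) z' -> rect x (x + w) y (y + h) z.
Proof.
move=> /plane_coords[? ? ? ?]; rewrite /rect /= !in_itv/= => -[/andP[? ?] /andP[? ?]].
by split; apply/andP; split; lra.
Qed.

(** The bookkeeping of [local_density]: a and b are both
    v D s w h up to a term of order e s. *)
Lemma density_estimate (v D s w h e a b : R) : 0 <= v -> 0 < D -> 0 < s -> 0 < w -> 0 < h ->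
  0 < e -> e <= 1 -> 4 * e <= w -> 4 * e <= h ->
  (v * D - e) * (s * (w * h)) <= a -> a <= (v * D + e) * (s * (w * h)) ->
  (v - e) * (D * (s * ((w - 2 * e) * (h - 2 * e)))) <= b ->
  b <= (v + e) * (D * (s * ((w + 2 * e) * (h + 2 * e)))) ->
  `|a - b| <= e * (w * h + D * (v * (2 * (w + h) + 4) + (w + 2) * (h + 2))) * s.
Proof.
move=> v0 D0 s0 w0 h0 e0 e1 ew eh a1 a2 b1 b2.
have sD : 0 <= s * D * e by rewrite !mulr_ge0// ltW.
have E1 : (v + e) * (D * (s * ((w + 2 * e) * (h + 2 * e)))) =
   s * (v * D * (w * h)) + s * (e * (D * (v * (2 * (w + h) + 4) + (w + 2) * (h + 2))))
   - s * D * e * (4 * v * (1 - e) + (2 * (1 - e) * (w + h) + 4 * (1 - e) * (1 + e))).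
  by ring.
have E2 : (v - e) * (D * (s * ((w - 2 * e) * (h - 2 * e)))) =
   s * (v * D * (w * h)) - s * (e * (D * (v * (2 * (w + h) + 4) + (w + 2) * (h + 2))))
   + s * D * e * (4 * v + 4 * e * v + (2 * (w + h) * (1 + e) + 4 * (1 - e) * (1 + e))).
  by ring.
have e1' : 0 <= 1 - e by rewrite subr_ge0.
have e2' : 0 <= 1 + e by rewrite addr_ge0// ltW.
have wh : 0 <= w + h by rewrite addr_ge0// ltW.
have P1 : 0 <= s * D * e * (4 * v * (1 - e) + (2 * (1 - e) * (w + h) + 4 * (1 - e) * (1 + e))).
  by rewrite mulr_ge0// !addr_ge0// !mulr_ge0.
have P2 : 0 <= s * D * e * (4 * v + 4 * e * v + (2 * (w + h) * (1 + e) + 4 * (1 - e) * (1 + e))).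
  by rewrite mulr_ge0// !addr_ge0// ?mulr_ge0// ltW.
have E3 : e * (w * h + D * (v * (2 * (w + h) + 4) + (w + 2) * (h + 2))) * s =
  e * (s * (w * h)) + s * (e * (D * (v * (2 * (w + h) + 4) + (w + 2) * (h + 2)))) by ring.
have E4 : (v * D - e) * (s * (w * h)) = s * (v * D * (w * h)) - e * (s * (w * h)) by ring.
have E5 : (v * D + e) * (s * (w * h)) = s * (v * D * (w * h)) + e * (s * (w * h)) by ring.
rewrite E4 in a1; rewrite E5 in a2; rewrite E1 in b2; rewrite E2 in b1; rewrite E3 ler_norml.
move: P1 P2 a1 a2 b1 b2.
move: (s * D * e * _) (s * D * e * _) (s * (e * _)) => X Y Z.
move: (s * (v * D * _)) (e * (s * _)) => P Q *.
by apply/andP; split; lra.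
Qed.

Lemma aff_plane (B : 'M[R]_2) (t : 'rV[R]_2) (z : RR) :
  plane (aff (B 0 0) (B 1 0) (B 0 1) (B 1 1) (t 0 0) (t 0 1) z) = plane z *m B + t.
Proof.
apply/rowP => j; rewrite !mxE /= !big_ord_recl big_ord0 !mxE /=.
have -> : lift ord0 ord0 = 1 :> 'I_2 by exact: val_inj.
case: j => [[|[|j]] Hj] //=.
- have -> : Ordinal Hj = 0 :> 'I_2 by exact: val_inj.
  by rewrite [B 0 0 * _]mulrC [B 1 0 * _]mulrC addr0.
- have -> : Ordinal Hj = 1 :> 'I_2 by exact: val_inj.
  by rewrite [B 0 1 * _]mulrC [B 1 1 * _]mulrC addr0.
Qed.

Variables (U V : set 'rV[R]_2) (psi chi : 'rV[R]_2 -> 'rV[R]_2) (u v : 'rV[R]_2 -> R).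
Hypotheses (oU : open U) (oV : open V).
Hypotheses (psiV : forall q, U q -> V (psi q)) (chiU : forall r, V r -> U (chi r)).
Hypotheses (psiK : forall q, U q -> chi (psi q) = q) (chiK : forall r, V r -> psi (chi r) = r).
Hypotheses (dpsi : forall q, U q -> differentiable psi q) (dchi : forall r, V r -> differentiable chi r).
Hypotheses (cu : forall q, U q -> {for q, continuous u}) (cv : forall q, V q -> {for q, continuous v}).
Hypotheses (u0 : forall q, U q -> 0 <= u q) (v0 : forall q, V q -> 0 <= v q).
Hypothesis uv : forall q, U q -> u q = v (psi q) * `|\det ('J psi q)|.

Local Notation U' := (@plane R @^-1` U : set RR).
Local Notation V' := (@plane R @^-1` V : set RR).
(** Extensions by a default value outside of the open sets, so that
    measures on the whole plane can be compared. *)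
Definition u_ext (z : RR) := if z \in U' then u (plane z) else 0.
Definition v_ext (z : RR) := if z \in V' then v (plane z) else 0.
Definition chi_ext (z : RR) : RR := if z \in V' then unplane (chi (plane z)) else (0, 0).

Let mU' : measurable U'. Proof. exact: open_plane_measurable. Qed.
Let mV' : measurable V'. Proof. exact: open_plane_measurable. Qed.
Lemma measurable_u_ext : measurable_fun setT u_ext.
Proof. by apply: measurable_ext => //; exact: continuous_plane_measurable. Qed.
Lemma measurable_v_ext : measurable_fun setT v_ext.
Proof. by apply: measurable_ext => //; exact: continuous_plane_measurable. Qed.
Lemma u_ext_ge0 z : 0 <= u_ext z. Proof. by rewrite /u_ext; case: ifPn => // /set_mem; exact: u0. Qed.
Lemma v_ext_ge0 z : 0 <= v_ext z. Proof. by rewrite /v_ext; case: ifPn => // /set_mem; exact: v0. Qed.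

Lemma measurable_chi_ext : measurable_fun setT chi_ext.
Proof.
have cc i q : V q -> {for q, continuous (fun q => chi q 0 i)}.
  move=> Vq; have /differentiable_continuous cq := dchi Vq.
  by apply: (@continuous_comp _ _ _ chi (fun w : 'rV[R]_2 => w 0 i)) => //; exact: coord_continuous.
have -> : chi_ext = (fun z => (if z \in V' then chi (plane z) 0 0 else 0, if z \in V' then chi (plane z) 0 1 else 0)).
  by apply/funext => z; rewrite /chi_ext /unplane; case: ifP.
have mcc i : measurable_fun V' (fun z => chi (plane z) 0 i).
  exact: (continuous_plane_measurable (f := fun q => chi q 0 i) oV (cc i)).
have m0 : measurable_fun setT (fun z : RR => (if z \in V' then chi (plane z) 0 0 else 0) : measurableTypeR R).
  exact: (measurable_ext (f := fun z => chi (plane z) 0 0 : measurableTypeR R) 0 mV' (mcc 0)).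
have m1 : measurable_fun setT (fun z : RR => (if z \in V' then chi (plane z) 0 1 else 0) : measurableTypeR R).
  exact: (measurable_ext (f := fun z => chi (plane z) 0 1 : measurableTypeR R) 0 mV' (mcc 1)).
exact: (measurable_fun_pair m0 m1).
Qed.

Lemma jacobian_inv q : U q -> 'J psi q *m 'J chi (psi q) = 1%:M.
Proof.
move=> Uq; apply/row_matrixP => i; rewrite !rowE mulmxA -!diffJ.
have d1 := dpsi Uq; have d2 := dchi (psiV Uq).
have E := diff_comp d1 d2.
rewrite -[LHS]/(('d chi (psi q) \o 'd psi q) (delta_mx 0 i)) -E.
rewrite -deriveE; last exact: differentiable_comp.
rewrite (@near_eq_derive _ _ _ _ id) ?derive_id ?mulmx1//.
by apply: filterS (open_nbhs_nbhs (conj oU Uq)) => b Ub /=; exact: psiK.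
Qed.

Definition rho : {measure set RR -> \bar R} := mdens_measure measurable_u_ext u_ext_ge0.
Definition nu : {measure set RR -> \bar R} :=
  measure_function_pushforward__canonical__measure_function_Measure (mdens_measure measurable_v_ext v_ext_ge0) measurable_chi_ext.

Lemma rhoE S : rho S = mdens u_ext S. Proof. by []. Qed.
Lemma nuE S : nu S = mdens v_ext (chi_ext @^-1` S). Proof. by []. Qed.

Lemma measurable_chi_ext_preimage S : measurable S -> measurable (chi_ext @^-1` S).
Proof. by move=> mS; rewrite -[X in measurable X]setTI; exact: measurable_chi_ext. Qed.

Lemma nuE' S : measurable S -> nu S = mdens v_ext (chi_ext @^-1` S `&` V').
Proof.
move=> mS; rewrite nuE /mdens integral_mkcondr; apply: eq_integral => z _.
by rewrite patchE /v_ext; case: ifP.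
Qed.

(** Near q0 the map chi differs from its affine approximation g by at most
    eta s. Hence the preimage of the rectangle Q by chi lies between the
    preimages by g of the shrunk rectangle Qm and of the grown rectangle Qp,
    whose areas are known. As u and v are almost constant, the leading terms
    cancel by the relation between u and v. *)
Lemma local_density (p0 : RR) w h k : U (plane p0) -> 0 < w -> 0 < h -> 0 < k ->
  exists2 s0, 0 < s0 & forall s x y, 0 < s < s0 ->
    x <= p0.1 <= x + w * s -> y <= p0.2 <= y + h * s ->
    `|fine (rho (rect x (x + w * s) y (y + h * s))) - fine (nu (rect x (x + w * s) y (y + h * s)))| <= k * s ^+ 2.
Proof.
move=> Uq0 w0 h0 k0; set q0 := plane p0 in Uq0; pose r0 := psi q0.
have Vr0 : V r0 := psiV Uq0.
have [A eA] : exists A, A = 'J psi q0 := ex_intro _ _ erefl.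
have [B eB] : exists B, B = 'J chi r0 := ex_intro _ _ erefl.
have AB : A *m B = 1%:M by rewrite eA eB; exact: jacobian_inv Uq0.
have BA : B *m A = 1%:M by exact: mulmx1C.
have [uA uB] := mulmx1_unit AB.
have detAB : \det A * \det B = 1 by rewrite -det_mulmx AB det1.
have A0 : \det A != 0 by rewrite -unitfE -unitmxE.
have B0 : \det B != 0 by rewrite -unitfE -unitmxE.
pose D := `|\det A|.
have D0 : 0 < D by rewrite normr_gt0.
have uE : u q0 = v r0 * D by rewrite /D eA; exact: uv.
have vr0 : 0 <= v r0 by exact: v0.
have [kA kA0 HA] := mulmx_norm_le A.
have [kB kB0 HB] := mulmx_norm_le B.
pose C := w * h + D * (v r0 * (2 * (w + h) + 4) + (w + 2) * (h + 2)).
have C0 : 0 < C.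
  have c1 : 0 < (w + 2) * (h + 2) by rewrite mulr_gt0// addr_gt0.
  have c2 : 0 <= v r0 * (2 * (w + h) + 4) by rewrite mulr_ge0//; lra.
  have c3 : 0 < D * (v r0 * (2 * (w + h) + 4) + (w + 2) * (h + 2)) by rewrite mulr_gt0// ltr_wpDl.
  by rewrite /C addr_gt0// mulr_gt0.
(* eta is small enough for [density_estimate] to give the bound k *)
pose eta := Num.min (Num.min 1 (k / C)) (Num.min (w / 4) (h / 4)).
have eta0 : 0 < eta by rewrite !lt_min ltr01 !divr_gt0.
have [e1 ek ew eh] : [/\ eta <= 1, eta * C <= k, 4 * eta <= w & 4 * eta <= h].
  rewrite -ler_pdivlMr// ![4 * _]mulrC -!ler_pdivlMr//.
  by split; rewrite /eta !ge_min lexx ?orbT.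
have S0 : 0 < w + h by exact: addr_gt0.
pose eps := eta / (kB * (w + h)); pose eps' := eta / (kA * (w + h)).
have eps0 : 0 < eps by rewrite divr_gt0// mulr_gt0.
have eps'0 : 0 < eps' by rewrite divr_gt0// mulr_gt0.
have : \forall q \near q0, [/\ U q, `|u q0 - u q| <= eta & `|psi q - psi q0 - (q - q0) *m A| <= eps * `|q - q0|].
  near=> q; split; near: q; first exact: open_nbhs_nbhs.
  - by have /cvgrPdist_le := cu Uq0; apply.
  - by rewrite eA; exact: diffJ_bound (dpsi Uq0) eps0.
move=> /nbhs_ballP[ra /= ra0 Ha].
have : \forall r \near r0, [/\ V r, `|v r0 - v r| <= eta & `|chi r - chi r0 - (r - r0) *m B| <= eps' * `|r - r0|].
  near=> r; split; near: r; first exact: open_nbhs_nbhs.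
  - by have /cvgrPdist_le := cv Vr0; apply.
  - by rewrite eB; exact: diffJ_bound (dchi Vr0) eps'0.
move=> /nbhs_ballP[rb /= rb0 Hb].
have chir0 : chi r0 = q0 := psiK Uq0.
(* for s < t the images of points of Q stay in the ball of radius rb around r0 *)
pose t := Num.min (ra / (w + h)) (rb / ((kA + eps) * (w + h))).
have kAe : 0 < kA + eps by exact: addr_gt0.
exists t; first by rewrite lt_min !divr_gt0// mulr_gt0.
move=> s x y /andP[s0]; rewrite lt_min !ltr_pdivlMr ?mulr_gt0// => /andP[sa sb] xp yp.
set Q := rect _ _ _ _.
have ws : 0 < w * s by exact: mulr_gt0.
have hs : 0 < h * s by exact: mulr_gt0.
have mQ : measurable Q by exact: measurable_rect.
have near_q0 z : Q z -> `|plane z - q0| <= s * (w + h).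
  exact: rect_near.
have inball z : Q z -> ball q0 ra (plane z).
  by move=> /near_q0 Hz; rewrite -ball_normE /= distrC; apply: le_lt_trans Hz _.
have s20 : 0 < s ^+ 2 by exact: exprn_gt0.
have l2Q : l2 Q = (s ^+ 2 * (w * h))%:E.
  by rewrite /Q l2_rect0 ?(ltW ws) ?(ltW hs)//; congr (_%:E); ring.
have rhoU : (rho Q <= ((u q0 + eta) * (s ^+ 2 * (w * h)))%:E)%E.
  rewrite rhoE EFinM -l2Q; apply: mdens_le => //; [exact: measurable_u_ext|exact: u_ext_ge0|].
  move=> z /inball /Ha [Uz h1 _]; rewrite /u_ext mem_set//; move: h1; rewrite ler_norml => /andP[? ?]; lra.
have rhoL : (((u q0 - eta) * (s ^+ 2 * (w * h)))%:E <= rho Q)%E.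
  rewrite rhoE EFinM -l2Q; apply: mdens_ge => //; [exact: measurable_u_ext|exact: u_ext_ge0|].
  move=> z /inball /Ha [Uz h1 _]; rewrite /u_ext mem_set//; move: h1; rewrite ler_norml => /andP[? ?]; lra.
(* the affine approximation of chi at r0 *)
pose tr := q0 - r0 *m B.
pose g := @aff R (B 0 0) (B 1 0) (B 0 1) (B 1 1) (tr 0 0) (tr 0 1).
have gE z : plane (g z) = q0 + (plane z - r0) *m B.
  by rewrite aff_plane /tr mulmxBl addrCA.
have l2g X : measurable X -> l2 (g @^-1` X) = (D%:E * l2 X)%E.
  move=> mX; rewrite l2_aff//; last by move: B0; rewrite det22 [B 0 1 * _]mulrC.
  congr (_ * _)%E; congr (_%:E); rewrite [B 1 0 * _]mulrC -det22 /D.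
  by rewrite -[LHS]mul1r -[X in X / _]normr1 -detAB normrM mulfK// normr_eq0.
have mg X : measurable X -> measurable (g @^-1` X) by exact: measurable_aff_pre.
pose Qp := rect (x - eta * s) (x + w * s + eta * s) (y - eta * s) (y + h * s + eta * s).
pose Qm := rect (x + eta * s) (x + w * s - eta * s) (y + eta * s) (y + h * s - eta * s).
have es : 0 < eta * s by exact: mulr_gt0.
have ews : 4 * (eta * s) <= w * s by rewrite mulrA ler_wpM2r// ltW.
have ehs : 4 * (eta * s) <= h * s by rewrite mulrA ler_wpM2r// ltW.
have l2Qp : l2 Qp = (s ^+ 2 * ((w + 2 * eta) * (h + 2 * eta)))%:E.
  by rewrite /Qp l2_rectD; [congr (_%:E); ring|rewrite addr_ge0// ?ltW// mulr_gt0|rewrite addr_ge0// ?ltW// mulr_gt0].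
have l2Qm : l2 Qm = (s ^+ 2 * ((w - 2 * eta) * (h - 2 * eta)))%:E.
  by rewrite /Qm l2_rectB; [congr (_%:E); ring|exact: quarter_le|exact: quarter_le].
have upper z : (chi_ext @^-1` Q `&` V') z -> (g @^-1` Qp) z /\ `|v r0 - v (plane z)| <= eta.
  move=> [/= + Vz]; rewrite /chi_ext mem_set// => Qz.
  have [Uq _ Hq] := Ha _ (inball _ Qz); rewrite unplaneK in Hq Uq.
  have qs := near_q0 _ Qz; rewrite unplaneK in qs.
  rewrite chiK // -/r0 in Hq.
  set q := chi (plane z) in Qz Hq Uq qs.
  have gz : plane (g z) - plane (unplane q) = (plane z - r0 - (q - q0) *m A) *m B.
    by rewrite gE unplaneK [in RHS]mulmxBl -mulmxA AB mulmx1 opprB addrCA addrA addrAC.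
  split.
    apply: (@rect_grow _ (unplane q)) => //.
    rewrite gz (le_trans (HB _))//.
    apply: (@le_trans _ _ (kB * (eps * (s * (w + h))))).
      by rewrite ler_pM2l// (le_trans Hq)// ler_pM2l.
    rewrite /eps le_eqVlt; apply/orP; left; apply/eqP; field.
    by rewrite !gt_eqF.
  suff /Hb [] : ball r0 rb (plane z) by [].
  rewrite -ball_normE /= distrC -[plane z - r0](subrK ((q - q0) *m A)).
  rewrite (le_lt_trans (ler_normD _ _))//.
  apply: (@le_lt_trans _ _ (eps * (s * (w + h)) + kA * (s * (w + h)))).
    by rewrite lerD// ?(le_trans Hq)// ?(le_trans (HA _))// ler_pM2l.
  by rewrite -mulrDl addrC mulrCA.
have lower z : (g @^-1` Qm) z -> [/\ V (plane z), Q (chi_ext z) & `|v r0 - v (plane z)| <= eta].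
  move=> Qz; set q' := g z in Qz; have q'E := gE z; rewrite -/q' in q'E.
  have QQ' : Q q' by apply: rect_shrink Qz; rewrite subrr normr0 ltW.
  have rE : plane z - r0 = (plane q' - q0) *m A.
    have -> : plane q' - q0 = (plane z - r0) *m B by rewrite q'E addrC addKr.
    by rewrite -mulmxA BA mulmx1.
  have rs : `|plane z - r0| <= kA * (s * (w + h)).
    by rewrite rE (le_trans (HA _))// ler_pM2l// near_q0.
  have zb : ball r0 rb (plane z).
    rewrite -ball_normE /= distrC (le_lt_trans rs)// (le_lt_trans _ sb)// mulrCA ler_pM2l//.
    by rewrite ler_pM2r// lerDl ltW.
  have [Vz hv Hz] := Hb _ zb; split => //; rewrite /chi_ext mem_set//.
  apply: rect_shrink Qz; rewrite unplaneK.
  have -> : chi (plane z) - plane q' = chi (plane z) - chi r0 - (plane z - r0) *m B.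
    by rewrite chir0 q'E opprD addrA.
  rewrite (le_trans Hz)//; apply: (@le_trans _ _ (eps' * (kA * (s * (w + h))))).
    by rewrite ler_pM2l.
  rewrite /eps' le_eqVlt; apply/orP; left; apply/eqP; field.
  by rewrite !gt_eqF.
have nuU : (nu Q <= ((v r0 + eta) * (D * (s ^+ 2 * ((w + 2 * eta) * (h + 2 * eta)))))%:E)%E.
  rewrite nuE'//; apply: (@le_trans _ _ ((v r0 + eta)%:E * l2 (chi_ext @^-1` Q `&` V'))%E).
    apply: mdens_le; [exact: measurable_v_ext|exact: v_ext_ge0|by apply: measurableI => //; exact: measurable_chi_ext_preimage|].
    move=> z Hz; have [_] := upper z Hz; rewrite /v_ext mem_set ?ler_norml; last by case: Hz.
    by move=> /andP[? ?]; lra.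
  rewrite [in leRHS]EFinM EFinM -l2Qp -l2g; last exact: measurable_rect.
  rewrite lee_wpmul2l ?lee_fin ?addr_ge0 ?(ltW eta0)//.
  apply: le_measure; rewrite ?inE; [by apply: measurableI => //; exact: measurable_chi_ext_preimage|by apply: mg; exact: measurable_rect|].
  by move=> z Hz; have [] := upper z Hz.
have nuL : (((v r0 - eta) * (D * (s ^+ 2 * ((w - 2 * eta) * (h - 2 * eta)))))%:E <= nu Q)%E.
  apply: (@le_trans _ _ (mdens v_ext (g @^-1` Qm))).
    rewrite EFinM EFinM -l2Qm -l2g; last exact: measurable_rect.
    apply: mdens_ge; [exact: measurable_v_ext|exact: v_ext_ge0|by apply: mg; exact: measurable_rect|].
    move=> z Hz; have [Vz _] := lower z Hz; rewrite /v_ext mem_set// ler_norml.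
    by move=> /andP[? ?]; lra.
  rewrite nuE; apply: (le_measure (mdens_measure measurable_v_ext v_ext_ge0)); rewrite ?inE; [by apply: mg; exact: measurable_rect|exact: measurable_chi_ext_preimage|].
  by move=> z Hz; have [] := lower z Hz.
have fin (m : \bar R) (a b : R) : (a%:E <= m)%E -> (m <= b%:E)%E -> a <= fine m <= b.
  by case: m => [m| |] //=; rewrite !lee_fin => -> ->.
have /andP[f1 f2] := fin _ _ _ rhoL rhoU.
have /andP[f3 f4] := fin _ _ _ nuL nuU.
move: (fine (rho Q)) (fine (nu Q)) f1 f2 f3 f4 => a b f1 f2 f3 f4.
apply: (@le_trans _ _ ((eta * C) * s ^+ 2)); last by rewrite ler_pM2r.
rewrite uE in f1 f2.
exact: (density_estimate vr0 D0 s20 w0 h0 eta0 e1 ew eh f1 f2 f3 f4).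
Unshelve. all: by end_near. Qed.

Lemma box_compact (a b c d : R) : compact [set q : 'rV[R]_2 | a <= q 0 0 <= b /\ c <= q 0 1 <= d].
Proof.
have := @rV_compact R 2 (fun i => if i == 0 then `[a, b]%classic else `[c, d]%classic).
rewrite (_ : [set q | _] = [set q : 'rV[R]_2 | a <= q 0 0 <= b /\ c <= q 0 1 <= d]); last first.
  apply/seteqP; split => q /=.
    by move=> H; have := H 0; have := H 1; rewrite /= !in_itv.
  move=> [h1 h2] i; case: ifPn => [/eqP->|i0]; rewrite /= in_itv//=.
  have -> : i = 1; last by [].
  by case: i i0 => [[|[|j]] Hj] // _; exact: val_inj.
by apply => i; case: ifP => _; exact: segment_compact.
Qed.

Lemma rect_finite (a b c d : R) : `[a, b]%classic `*` `[c, d]%classic `<=` U' ->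
  (rho (rect a b c d) < +oo)%E /\ (nu (rect a b c d) < +oo)%E.
Proof.
move=> KU; set K := [set q : 'rV[R]_2 | a <= q 0 0 <= b /\ c <= q 0 1 <= d].
have cK : compact K by exact: box_compact.
have KU2 q : K q -> U q.
  move=> [h1 h2]; rewrite -[q]unplaneK; apply: KU; split => /=; by rewrite in_itv/=.
have bnd (f : 'rV[R]_2 -> R) : (forall q, U q -> {for q, continuous f}) -> exists C, forall q, K q -> f q <= C.
  move=> cf; apply: compact_locbound => // q /KU2 Uq; exists (f q + 1).
  have /cvgrPdist_le /(_ _ ltr01) := cf q Uq; apply: filterS => p + _.
  by rewrite ler_norml => /andP[? _]; lra.
have QK z : rect a b c d z -> K (plane z).
  by rewrite /rect /K /= !mxE /= !in_itv/= => -[/andP[/ltW-> ->] /andP[/ltW-> ->]].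
have mQ : measurable (rect a b c d) by exact: measurable_rect.
have big M : (l2 (rect (- M) M (- M) M) < +oo)%E.
  have [M0|M0] := leP 0 M; first by rewrite l2_rect ?ltry//; lra.
  rewrite (_ : rect _ _ _ _ = set0) ?measure0//.
  by apply/seteqP; split => // z [] /=; rewrite !in_itv/= => /andP[? ?]; lra.
split.
  have [C HC] := bnd u cu.
  have [M HM] := compact_bounded cK.
  apply: (@le_lt_trans _ _ (`|C|%:E * l2 (rect a b c d))%E).
    apply: mdens_le => //; [exact: measurable_u_ext|exact: u_ext_ge0|] => z Qz.
    rewrite /u_ext mem_set; last exact/KU2/QK.
    by apply: le_trans (HC _ (QK _ Qz)) _; exact: ler_norm.
  apply: lte_mul_pinfty => //.
  have [ab|ab] := leP a b; have [cd|cd] := leP c d; try (rewrite (_ : rect _ _ _ _ = set0) ?measure0//;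
    by apply/seteqP; split => // z [] /=; rewrite !in_itv/= => /andP[? ?] /andP[? ?]; lra).
  by rewrite l2_rect ?ltry.
have cpsi q : U q -> {for q, continuous psi} by move=> Uq; apply: differentiable_continuous; exact: dpsi.
have [C HC] := bnd (v \o psi) (fun q Uq => continuous_comp (cpsi q Uq) (cv (psiV Uq))).
have [M HM] := bnd (fun q => `|psi q|) (fun q Uq => continuous_comp (cpsi q Uq) (@norm_continuous _ _ _)).
rewrite nuE'//.
have mS : measurable (chi_ext @^-1` rect a b c d `&` V') by apply: measurableI => //; exact: measurable_chi_ext_preimage.
have inv z : (chi_ext @^-1` rect a b c d `&` V') z -> exists2 q, K q & psi q = plane z.
  move=> [/= + Vz]; rewrite /chi_ext mem_set// => /QK; rewrite unplaneK => Kq.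
  by exists (chi (plane z)) => //; exact: chiK.
apply: (@le_lt_trans _ _ (`|C|%:E * l2 (chi_ext @^-1` rect a b c d `&` V'))%E).
  apply: mdens_le => //; [exact: measurable_v_ext|exact: v_ext_ge0|] => z Hz.
  have [q Kq qz] := inv z Hz; rewrite /v_ext mem_set; last by case: Hz.
  by rewrite -qz; apply: le_trans (HC _ Kq) _; exact: ler_norm.
apply: lte_mul_pinfty => //; apply: le_lt_trans (big (`|M| + 1)).
apply: le_measure; [by rewrite inE|by rewrite inE; exact: measurable_rect|move=> z Hz].
have [q Kq qz] := inv z Hz; have nz : `|plane z| <= `|M|.
  by rewrite -qz; apply: le_trans (HM _ Kq) _; exact: ler_norm.
have := rV_coord_le (plane z) 0; have := rV_coord_le (plane z) 1; rewrite !mxE /= !ler_norml.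
by move=> /andP[? ?] /andP[? ?]; split; rewrite /= in_itv/=; apply/andP; split; lra.
Qed.

(** Otherwise [bisection] leads to rectangles that shrink to a point and on
    which the difference of both measures is at least proportional to the
    area, against [local_density]. *)
Lemma rect_eq (a b c d : R) : `[a, b]%classic `*` `[c, d]%classic `<=` U' ->
  rho (rect a b c d) = nu (rect a b c d).
Proof.
move=> KU; have [f1 f2] := rect_finite KU.
have [ab|ab] := ltP a b; last first.
  by rewrite rect_empty ?measure0//; left.
have [cd|cd] := ltP c d; last first.
  by rewrite rect_empty ?measure0//; right.
have fin1 : rho (rect a b c d) \is a fin_num by rewrite ge0_fin_numE.
have fin2 : nu (rect a b c d) \is a fin_num by rewrite ge0_fin_numE.
clear f1 f2; pose w := b - a; pose h := d - c.
have w0 : 0 < w by rewrite subr_gt0.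
have h0 : 0 < h by rewrite subr_gt0.
have mr (a' b' c' d' : R) : measurable (rect a' b' c' d') by exact: measurable_rect.
pose Q x y s := rect x (x + w * s) y (y + h * s).
pose dl x y s := fine (rho (Q x y s)) - fine (nu (Q x y s)).
have Qab : Q a c 1 = rect a b c d by rewrite /Q !mulr1 /w /h ![_ + (_ - _)]addrC !subrK.
have Qsub x y s : [/\ a <= x, x + w * s <= a + w, c <= y & y + h * s <= c + h] -> Q x y s `<=` rect a b c d.
  move=> [? e1 ? e2]; apply: rect_sub => //.
  - by move: e1; rewrite /w [a + _]addrC subrK.
  - by move: e2; rewrite /h [c + _]addrC subrK.
have dl_add x y s : 0 < s -> [/\ a <= x, x + w * s <= a + w, c <= y & y + h * s <= c + h] ->
  dl x y s = dl x y (s / 2) + dl (x + w * (s / 2)) y (s / 2)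
    + dl x (y + h * (s / 2)) (s / 2) + dl (x + w * (s / 2)) (y + h * (s / 2)) (s / 2).
  move=> s0 ins; have ws : 0 < w * (s / 2) by rewrite mulr_gt0// divr_gt0.
  have hs : 0 < h * (s / 2) by rewrite mulr_gt0// divr_gt0.
  have E z l : z + l * s = z + l * (s / 2) + l * (s / 2) by field.
  have sp (m : {measure set RR -> \bar R}) : m (rect a b c d) \is a fin_num ->
    fine (m (Q x y s)) = fine (m (Q x y (s / 2))) + fine (m (Q (x + w * (s / 2)) y (s / 2)))
    + fine (m (Q x (y + h * (s / 2)) (s / 2))) + fine (m (Q (x + w * (s / 2)) (y + h * (s / 2)) (s / 2))).
    move=> mfin; rewrite /Q !E; apply: measure_itv_split; [by apply/andP; split; lra|by apply/andP; split; lra|].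
    rewrite ge0_fin_numE// in mfin; apply: le_lt_trans mfin; apply: le_measure; rewrite ?inE//.
    by move=> z; rewrite -!E; exact: Qsub.
  by rewrite /dl !(sp rho)// !(sp nu)//; ring.
apply/eqP; apply: contraT => neq.
have d0 : dl a c 1 != 0.
  by apply: contra neq; rewrite /dl Qab subr_eq0 => /eqP E; rewrite -(fineK fin1) -(fineK fin2) E.
have [X [Y [aX cY H]]] := bisection w0 h0 dl_add d0.
have Up : U (plane (X, Y)).
  by apply: KU; split; rewrite /= in_itv/=; move: aX cY; rewrite /w /h ![_ + (_ - _)]addrC !subrK.
have k0 : 0 < `|dl a c 1| / 2 by rewrite divr_gt0 ?normr_gt0.
have [s0 s00 Hs] := local_density Up w0 h0 k0.
have [n ns] : exists n, 2^-1 ^+ n < s0.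
  have c2 : 2^-1 ^+ n @[n --> \oo] --> (0 : R).
    by apply: cvg_expr; rewrite ger0_norm ?invf_lt1 ?ltr1n.
  have [n ns] : exists n, (fun n => 2^-1 ^+ n < s0) n.
    by apply: (@filter_ex _ \oo); apply: cvgr_lt c2 _ s00.
  by exists n.
have [x [y [_ Xx Yy ge]]] := H n.
have sn : 0 < 2^-1 ^+ n :> R by rewrite exprn_gt0.
have := Hs (2^-1 ^+ n) x y _ Xx Yy; rewrite sn ns => /(_ isT) le.
have := le_trans ge le; rewrite ler_pM2r ?exprn_gt0//.
by have := k0; lra.
Qed.

(** Both measures agree on rectangles, hence on all measurable sets. The
    maps psi and chi enter through their differentials at single points
    only, which is the information that charts provide. *)
Theorem change_of_variables (B C : set RR) : measurable B -> measurable C ->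
  (forall z, B z -> U (plane z)) -> (forall z, C z -> V (plane z)) ->
  psi @` (@plane R @` B) = @plane R @` C ->
  (\int[l2]_(z in B) (u (plane z))%:E = \int[l2]_(z in C) (v (plane z))%:E)%E.
Proof.
move=> mB mC BU CV E.
transitivity (rho B).
  by rewrite rhoE /mdens; apply: eq_integral => z /set_mem zB; rewrite /u_ext mem_set//; exact: BU.
rewrite (rect_measure_unique (m1 := rho) (m2 := nu) oU _ mB BU); last first.
  by move=> a b c d H; split; [exact: rect_eq|have [] := rect_finite H].
rewrite nuE'//.
have -> : chi_ext @^-1` B `&` V' = C.
  apply/seteqP; split => z.
    move=> [/= + Vz]; rewrite /chi_ext mem_set// => Bz.
    have : (@plane R @` C) (plane z).
      rewrite -E; exists (chi (plane z)); last exact: chiK.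
      by exists (unplane (chi (plane z))) => //; exact: unplaneK.
    by move=> [z' Cz' /(congr1 (@unplane R))]; rewrite !planeK => <-.
  move=> Cz; split; last exact: CV.
  have : (psi @` (@plane R @` B)) (plane z) by rewrite E; exists z.
  move=> [_ [z' Bz' <-] Ez]; rewrite /preimage /= /chi_ext mem_set; last exact: CV.
  by rewrite -Ez psiK ?planeK//; exact: BU.
by rewrite /mdens; apply: eq_integral => z /set_mem zC; rewrite /v_ext mem_set//; exact: CV.
Qed.

End CoV.

(** * Euclidean geometry of space and unit normals *)

Section Dot.
Variables (R : realType).
Implicit Types (u v w n : 'rV[R]_3).

Lemma dotE u v : dot u v = \sum_i u 0 i * v 0 i.
Proof. by rewrite /dot mxE; apply: eq_bigr => i _; rewrite mxE. Qed.

Lemma dotC u v : dot u v = dot v u.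
Proof. by rewrite !dotE; apply: eq_bigr => i _; rewrite mulrC. Qed.

Lemma dotDl u v w : dot (u + v) w = dot u w + dot v w.
Proof. by rewrite /dot mulmxDl mxE. Qed.

Lemma dotZl (a : R) u v : dot (a *: u) v = a * dot u v.
Proof. by rewrite /dot -scalemxAl mxE. Qed.

Lemma dotNl u v : dot (- u) v = - dot u v.
Proof. by rewrite /dot mulNmx mxE. Qed.

Lemma dotBl u v w : dot (u - v) w = dot u w - dot v w.
Proof. by rewrite dotDl dotNl. Qed.

Lemma dotDr u v w : dot u (v + w) = dot u v + dot u w.
Proof. by rewrite dotC dotDl !(dotC u). Qed.

Lemma dotZr (a : R) u v : dot u (a *: v) = a * dot u v.
Proof. by rewrite dotC dotZl dotC. Qed.

Lemma dotNr u v : dot u (- v) = - dot u v.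
Proof. by rewrite dotC dotNl dotC. Qed.

Lemma dotBr u v w : dot u (v - w) = dot u v - dot u w.
Proof. by rewrite dotDr dotNr. Qed.

Lemma dot0l v : dot 0 v = 0.
Proof. by rewrite /dot mul0mx mxE. Qed.

Lemma dot_ge0 u : 0 <= dot u u.
Proof. by rewrite dotE sumr_ge0// => i _; rewrite -expr2 sqr_ge0. Qed.

Lemma dot_coord_le u i : u 0 i ^+ 2 <= dot u u.
Proof.
rewrite dotE (bigD1 i)//= -expr2 lerDl sumr_ge0// => j _.
by rewrite -expr2 sqr_ge0.
Qed.

Lemma norm_le_dot u (a : R) : 0 <= a -> dot u u <= a ^+ 2 -> `|u| <= a.
Proof.
move=> a0 H; apply: rV_norm_le => // i.
by rewrite -(ler_pXn2r (n := 2)) ?nnegrE// real_normK ?num_real// (le_trans (dot_coord_le _ _)).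
Qed.

Lemma dot_eq0 u : (dot u u == 0) = (u == 0).
Proof.
apply/idP/idP => [/eqP H|/eqP->]; last by rewrite dot0l.
by rewrite -normr_le0; apply: norm_le_dot => //; rewrite H expr0n.
Qed.

(** The constant compares the Euclidean norm with the sup norm. *)
Lemma dot_le u v : `|dot u v| <= 3 * (`|u| * `|v|).
Proof.
rewrite dotE (le_trans (ler_norm_sum _ _ _))//.
apply: (@le_trans _ _ (\sum_(i < 3) `|u| * `|v|)).
  by apply: ler_sum => i _; rewrite normrM ler_pM// rV_coord_le.
by rewrite sumr_const card_ord mulr_natl.
Qed.

Lemma dot_unit_le u n : dot n n = 1 -> `|dot u n| <= 3 * `|u|.
Proof.
move=> n1; rewrite (le_trans (dot_le _ _))// mulrA ler_piMr ?mulr_ge0//.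
by apply: norm_le_dot; rewrite ?n1 ?expr1n.
Qed.

Lemma dot_mulmx (w : 'rV[R]_2) (J : 'M[R]_(2, 3)) n : dot (w *m J) n = (w *m (J *m n^T)) 0 0.
Proof. by rewrite /dot mulmxA. Qed.

Lemma perp_col (J : 'M[R]_(2, 3)) n : (forall w : 'rV[R]_2, dot (w *m J) n = 0) <-> J *m n^T = 0.
Proof.
split=> [H|H w]; last by rewrite dot_mulmx H mulmx0 mxE.
apply/row_matrixP => i; rewrite row0 rowE; apply/rowP => j.
by rewrite ord1 -dot_mulmx H mxE.
Qed.

Lemma perp_row (J : 'M[R]_(2, 3)) n w : row_free J -> n != 0 -> J *m n^T = 0 ->
  dot w n = 0 -> (w <= J)%MS.
Proof.
move=> fJ n0 Jn wn.
have JK : (J <= kermx n^T)%MS by apply/sub_kermxP.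
have wK : (w <= kermx n^T)%MS.
  by apply/sub_kermxP; apply/matrixP => i j; rewrite !ord1 [RHS]mxE; exact: wn.
have rk : \rank (kermx n^T) = 2.
  rewrite mxrank_ker mxrank_tr; suff -> : \rank n = 1%N by [].
  by rewrite rank_rV n0.
apply: submx_trans wK _.
by rewrite -(geq_leqif (mxrank_leqif_sup JK)) rk; move/eqP: fJ => ->.
Qed.

(** The component of m along n has square 1. *)
Lemma perp_unique (J : 'M[R]_(2, 3)) n m : row_free J -> J *m n^T = 0 -> J *m m^T = 0 ->
  dot n n = 1 -> dot m m = 1 -> m = n \/ m = - n.
Proof.
move=> fJ Jn Jm n1 m1.
have n0 : n != 0 by rewrite -dot_eq0 n1 oner_eq0.
have wn : dot (m - dot m n *: n) n = 0 by rewrite dotBl dotZl n1 mulr1 subrr.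
have /submxP[a aE] := perp_row fJ n0 Jn wn.
have m0 : dot (m - dot m n *: n) m = 0 by rewrite aE dot_mulmx Jm mulmx0 mxE.
have E : dot m n ^+ 2 = 1.
  by move/eqP: m0; rewrite dotBl dotZl m1 (dotC n) -expr2 subr_eq0 => /eqP<-.
have mE : m = dot m n *: n.
  apply/eqP; rewrite -subr_eq0 -dot_eq0.
  by rewrite [X in X == 0]dotBr dotZr m0 wn mulr0 subrr.
move/eqP: E; rewrite sqrf_eq1 => /orP[/eqP c1|/eqP c1]; [left|right]; rewrite mE c1.
  by rewrite scale1r.
by rewrite scaleN1r.
Qed.

Section SmoothDot.
Variables (V : normedModType R) (U : set V).
Hypothesis oU : open U.

Lemma Ck_dot k (f g : V -> 'rV[R]_3) : Ck k U f -> Ck k U g -> Ck k U (fun q => dot (f q) (g q)).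
Proof.
move=> /(Ck_rowP oU) Cf /(Ck_rowP oU) Cg.
apply: (Ck_eq oU) (@Ck_sum _ _ _ oU _ k _ (index_enum 'I_3) xpredT (fun i q => f q 0 i * g q 0 i) _).
  by move=> q _; rewrite dotE.
by move=> i _; exact: Ck_mul.
Qed.

Lemma derive_dot (f g : V -> 'rV[R]_3) (q v : V) : differentiable f q -> differentiable g q ->
  'D_v (fun q => dot (f q) (g q)) q = dot ('D_v f q) (g q) + dot (f q) ('D_v g q).
Proof.
move=> df dg; have dfi := (diff_rowP f q).1 df; have dgi := (diff_rowP g q).1 dg.
have -> : (fun q => dot (f q) (g q)) = \sum_(i < 3) (fun q => f q 0 i * g q 0 i).
  by apply/funext => p; rewrite dotE fct_sumE.
rewrite derive_sum; last by move=> i; apply: derivableM; exact: diff_derivable.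
rewrite !dotE -big_split /=; apply: eq_bigr => i _.
rewrite derive_mulR ?derive_coord; try exact: diff_derivable.
by rewrite addrC [g _ _ _ * _]mulrC.
Qed.

Lemma differentiable_dot (f g : V -> 'rV[R]_3) q : differentiable f q -> differentiable g q ->
  differentiable (fun q => dot (f q) (g q)) q.
Proof.
move=> df dg; have dfi := (diff_rowP f q).1 df; have dgi := (diff_rowP g q).1 dg.
have -> : (fun q => dot (f q) (g q)) = \sum_(i < 3) (fun q => f q 0 i * g q 0 i).
  by apply/funext => p; rewrite dotE fct_sumE.
by apply: differentiable_sum => i; exact: differentiableM.
Qed.

End SmoothDot.

Lemma dot_continuous (T : topologicalType) (f g : T -> 'rV[R]_3) p :
  {for p, continuous f} -> {for p, continuous g} -> {for p, continuous (fun q => dot (f q) (g q))}.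
Proof.
move=> cf cg.
have ci i : {for p, continuous (fun q => f q 0 i * g q 0 i)}.
  apply: cvgM; first exact: (continuous_comp cf (@coord_continuous _ _ _ 0 i (f p))).
  exact: (continuous_comp cg (@coord_continuous _ _ _ 0 i (g p))).
have -> : (fun q => dot (f q) (g q)) = (fun q => f q 0 0 * g q 0 0 + (f q 0 1 * g q 0 1 + f q 0 2 * g q 0 2)).
  apply/funext => q; rewrite dotE !big_ord_recl big_ord0 addr0.
  by congr (_ + (_ * _ + _ * _)); congr (_ 0 _); exact: val_inj.
exact: cvgD (ci 0) (cvgD (ci 1) (ci 2)).
Qed.

Lemma dot3 u v : dot u v = u 0 0 * v 0 0 + u 0 1 * v 0 1 + u 0 2 * v 0 2.
Proof.
rewrite dotE !big_ord_recl big_ord0 addr0 addrA.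
by congr (_ * _ + _ * _ + _ * _); congr (_ 0 _); exact: val_inj.
Qed.

Lemma row3P u v : u 0 0 = v 0 0 -> u 0 1 = v 0 1 -> u 0 2 = v 0 2 -> u = v.
Proof.
move=> h0 h1 h2; apply/rowP => -[[|[|[|j]]] Hj] //.
- by rewrite (_ : Ordinal Hj = 0)//; exact: val_inj.
- by rewrite (_ : Ordinal Hj = 1)//; exact: val_inj.
- by rewrite (_ : Ordinal Hj = 2)//; exact: val_inj.
Qed.

Definition cross u v : 'rV[R]_3 := \row_j
  (if j == 0 then u 0 1 * v 0 2 - u 0 2 * v 0 1
   else if j == 1 then u 0 2 * v 0 0 - u 0 0 * v 0 2
   else u 0 0 * v 0 1 - u 0 1 * v 0 0).

Lemma dot_cross_l u v : dot u (cross u v) = 0.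
Proof. by rewrite dot3 !mxE /=; ring. Qed.

Lemma dot_cross_r u v : dot v (cross u v) = 0.
Proof. by rewrite dot3 !mxE /=; ring. Qed.

Lemma row2_mul (J : 'M[R]_(2, 3)) (w : 'rV[R]_2) : w *m J = w 0 0 *: row 0 J + w 0 1 *: row 1 J.
Proof.
rewrite [LHS]mulmx_sum_row !big_ord_recl big_ord0 addr0.
by congr (_ *: _ + _ *: _); congr (_ _ _); rewrite ?[RHS]/= //; exact: val_inj.
Qed.

Lemma cross_neq0 (J : 'M[R]_(2, 3)) : row_free J -> cross (row 0 J) (row 1 J) != 0.
Proof.
move=> fJ; apply/eqP => /rowP c0.
have h0 := c0 0; have h1 := c0 1; have h2 := c0 2; rewrite !mxE /= in h0 h1 h2.
have z k : J 1 k = 0 /\ J 0 k = 0.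
  pose w : 'rV[R]_2 := \row_i (if i == 0 then J 1 k else - J 0 k).
  suff w0 : w = 0.
    by have /rowP wE := w0; have := wE 0; have := wE 1; rewrite !mxE /= => /eqP; rewrite oppr_eq0 => /eqP -> ->.
  apply: (row_free_inj fJ); rewrite /= mul0mx row2_mul.
  have kE : [\/ k = 0, k = 1 | k = 2].
    by case: k @w => [[|[|[|k]]] Hk] _ //; [constructor 1|constructor 2|constructor 3]; exact: val_inj.
  by case: kE => E; rewrite /w E; apply: row3P; rewrite !mxE /=; lra.
have J0 : J = 0.
  apply/matrixP => i k; rewrite mxE; have [j1 j0] := z k.
  case: i => [[|[|i]] Hi] //.
  - by rewrite (_ : Ordinal Hi = 0)//; exact: val_inj.
  - by rewrite (_ : Ordinal Hi = 1)//; exact: val_inj.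
by move/eqP: fJ; rewrite J0 mxrank0.
Qed.

Lemma perp_both (J : 'M[R]_(2, 3)) n w : row_free J -> n != 0 -> J *m n^T = 0 ->
  dot w n = 0 -> J *m w^T = 0 -> w = 0.
Proof.
move=> fJ n0 Jn wn Jw; have /submxP[a aE] := perp_row fJ n0 Jn wn.
by apply/eqP; rewrite -dot_eq0 {1}aE dot_mulmx Jw mulmx0 mxE.
Qed.

Section SmoothNormal.
Variables (U : set 'rV[R]_2) (x N : 'rV[R]_2 -> 'rV[R]_3).
Hypotheses (oU : open U) (sx : smooth_on U x).
Hypothesis fx : forall q, U q -> row_free ('J x q).
Hypothesis dN : forall q, U q -> differentiable N q.
Hypothesis N1 : forall q, U q -> dot (N q) (N q) = 1.
Hypothesis JN : forall q, U q -> 'J x q *m (N q)^T = 0.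

Lemma derive_row i q : U q -> 'D_(delta_mx 0 i) x q = row i ('J x q).
Proof. by move=> Uq; rewrite deriveEjacobian ?rowE//; exact: (sx [::]). Qed.

(** The cross product c of the partial derivatives is a multiple of N. With
    g = 1 / <c, N> one has N = g c and g^2 <c, c> = 1, so that
    [Ck_inv_sqrt] applies, whichever of the two directions N has. *)
Lemma smooth_normal : smooth_on U N.
Proof.
have Cx k : Ck k U x by apply: (Ck_smooth U x).1.
pose c q := cross ('D_(delta_mx 0 0) x q) ('D_(delta_mx 0 1) x q).
have Cc k : Ck k U c.
  have C0 i : Ck k U (fun q => 'D_(delta_mx 0 0) x q 0 i).
    by apply: (Ck_rowP oU _ _).1; exact: (Cx k.+1).2.
  have C1 i : Ck k U (fun q => 'D_(delta_mx 0 1) x q 0 i).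
    by apply: (Ck_rowP oU _ _).1; exact: (Cx k.+1).2.
  have Cm i j : Ck k U (fun q => 'D_(delta_mx 0 0) x q 0 i * 'D_(delta_mx 0 1) x q 0 j - 'D_(delta_mx 0 0) x q 0 j * 'D_(delta_mx 0 1) x q 0 i).
    by apply: Ck_add => //; [exact: Ck_mul|apply: Ck_opp => //; exact: Ck_mul].
  apply/(Ck_rowP oU) => -[[|[|[|j]]] Hj] //.
  - by apply: (Ck_eq oU) (Cm 1 2) => q _; rewrite mxE.
  - by apply: (Ck_eq oU) (Cm 2 0) => q _; rewrite mxE.
  - by apply: (Ck_eq oU) (Cm 0 1) => q _; rewrite mxE.
have cN q : U q -> c q = dot (c q) (N q) *: N q.
  move=> Uq; apply/eqP; rewrite -subr_eq0; apply/eqP.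
  apply: (@perp_both ('J x q) (N q)); [exact: fx| |exact: JN| |].
  - by rewrite -dot_eq0 N1// oner_eq0.
  - by rewrite dotBl dotZl N1// mulr1 subrr.
  apply/perp_col => w; rewrite dotBr dotZr ((perp_col _ _).2 (JN Uq)) mulr0 subr0.
  by rewrite row2_mul dotDl !dotZl /c !derive_row// dot_cross_l dot_cross_r !mulr0 addr0.
have c0 q : U q -> c q != 0 by move=> Uq; rewrite /c !derive_row//; exact/cross_neq0/fx.
have f0 q : U q -> dot (c q) (N q) != 0.
  by move=> Uq; apply: contra_neq (c0 q Uq) => E; rewrite cN// E scale0r.
pose g q := (dot (c q) (N q))^-1.
have dg q : U q -> differentiable g q.
  move=> Uq; apply: differentiableV; last exact: f0.
  by apply: differentiable_dot; [exact: Ck_diff (Cc 0%N) Uq|exact: dN].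
have gc q : U q -> g q ^+ 2 * dot (c q) (c q) = 1.
  move=> Uq; have -> : dot (c q) (c q) = dot (c q) (N q) ^+ 2.
    by rewrite {1}(cN q Uq) dotZl (dotC (N q)) expr2.
  by rewrite /g -exprMn mulVf ?expr1n// f0.
apply/Ck_smooth => k.
have Cg : Ck k U g by apply: (Ck_inv_sqrt oU dg gc); exact: Ck_dot.
apply: (Ck_eq oU) (Ck_scale oU Cg (Cc k)) => q Uq.
by rewrite {1}(cN q Uq) scalerA /g mulVf ?scale1r// f0.
Qed.

End SmoothNormal.
End Dot.

(** * Transition between charts *)

Local Opaque jacobian diff.

Section Jac.
Variable R : realType.

Lemma jacobian_comp n m k (f : 'rV[R]_n -> 'rV[R]_m) (g : 'rV[R]_m -> 'rV[R]_k) a :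
  differentiable f a -> differentiable g (f a) -> 'J (g \o f) a = 'J f a *m 'J g (f a).
Proof.
move=> df dg; have E := diff_comp df dg.
have Eg (v : 'rV[R]_n) : v *m 'J (g \o f) a = v *m ('J f a *m 'J g (f a)).
  have h1 := diffJ (g \o f) a v; have h2 := diffJ f a v; have h3 := diffJ g (f a) (v *m 'J f a).
  rewrite mulmxA -h1 -h3 -h2; exact: (congr1 (fun F : _ -> _ => F v) E).
by apply/row_matrixP => i; rewrite (rowE i ('J (g \o f) a)) (rowE i ('J f a *m _)); exact: Eg.
Qed.

Lemma near_continuous (T1 T2 : topologicalType) (f : T1 -> T2) a (P : T2 -> Prop) :
  {for a, continuous f} -> (\forall p \near f a, P p) -> \forall q \near a, P (f q).
Proof. by move=> cf H; exact: (cf _ H). Qed.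

Lemma near_eq_J n m (f g : 'rV[R]_n -> 'rV[R]_m) a :
  (\forall b \near a, f b = g b) -> differentiable f a ->
  differentiable g a /\ 'J g a = 'J f a.
Proof.
move=> fg df; have [dg E] := near_eq_diff fg df; split; first exact: dg.
have Eg (v : 'rV[R]_n) : v *m 'J g a = v *m 'J f a.
  have h1 := diffJ g a v; have h2 := diffJ f a v.
  exact: (etrans (esym h1) (etrans (congr1 (fun F : _ -> _ => F v) E) h2)).
apply/row_matrixP => i; exact: (etrans (rowE i ('J g a)) (etrans (Eg _) (esym (rowE i ('J f a))))).
Qed.

Lemma diff_lipschitz n m (f : 'rV[R]_n -> 'rV[R]_m) a : differentiable f a ->
  exists2 C, 0 < C & \forall b \near a, `|f b - f a| <= C * `|b - a|.
Proof.
move=> df; have [k k0 Hk] := mulmx_norm_le ('J f a).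
exists (k + 1); first exact: addr_gt0.
have := diffJ_bound df ltr01; apply: filterS => b H.
rewrite -[f b - f a](subrK ((b - a) *m 'J f a)) (le_trans (ler_normD _ _))//.
by rewrite mulrDl addrC lerD.
Qed.
End Jac.

Section Charts.
Variable R : realType.
Variables (M : set 'rV[R]_3).
Implicit Types (U V : set 'rV[R]_2) (x y : 'rV[R]_2 -> 'rV[R]_3).

Lemma chart_open U x : chart M U x -> open U. Proof. by case. Qed.
Lemma chart_smooth U x : chart M U x -> smooth_on U x. Proof. by case. Qed.
Lemma chart_free U x q : chart M U x -> U q -> row_free ('J x q).
Proof. by case=> _ _ _ + _; apply. Qed.
Lemma chart_diff U x q : chart M U x -> U q -> differentiable x q.
Proof. by move=> /chart_smooth sx Uq; exact: (sx [::]). Qed.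
Lemma chart_inj U x q r : chart M U x -> U q -> U r -> x q = x r -> q = r.
Proof. by case=> _ _ ix _ _ Uq Ur; apply: ix; exact: mem_set. Qed.

Lemma chart_image U x V : chart M U x -> open V -> V `<=` U ->
  exists2 W, open W & x @` V = M `&` W.
Proof. by case=> _ _ _ _; apply. Qed.

Lemma chart_in U x q : chart M U x -> U q -> M (x q).
Proof.
move=> cx Uq; have [W _ E] := chart_image cx (chart_open cx) (@subset_refl _ _).
by have : (x @` U) (x q) by [exists q]; rewrite E => -[].
Qed.

Lemma chart_restrict U x V : chart M U x -> open V -> V `<=` U -> chart M V x.
Proof.
move=> [oU sx ix fx ox] oV VU; split=> //.
- by move=> l q /VU; exact: sx.
- by move=> q r; rewrite !inE => /VU Uq /VU Ur; apply: ix; exact: mem_set.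
- by move=> q /VU; exact: fx.
- by move=> V' oV' V'V; apply: ox => //; exact: subset_trans V'V VU.
Qed.

Definition cinv V y (p : 'rV[R]_3) : 'rV[R]_2 := xget 0 [set r | V r /\ y r = p].

Lemma cinvK V y r : chart M V y -> V r -> cinv V y (y r) = r.
Proof.
move=> cy Vr; rewrite /cinv; case: xgetP => [s _ [Vs ys]|/(_ r)]; last by case.
exact: chart_inj cy Vs Vr ys.
Qed.

Lemma cinvP V y p : (y @` V) p -> V (cinv V y p) /\ y (cinv V y p) = p.
Proof.
move=> [r Vr yr]; rewrite /cinv; case: xgetP => [s _ //|/(_ r)]; by case.
Qed.

Section Inverse.
Variables (V : set 'rV[R]_2) (y : 'rV[R]_2 -> 'rV[R]_3) (r0 : 'rV[R]_2).
Hypotheses (cy : chart M V y) (Vr0 : V r0).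
Let p0 := y r0.

Lemma cinv_near V' : open V' -> V' r0 ->
  \forall p \near p0, M p -> [/\ (V `&` V') (cinv V y p), y (cinv V y p) = p & (y @` V) p].
Proof.
move=> oV' V'r0; have oVV : open (V `&` V') by apply: openI => //; exact: chart_open cy.
have [W oW E] := chart_image cy oVV (@subIsetl _ _ _).
have : W p0.
  suff : (y @` (V `&` V')) p0 by rewrite E => -[].
  by exists r0.
move=> Wp; apply: filterS (open_nbhs_nbhs (conj oW Wp)) => p W_p Mp.
have : (y @` (V `&` V')) p by rewrite E.
move=> [r [Vr V'r] <-]; rewrite cinvK//; split=> //; by exists r.
Qed.

(** The differential of y at r0 is injective, and y differs from it by a
    small fraction of the distance to r0. *)
Lemma cinv_lip : exists2 C, 0 < C &
  \forall p \near p0, M p -> `|cinv V y p - r0| <= C * `|p - p0|.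
Proof.
have fJ := chart_free cy Vr0.
have [k k0 Hk] := mulmx_norm_le (pinvmx ('J y r0)).
have e0 : 0 < (2 * k)^-1 by rewrite invr_gt0 mulr_gt0.
exists (2 * k); first exact: mulr_gt0.
have := diffJ_bound (chart_diff cy Vr0) e0.
move=> /nbhs_ballP[d /= d0 Hd].
have oB : open (ball r0 d) by exact: ball_open.
have := cinv_near oB (ballxx r0 d0).
apply: filterS => p H Mp; have [[Vr Br] yr _] := H Mp.
move: (cinv V y p) Vr Br yr => r Vr Br yr; have := Hd _ Br; rewrite yr -/p0 => Hr.
have E : r - r0 = (p - p0) *m pinvmx ('J y r0) - (p - p0 - (r - r0) *m 'J y r0) *m pinvmx ('J y r0).
  by rewrite -mulmxBl opprB [p - p0 + _]addrC subrK -mulmxA mulmxVp// mulmx1.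
have h1 := Hk (p - p0); have h2 := Hk (p - p0 - (r - r0) *m 'J y r0).
have : `|r - r0| <= k * `|p - p0| + k * ((2 * k)^-1 * `|r - r0|).
  rewrite {1}E (le_trans (ler_normB _ _))// lerD// (le_trans h2)// ler_pM2l//.
have -> : k * ((2 * k)^-1 * `|r - r0|) = `|r - r0| / 2 by field; rewrite gt_eqF.
by move=> H'; rewrite -mulrA; lra.
Qed.

Lemma cinv_diff e : 0 < e -> \forall p \near p0, M p ->
  `|cinv V y p - r0 - (p - p0) *m pinvmx ('J y r0)| <= e * `|p - p0|.
Proof.
move=> e0; have fJ := chart_free cy Vr0.
have [k k0 Hk] := mulmx_norm_le (pinvmx ('J y r0)).
have [C C0 HC] := cinv_lip.
have e'0 : 0 < e / (k * C) by rewrite divr_gt0// mulr_gt0.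
have := diffJ_bound (chart_diff cy Vr0) e'0.
move=> /nbhs_ballP[d /= d0 Hd].
have oB : open (ball r0 d) by exact: ball_open.
have := cinv_near oB (ballxx r0 d0).
move: HC; apply: filterS2 => p HC H Mp; have [[Vr Br] yr _] := H Mp.
have {}HC := HC Mp.
move: (cinv V y p) Vr Br yr HC => r Vr Br yr HC; have := Hd _ Br; rewrite yr -/p0 => Hr.
have -> : r - r0 - (p - p0) *m pinvmx ('J y r0) = - ((p - p0 - (r - r0) *m 'J y r0) *m pinvmx ('J y r0)).
  by rewrite [(p - p0 - _) *m _]mulmxBl -[(r - r0) *m _ *m _]mulmxA mulmxVp// mulmx1 opprB.
rewrite normrN (le_trans (Hk _))//.
apply: (@le_trans _ _ (k * (e / (k * C) * (C * `|p - p0|)))).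
  rewrite ler_pM2l// (le_trans Hr)// ler_pM2l//.
by rewrite le_eqVlt; apply/orP; left; apply/eqP; field; rewrite !gt_eqF.
Qed.

(** That charts are open onto their images makes the inverse of y continuous,
    and the first order expansion of y can then be solved for the
    coordinates. *)
Lemma cinv_comp n (f : 'rV[R]_n -> 'rV[R]_3) q0 : differentiable f q0 -> f q0 = p0 ->
  (\forall q \near q0, M (f q)) ->
  [/\ differentiable (cinv V y \o f) q0, 'J f q0 = 'J (cinv V y \o f) q0 *m 'J y r0 &
   'J (cinv V y \o f) q0 = 'J f q0 *m pinvmx ('J y r0)].
Proof.
move=> df fq0 Mf.
have cf : {for q0, continuous f} by exact: differentiable_continuous.
have K0 : cinv V y (f q0) = r0 by rewrite fq0; exact: cinvK.
have [dc Jc] : differentiable (cinv V y \o f) q0 /\ 'J (cinv V y \o f) q0 = 'J f q0 *m pinvmx ('J y r0).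
  apply: diffJ_crit => e e0.
  have [k k0 Hk] := mulmx_norm_le (pinvmx ('J y r0)).
  have [C C0 HC] := diff_lipschitz df.
  have e1 : 0 < e / (2 * C) by rewrite divr_gt0// mulr_gt0.
  have e2 : 0 < e / (2 * k) by rewrite divr_gt0// mulr_gt0.
  have H1 := diffJ_bound df e2.
  have H2 : \forall q \near q0, M (f q) ->
      `|cinv V y (f q) - r0 - (f q - p0) *m pinvmx ('J y r0)| <= e / (2 * C) * `|f q - p0|.
    by have H := cinv_diff e1; rewrite -/p0 -fq0 in H; have := near_continuous cf H; apply: filterS => q; rewrite fq0.
  near=> q; rewrite /= K0.
  have Mq : M (f q) by near: q.
  have h1 : `|f q - f q0 - (q - q0) *m 'J f q0| <= e / (2 * k) * `|q - q0| by near: q.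
  have h2 : M (f q) -> `|cinv V y (f q) - r0 - (f q - p0) *m pinvmx ('J y r0)| <= e / (2 * C) * `|f q - p0| by near: q.
  have h3 : `|f q - f q0| <= C * `|q - q0| by near: q.
  have {}h2 := h2 Mq; rewrite -fq0 in h2.
  have -> : cinv V y (f q) - r0 - (q - q0) *m ('J f q0 *m pinvmx ('J y r0)) =
     (cinv V y (f q) - r0 - (f q - f q0) *m pinvmx ('J y r0)) + (f q - f q0 - (q - q0) *m 'J f q0) *m pinvmx ('J y r0).
    by rewrite [(f q - f q0 - _) *m _]mulmxBl mulmxA addrA subrK.
  rewrite (le_trans (ler_normD _ _))// (splitr e) mulrDl lerD//.
    rewrite (le_trans h2)//; apply: (@le_trans _ _ (e / (2 * C) * (C * `|q - q0|))).
      by rewrite ler_pM2l.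
    by rewrite le_eqVlt; apply/orP; left; apply/eqP; field; rewrite gt_eqF.
  rewrite (le_trans (Hk _))//; apply: (@le_trans _ _ (k * (e / (2 * k) * `|q - q0|))).
    by rewrite ler_pM2l.
  by rewrite le_eqVlt; apply/orP; left; apply/eqP; field; rewrite gt_eqF.
split=> //.
have Vc : V (cinv V y (f q0)) by rewrite K0.
have JC := jacobian_comp dc (chart_diff cy Vc).
have E : \forall q \near q0, (y \o (cinv V y \o f)) q = f q.
  have H := cinv_near openT I; rewrite -/p0 -fq0 in H; have {}H := near_continuous cf H.
  near=> q; have Mq : M (f q) by near: q.
  have [] : [/\ (V `&` setT) (cinv V y (f q)), y (cinv V y (f q)) = f q & (y @` V) (f q)]; last by [].
  by move: Mq; near: q.
have dyc : differentiable (y \o (cinv V y \o f)) q0.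
  by apply: differentiable_comp => //; exact: chart_diff cy Vc.
have [_ E2] := near_eq_J E dyc.
exact: (etrans E2 (etrans JC (congr1 (fun r => _ *m 'J y r) K0))).
Unshelve. all: by end_near. Qed.

End Inverse.

(** Both Jacobians have full rank, which makes the Jacobian of the
    transition map invertible. *)
Lemma transition U x V y q0 r0 : chart M U x -> chart M V y -> U q0 -> V r0 -> x q0 = y r0 ->
  [/\ differentiable (cinv V y \o x) q0, 'J x q0 = 'J (cinv V y \o x) q0 *m 'J y r0,
    'J (cinv V y \o x) q0 \in unitmx &
    \forall q \near q0, [/\ U q, V (cinv V y (x q)) & y (cinv V y (x q)) = x q]].
Proof.
move=> cx cy Uq0 Vr0 xy.
have oU := chart_open cx.
have dx := chart_diff cx Uq0.
have nU : \forall q \near q0, U q by exact: open_nbhs_nbhs.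
have Mx : \forall q \near q0, M (x q) by apply: filterS nU => q; exact: chart_in.
have [d1 d2 _] := cinv_comp cy Vr0 dx xy Mx; split=> //.
  have : (\rank ('J x q0) <= \rank ('J (cinv V y \o x) q0))%N by rewrite d2 mxrankM_maxl.
  have /eqP -> := chart_free cx Uq0.
  by rewrite -row_free_unit -row_leq_rank.
have H := cinv_near cy Vr0 openT I; rewrite -xy in H; have {}H := near_continuous (differentiable_continuous dx) H.
move: nU H; apply: filterS2 => q Uq H.
by have [[? _] ? _] := H (chart_in cx Uq).
Qed.

End Charts.

(** * Densities on a surface and their integrals *)

Section Decomp.
Variable R : realType.
Variable M : set 'rV[R]_3.
Local Notation RR := (measurableTypeR R * measurableTypeR R)%type.
Local Notation l2 := (@lebesgue_measure R \x @lebesgue_measure R)%E.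
Implicit Types (U V : set 'rV[R]_2) (x y : 'rV[R]_2 -> 'rV[R]_3).
Implicit Types (B C : set RR).
Implicit Type dens : ('rV[R]_2 -> 'rV[R]_3) -> 'rV[R]_2 -> R.

(** The integrands f sqrt (det g) of surface integrals, in terms of the
    chart; the last condition is their transformation rule. *)
Definition density dens := [/\
  (forall U x q, chart M U x -> U q -> 0 <= dens x q),
  (forall U x q, chart M U x -> U q -> {for q, continuous (dens x)}) &
  (forall U x V y q r A, chart M U x -> chart M V y -> U q -> V r -> x q = y r ->
     'J x q = A *m 'J y r -> A \in unitmx -> dens x q = dens y r * `|\det A|)].

Definition decomposition n (U : 'I_n -> set 'rV[R]_2) (x : 'I_n -> 'rV[R]_2 -> 'rV[R]_3)
    (B : 'I_n -> set RR) := [/\ (forall i, chart M (U i) (x i)),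
        (forall i, measurable (B i) /\ @plane R @` B i `<=` U i),
        (forall i j, i != j ->
           x i @` (@plane R @` B i) `&` x j @` (@plane R @` B j) = set0) &
        M = \bigcup_i (x i @` (@plane R @` B i))].

Definition overlap x (B : set RR) y (C : set RR) : set RR :=
  [set z | B z /\ (y @` (@plane R @` C)) (x (plane z))].

Definition dom_overlap U x V y : set 'rV[R]_2 := [set q | U q /\ (y @` V) (x q)].

Lemma dom_overlap_open U x V y : chart M U x -> chart M V y -> open (dom_overlap U x V y).
Proof.
move=> cx cy; rewrite openE => q [Uq [r Vr /esym xy]].
have [_ _ _] := transition cx cy Uq Vr xy; apply: filterS => p [Up Vp E].
by split=> //; exists (cinv V y (x p)).
Qed.

Lemma dom_overlap_diff U x V y q : chart M U x -> chart M V y -> dom_overlap U x V y q ->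
  differentiable (cinv V y \o x) q.
Proof.
by move=> cx cy [Uq [r Vr /esym xy]]; have [] := transition cx cy Uq Vr xy.
Qed.

Lemma overlap_measurable U x V y B C : chart M U x -> chart M V y ->
  measurable B -> measurable C -> @plane R @` B `<=` U -> @plane R @` C `<=` V ->
  measurable (overlap x B y C).
Proof.
move=> cx cy mB mC BU CV.
have oD := dom_overlap_open cx cy.
have -> : overlap x B y C = B `&` (@plane R @^-1` dom_overlap U x V y) `&` (chi_ext (dom_overlap U x V y) (cinv V y \o x) @^-1` C).
  apply/seteqP; split => z.
    move=> [Bz [_ [w Cw <-] yw]].
    have Vw : V (plane w) by apply: CV; exists w.
    have Dz : dom_overlap U x V y (plane z).
      by split; [apply: BU; exists z|exists (plane w)].
    by split=> //; rewrite /preimage /= /chi_ext mem_set //= -yw (cinvK cy) // planeK.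
  move=> [[Bz Dz]]; rewrite /preimage /= /chi_ext mem_set //= => Cz; split=> //.
  have [_ yV] := Dz; have [_ E] := cinvP yV.
  exists (plane (unplane (cinv V y (x (plane z))))); last by rewrite unplaneK.
  by eexists; first exact: Cz.
apply: measurableI; first by apply: measurableI => //; exact: open_plane_measurable.
apply: measurable_chi_ext_preimage => //.
by move=> q; exact: dom_overlap_diff.
Qed.

Lemma overlap_integral dens U x V y B C : density dens -> chart M U x -> chart M V y ->
  measurable B -> measurable C -> @plane R @` B `<=` U -> @plane R @` C `<=` V ->
  (\int[l2]_(z in overlap x B y C) (dens x (plane z))%:E =
   \int[l2]_(z in overlap y C x B) (dens y (plane z))%:E)%E.
Proof.
move=> [d0 dc dt] cx cy mB mC BU CV.
pose U1 := dom_overlap U x V y; pose V1 := dom_overlap V y U x.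
pose psi := cinv V y \o x; pose chi := cinv U x \o y.
have psiE q : U1 q -> V1 (psi q) /\ y (psi q) = x q.
  move=> [Uq yV]; have [Vp E] := cinvP yV; split=> //; split=> //.
  by exists q => //; exact: esym.
have chiE q : V1 q -> U1 (chi q) /\ x (chi q) = y q.
  move=> [Uq yV]; have [Vp E] := cinvP yV; split=> //; split=> //.
  by exists q => //; exact: esym.
apply: (change_of_variables (U := U1) (V := V1) (psi := psi) (chi := chi)).
- exact: dom_overlap_open.
- exact: dom_overlap_open.
- by move=> q /psiE[].
- move=> q U1q; have [_ E] := psiE q U1q; rewrite /chi /= E (cinvK cx)//; by case: U1q.
- move=> q U1q; have [_ E] := chiE q U1q; rewrite /psi /= E (cinvK cy)//; by case: U1q.
- by move=> q; exact: dom_overlap_diff.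
- by move=> q; exact: dom_overlap_diff.
- by move=> q [Uq _]; exact: dc cx Uq.
- by move=> q [Uq _]; exact: dc cy Uq.
- by move=> q [Uq _]; exact: d0 cx Uq.
- by move=> q [Uq _]; exact: d0 cy Uq.
- move=> q U1q; have [[Vp _] E] := psiE q U1q; have [Uq _] := U1q.
  have [_ JE uJ _] := transition cx cy Uq Vp (esym E).
  exact: (dt _ _ _ _ _ _ _ cx cy Uq Vp (esym E) JE uJ).
- exact: overlap_measurable cx cy _ _ _ _.
- exact: overlap_measurable cy cx _ _ _ _.
- move=> z [Bz [_ [w Cw <-] yw]]; split; first by apply: BU; exists z.
  by exists (plane w) => //; apply: CV; exists w.
- move=> z [Bz [_ [w Cw <-] yw]]; split; first by apply: CV; exists z.
  by exists (plane w) => //; apply: BU; exists w.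
apply/seteqP; split => [_ [_ [z [Bz [_ [w Cw <-] yw]] <-] <-]|_ [w [Cw [_ [z Bz <-] yw]] <-]].
  exists w; last by rewrite /psi /= -yw (cinvK cy)//; apply: CV; exists w.
  by split => //; exists (plane z) => //; exists z.
exists (plane z).
  by exists z => //; split => //; exists (plane w) => //; exists w.
by rewrite /psi /= yw (cinvK cy)//; apply: CV; exists w.
Qed.

Definition decomp_sum dens n (x : 'I_n -> 'rV[R]_2 -> 'rV[R]_3) (B : 'I_n -> set RR) :=
  (\sum_(i < n) \int[l2]_(z in B i) (dens (x i) (plane z))%:E)%E.

Lemma density_measurable dens U x B : density dens -> chart M U x -> measurable B ->
  @plane R @` B `<=` U -> measurable_fun B (fun z => (dens x (plane z))%:E).
Proof.
move=> [d0 dc dt] cx mB BU; apply/measurable_EFinP.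
apply: (@measurable_funS _ _ _ _ (@plane R @^-1` U : set RR)).
- apply: open_plane_measurable; exact: chart_open cx.
- by move=> z Bz; apply: BU; exists z.
by apply: continuous_plane_measurable; [exact: chart_open cx|move=> q; exact: dc cx].
Qed.

Lemma decomp_split dens n (U : 'I_n -> set 'rV[R]_2)
    (x : 'I_n -> 'rV[R]_2 -> 'rV[R]_3) (B : 'I_n -> set RR) V y C : density dens ->
  decomposition U x B -> chart M V y -> measurable C -> @plane R @` C `<=` V ->
  (\int[l2]_(z in C) (dens y (plane z))%:E =
   \sum_(i < n) \int[l2]_(z in overlap y C (x i) (B i)) (dens y (plane z))%:E)%E.
Proof.
move=> dd [cx mB tB ME] cy mC CV.
have CE : C = \big[setU/set0]_(i < n) overlap y C (x i) (B i).
  rewrite -bigcup_seq; apply/seteqP; split => [z Cz|z [i _ []//]].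
  have : M (y (plane z)) by apply: (chart_in cy); apply: CV; exists z.
  rewrite ME => -[i _ H]; exists i => //=; exact: mem_index_enum.
rewrite [in LHS]CE ge0_integral_bigsetU//.
- by move=> i; have [? ?] := mB i; exact: overlap_measurable cy (cx i) _ _ _ _.
- exact: index_enum_uniq.
- move=> i j _ _ [z [[Cz iz] [_ jz]]]; apply/eqP; apply: contraT => ij.
  by have := tB i j ij => /seteqP[/(_ (y (plane z))) E _]; exfalso; apply: E.
- rewrite -CE; exact: (density_measurable dd cy mC CV).
move=> z; rewrite -CE => Cz; rewrite lee_fin; have [d0 _ _] := dd.
by apply: d0 cy _; apply: CV; exists z.
Qed.

(** Both sums are refined along the pairwise overlaps of the pieces, on
    which two charts are compared by [change_of_variables]. *)
Theorem decomp_indep dens n (U : 'I_n -> set 'rV[R]_2)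
    (x : 'I_n -> 'rV[R]_2 -> 'rV[R]_3) (B : 'I_n -> set RR)
    m (V : 'I_m -> set 'rV[R]_2)
    (y : 'I_m -> 'rV[R]_2 -> 'rV[R]_3) (C : 'I_m -> set RR) :
  density dens -> decomposition U x B -> decomposition V y C ->
  decomp_sum dens x B = decomp_sum dens y C.
Proof.
move=> dd D1 D2; have [cx mB _ _] := D1; have [cy mC _ _] := D2.
rewrite /decomp_sum.
under eq_bigr => i _ do rewrite (decomp_split dd D2 (cx i) (mB i).1 (mB i).2).
under [RHS]eq_bigr => i _ do rewrite (decomp_split dd D1 (cy i) (mC i).1 (mC i).2).
rewrite exchange_big /=; apply: eq_bigr => j _; apply: eq_bigr => i _.
have [? ?] := mB i; have [? ?] := mC j.
exact: overlap_integral dd (cx i) (cy j) _ _ _ _.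
Qed.

End Decomp.

(** * Existence of decompositions and finiteness of integrals *)

Section Exist.
Variable R : realType.
Variable M : set 'rV[R]_3.
Hypotheses (sM : surface M) (cM : compact M).
Local Notation RR := (measurableTypeR R * measurableTypeR R)%type.
Local Notation l2 := (@lebesgue_measure R \x @lebesgue_measure R)%E.

(** The piece of a chart is the part of its domain that the earlier charts
    leave uncovered; the first chart therefore keeps its whole domain. *)
Lemma decomp_of_charts n (U : 'I_n -> set 'rV[R]_2) (x : 'I_n -> 'rV[R]_2 -> 'rV[R]_3) :
  (forall i, chart M (U i) (x i)) -> M `<=` \bigcup_i (x i @` U i) ->
  exists B : 'I_n -> set RR, decomposition M U x B /\
   forall i : 'I_n, val i = 0%N -> B i = @plane R @^-1` U i.
Proof.
move=> cx cov.
pose P i : set RR := @plane R @^-1` U i.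
have PU i : @plane R @` P i = U i.
  apply/seteqP; split => [_ [z Pz <-]|q Uq]; first exact: Pz.
  by exists (unplane q); rewrite ?unplaneK// /P /preimage /= unplaneK.
have mP i : measurable (P i) by apply: open_plane_measurable; exact: chart_open (cx i).
pose B i := P i `\` \big[setU/set0]_(j < n | (j < i)%N) overlap (x i) (P i) (x j) (P j).
have mB i : measurable (B i).
  apply: measurableD => //; apply: bigsetU_measurable => j _.
  by apply: overlap_measurable (cx i) (cx j) _ _ _ _; rewrite ?PU.
have BP i : B i `<=` P i by move=> z [].
have inB i z : B i z <-> P i z /\ forall j : 'I_n, (j < i)%N -> ~ (x j @` U j) (x i (plane z)).
  rewrite /B -bigcup_seq_cond; split=> -[Pz H]; split=> //.
    move=> j ji Hj; apply: H; exists j; first by rewrite /= mem_index_enum ji.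
    by split=> //; rewrite PU.
  move=> [j /andP[_ ji] [_]]; rewrite PU; exact: H.
exists B; split; last first.
  move=> i i0; apply/seteqP; split => z; first by move/BP.
  by move=> Pz; apply/inB; split=> // j; rewrite i0.
split=> //.
- move=> i; split=> // _ [z /BP Pz <-]; exact: Pz.
- have half (i j : 'I_n) : (j < i)%N -> x i @` (@plane R @` B i) `&` x j @` (@plane R @` B j) = set0.
    move=> ji; apply/seteqP; split => // p [[_ [z /inB[Pz H] <-] <-] [_ [w /BP Pw <-] E]].
    by apply: (H j ji); exists (plane w).
  move=> i j; rewrite neq_ltn => /orP[ij|ji]; last exact: half.
  by rewrite setIC; exact: half.
apply/seteqP; split => [p Mp|p [i _ [_ [z /BP Pz <-] <-]]]; last exact: chart_in (cx i) Pz.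
have ex : exists k, [exists i : 'I_n, (val i == k) && `[< (x i @` U i) p >]].
  have [i _ ip] := cov p Mp; exists (val i); apply/existsP; exists i.
  by rewrite eqxx /=; apply/asboolP.
case: (ex_minnP ex) => k /existsP[i /andP[/eqP ik /asboolP [q Uq qp]]] kmin.
exists i => //; exists q => //; exists (unplane q); last exact: unplaneK.
apply/inB; split; first by rewrite /P /preimage /= unplaneK.
move=> j ji; rewrite unplaneK qp => Hj.
suff : (k <= j)%N by rewrite leqNgt -ik ji.
by apply: kmin; apply/existsP; exists j; rewrite eqxx; apply/asboolP.
Qed.

(** The predicate P allows a prior restriction of the charts, for instance
    to small balls. *)
Lemma finite_charts (P : set 'rV[R]_2 -> ('rV[R]_2 -> 'rV[R]_3) -> Prop) :
  (forall p, M p -> exists U x q, [/\ chart M U x, U q, x q = p & P U x]) ->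
  exists S : seq (set 'rV[R]_2 * ('rV[R]_2 -> 'rV[R]_3)),
    (forall i, (i < size S)%N -> chart M (nth (set0, fun=> 0) S i).1 (nth (set0, fun=> 0) S i).2 /\
        P (nth (set0, fun=> 0) S i).1 (nth (set0, fun=> 0) S i).2) /\
    forall p, M p -> exists2 i, (i < size S)%N & ((nth (set0, fun=> 0) S i).2 @` (nth (set0, fun=> 0) S i).1) p.
Proof.
move=> H.
have ch p : exists Ux : set 'rV[R]_2 * ('rV[R]_2 -> 'rV[R]_3), M p ->
   [/\ chart M Ux.1 Ux.2, (Ux.2 @` Ux.1) p & P Ux.1 Ux.2].
  have [Mp|] := pselect (M p); last by exists (set0, fun=> 0).
  have [U [x [q [cx Uq qp PU]]]] := H p Mp; exists (U, x) => _; split => //.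
  by exists q.
have [f Hf] := choice ch.
have chW p : exists W : set 'rV[R]_3, M p -> open W /\ (f p).2 @` (f p).1 = M `&` W.
  have [Mp|] := pselect (M p); last by exists set0.
  have [cx _ _] := Hf p Mp.
  have [W oW E] := chart_image cx (chart_open cx) (@subset_refl _ _).
  by exists W.
have [W HW] := choice chW.
have := cM; rewrite compact_cover => /(_ _ M W) [].
- by move=> p /HW[].
- move=> p Mp; exists p => //; have [_ E] := HW p Mp; have [_ + _] := Hf p Mp.
  by rewrite E => -[].
move=> D' DM' cov'; pose D : seq 'rV[R]_3 := finmap.enum_fset D'.
have DM : {subset D <= M} by exact: DM'.
have cov p : M p -> exists2 r, r \in D & W r p by move=> /cov'[r rD Wp]; exists r.
exists [seq f p | p <- D]; split.
  move=> i; rewrite size_map => iD; rewrite (nth_map 0)//.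
  have /DM : nth 0 D i \in D by exact: mem_nth.
  by rewrite inE => /Hf[].
move=> p Mp; have [r rD Wp] := cov p Mp.
exists (index r D); first by rewrite size_map index_mem.
rewrite (nth_map 0) ?index_mem// nth_index//.
have := DM r rD; rewrite inE => Mr; have [_ ->] := HW r Mr; by [].
Qed.

(** Isolates the integral over the domain of a given chart as one term of
    the total. *)
Lemma decomp_starting U0 x0 : chart M U0 x0 ->
  exists n (U : 'I_n.+1 -> set 'rV[R]_2) (x : 'I_n.+1 -> 'rV[R]_2 -> 'rV[R]_3) B,
   [/\ decomposition M U x B, U ord0 = U0, x ord0 = x0 & B ord0 = @plane R @^-1` U0].
Proof.
move=> c0; have [S [cS covS]] := @finite_charts (fun _ _ => True) (fun p Mp => let: ex_intro U (ex_intro x (ex_intro q (And3 a b c))) := (let: And3 _ _ h := sM in h p Mp) in ex_intro _ U (ex_intro _ x (ex_intro _ q (And4 a b c I)))).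
pose T := (U0, x0) :: S.
pose U (i : 'I_(size S).+1) := (nth (set0, fun=> 0) T i).1.
pose x (i : 'I_(size S).+1) := (nth (set0, fun=> 0) T i).2.
have cx i : chart M (U i) (x i).
  by case: i => [[|i] Hi]; rewrite /U /x //=; exact: (cS _ _).1.
have [|B [dB B0]] := decomp_of_charts cx.
  move=> p Mp; have [i iS H] := covS p Mp.
  by exists (lift ord0 (Ordinal iS)) => //; rewrite /x /U /= /bump /=.
by exists (size S), U, x, B; split => //; rewrite B0.
Qed.

(** Each point has a chart whose domain is a ball on which the density is
    bounded, and finitely many of these charts cover M. *)
Lemma chart_bounded dens : density M dens ->
  exists n (U : 'I_n -> set 'rV[R]_2) (x : 'I_n -> 'rV[R]_2 -> 'rV[R]_3) B,
   decomposition M U x B /\ (decomp_sum dens x B < +oo)%E.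
Proof.
move=> dd; have [d0 dc dt] := dd.
pose P U x := exists C, forall q, U q -> `|q| <= C /\ dens x q <= C.
have [S [cS covS]] : exists S : seq (set 'rV[R]_2 * ('rV[R]_2 -> 'rV[R]_3)),
    (forall i, (i < size S)%N -> chart M (nth (set0, fun=> 0) S i).1 (nth (set0, fun=> 0) S i).2 /\
        P (nth (set0, fun=> 0) S i).1 (nth (set0, fun=> 0) S i).2) /\
    forall p, M p -> exists2 i, (i < size S)%N & ((nth (set0, fun=> 0) S i).2 @` (nth (set0, fun=> 0) S i).1) p.
  apply: finite_charts => p Mp; have [_ _ /(_ p Mp)[U [x [q [cx Uq xq]]]]] := sM.
  have : \forall r \near q, U r /\ dens x r <= dens x q + 1.
    near=> r; split; near: r; first by apply: open_nbhs_nbhs; split => //; exact: chart_open cx.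
    have /cvgrPdist_le /(_ _ ltr01) := dc _ _ _ cx Uq; apply: filterS => r.
    by rewrite ler_norml => /andP[? _]; lra.
  move=> /nbhs_ballP[e /= e0 He]; exists (ball q e), x, q; split=> //.
  - by apply: chart_restrict cx (ball_open _ _) _ => // r /He[].
  - exact: ballxx.
  exists (Num.max (`|q| + e) (dens x q + 1)) => r qr; rewrite !le_max; split.
    apply/orP; left; move: qr; rewrite -ball_normE /= => qr.
    rewrite -[r](subrK q) (le_trans (ler_normD _ _))// addrC lerD2l distrC ltW//.
  by apply/orP; right; have [] := He _ qr.
pose U (i : 'I_(size S)) := (nth (set0, fun=> 0) S i).1.
pose x (i : 'I_(size S)) := (nth (set0, fun=> 0) S i).2.
have cx i : chart M (U i) (x i) by exact: (cS i (ltn_ord i)).1.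
have [|B [dB _]] := decomp_of_charts cx.
  by move=> p Mp; have [i iS H] := covS p Mp; exists (Ordinal iS).
exists (size S), U, x, B; split=> //.
rewrite /decomp_sum; apply/lte_sum_pinfty => i _.
have [C HC] := (cS i (ltn_ord i)).2; rewrite -/(U i) -/(x i) in HC.
have [_ mB _ _] := dB; have [mBi BU] := mB i.
have inU z : B i z -> U i (plane z) by move=> Bz; apply: BU; exists z.
apply: (@le_lt_trans _ _ (\int[l2]_(z in B i) (cst `|C|%:E) z)%E).
  apply: ge0_le_integral => //.
  - by move=> z /inU Uz; rewrite lee_fin; exact: d0 (cx i) Uz.
  - exact: density_measurable dd (cx i) mBi BU.
  - by move=> z /inU Uz; rewrite lee_fin (le_trans (HC _ Uz).2)// ler_norm.
rewrite integral_cst//; apply: lte_mul_pinfty => //.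
have mr : measurable (rect (- (`|C| + 1)) (`|C| + 1) (- (`|C| + 1)) (`|C| + 1)) by exact: measurable_rect.
have C1 : 0 <= `|C| by [].
apply: (@le_lt_trans _ _ (l2 (rect (- (`|C| + 1)) (`|C| + 1) (- (`|C| + 1)) (`|C| + 1)))).
  apply: le_measure; rewrite ?inE// => z /inU Uz; have [+ _] := HC _ Uz.
  have := rV_coord_le (plane z) 0; have := rV_coord_le (plane z) 1; rewrite !mxE /= => h1 h2 h3.
  have h4 : C <= `|C| by exact: ler_norm.
  move: (le_trans h1 h3) (le_trans h2 h3); rewrite !ler_norml => /andP[? ?] /andP[? ?].
  by split; rewrite /= in_itv/=; apply/andP; split; lra.
by rewrite l2_rect ?ltry//; lra.
Unshelve. all: by end_near. Qed.

Lemma decomp_sum_fin dens n (U : 'I_n -> set 'rV[R]_2) (x : 'I_n -> 'rV[R]_2 -> 'rV[R]_3) B :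
  density M dens -> decomposition M U x B -> decomp_sum dens x B \is a fin_num.
Proof.
move=> dd D; have [m [V [y [C [D' fin]]]]] := chart_bounded dd.
rewrite (decomp_indep dd D D') ge0_fin_numE// /decomp_sum sume_ge0// => i _.
apply: integral_ge0 => z Cz; rewrite lee_fin; have [d0 _ _] := dd.
have [cy mC _ _] := D'; apply: d0 (cy i) _; apply: (mC i).2; by exists z.
Qed.

End Exist.

(** * Fundamental forms of an ovaloid *)

Section TwoForms.
Variable R : realType.

Lemma matrix2P (A B : 'M[R]_2) : A 0 0 = B 0 0 -> A 0 1 = B 0 1 -> A 1 0 = B 1 0 -> A 1 1 = B 1 1 -> A = B.
Proof.
move=> h1 h2 h3 h4; apply/matrixP => i j.
have two (k : 'I_2) : k = 0 \/ k = 1.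
  by case: k => [[|[|k]] Hk] //; [left|right]; exact: val_inj.
by case: (two i) => ->; case: (two j) => ->.
Qed.

Lemma mulmx2E (A B : 'M[R]_2) i j : (A *m B) i j = A i 0 * B 0 j + A i 1 * B 1 j.
Proof.
rewrite mxE !big_ord_recl big_ord0 addr0.
by congr (_ * _ + A _ _ * B _ _); exact: val_inj.
Qed.

Lemma trace2E (A : 'M[R]_2) : \tr A = A 0 0 + A 1 1.
Proof. by rewrite /mxtrace !big_ord_recl big_ord0 addr0; congr (_ + A _ _); exact: val_inj. Qed.

Lemma quad2 (A : 'M[R]_2) (w : 'rV[R]_2) : (w *m A *m w^T) 0 0 =
  w 0 0 ^+ 2 * A 0 0 + w 0 0 * w 0 1 * (A 0 1 + A 1 0) + w 0 1 ^+ 2 * A 1 1.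
Proof.
have rv k : (w *m A) 0 k = w 0 0 * A 0 k + w 0 1 * A 1 k.
  rewrite mxE !big_ord_recl big_ord0 addr0; by congr (_ * _ + w _ _ * A _ _); exact: val_inj.
rewrite mxE !big_ord_recl big_ord0 addr0 !mxE.
have -> : lift ord0 ord0 = 1 :> 'I_2 by exact: val_inj.
have := rv 0; have := rv 1; rewrite !mxE => -> ->; ring.
Qed.

Definition posdef (A : 'M[R]_2) := forall w : 'rV[R]_2, w != 0 -> 0 < (w *m A *m w^T) 0 0.

Definition rv2 (a b : R) : 'rV[R]_2 := \row_j (if j == 0 then a else b).

Lemma rv2_neq0 a b : (a != 0) || (b != 0) -> rv2 a b != 0.
Proof.
move=> H; apply/eqP => /rowP E; have := E 0; have := E 1; rewrite !mxE /= => b0 a0.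
by move: H; rewrite a0 b0 eqxx.
Qed.

Lemma posdef_quad A a b : posdef A -> (a != 0) || (b != 0) ->
  0 < a ^+ 2 * A 0 0 + a * b * (A 0 1 + A 1 0) + b ^+ 2 * A 1 1.
Proof. by move=> pA /rv2_neq0/pA; rewrite quad2 !mxE /=. Qed.

Lemma posdef_det A : posdef A -> A 0 1 = A 1 0 -> [/\ 0 < A 0 0, 0 < A 1 1 & 0 < \det A].
Proof.
move=> pA sA; have n1 : (1 != 0 :> R) by exact: oner_neq0.
have h0 : 0 < A 0 0 by have := posdef_quad (a := 1) (b := 0) pA; rewrite n1 => /(_ isT); nra.
have h1 : 0 < A 1 1 by have := posdef_quad (a := 0) (b := 1) pA; rewrite n1 orbT => /(_ isT); nra.
split=> //; rewrite det22.
have := posdef_quad (a := A 0 1) (b := - A 0 0) pA; rewrite oppr_eq0 (gt_eqF h0) orbT => /(_ isT).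
rewrite sA => H; rewrite -(pmulr_rgt0 _ h0); apply: lt_le_trans H _.
by rewrite le_eqVlt; apply/orP; left; apply/eqP; ring.
Qed.

(** S is self-adjoint for the inner product I. The discriminant of its
    characteristic polynomial, up to a positive factor, is a sum of two
    nonnegative terms (disc); when both vanish, S I is proportional to I. *)
Lemma two_forms (I S : 'M[R]_2) : posdef I -> I 0 1 = I 1 0 ->
  posdef (S *m I) -> (S *m I) 0 1 = (S *m I) 1 0 ->
  [/\ 0 < \det I, 0 < \det S, 0 < \tr S, 4 * \det S <= \tr S ^+ 2 &
     4 * \det S = \tr S ^+ 2 -> S = (\tr S / 2)%:M].
Proof.
move=> pI sI pS sS; have [E0 G0 D0] := posdef_det pI sI.
have [e0 g0 d0] := posdef_det pS sS.
have dS : 0 < \det S by move: d0; rewrite det_mulmx pmulr_lgt0.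
have trD : \tr S * \det I = (S *m I) 0 0 * I 1 1 - 2 * (S *m I) 0 1 * I 0 1 + (S *m I) 1 1 * I 0 0.
  have : (S *m I) 0 1 * I 0 1 = (S *m I) 1 0 * I 0 1 by rewrite sS.
  by rewrite !mulmx2E trace2E det22 -sI; lra.
have dSD : \det S * \det I = (S *m I) 0 0 * (S *m I) 1 1 - (S *m I) 0 1 ^+ 2.
  by rewrite -det_mulmx det22 -sS expr2.
have detI : \det I = I 0 0 * I 1 1 - I 0 1 ^+ 2 by rewrite det22 -sI expr2.
have T0 : 0 < \tr S.
  have := posdef_quad (a := I 0 1) (b := - I 0 0) pS.
  rewrite oppr_eq0 (gt_eqF E0) orbT => /(_ isT) H.
  rewrite -(pmulr_lgt0 _ D0) trD -(pmulr_rgt0 _ E0).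
  have H2 : 0 < (S *m I) 0 0 * (I 0 0 * I 1 1 - I 0 1 ^+ 2) by rewrite -detI mulr_gt0.
  apply: lt_le_trans (addr_gt0 H H2) _; rewrite -sS le_eqVlt; apply/orP; left; apply/eqP; ring.
have disc : (I 0 0 * \det I) ^+ 2 * (\tr S ^+ 2 - 4 * \det S) =
   4 * \det I * (I 0 0 * (S *m I) 0 1 - I 0 1 * (S *m I) 0 0) ^+ 2 +
   (I 0 0 * (I 0 0 * (S *m I) 1 1 - I 1 1 * (S *m I) 0 0) - 2 * I 0 1 * (I 0 0 * (S *m I) 0 1 - I 0 1 * (S *m I) 0 0)) ^+ 2.
  transitivity (I 0 0 ^+ 2 * ((\tr S * \det I) ^+ 2 - 4 * \det I * (\det S * \det I))); first by ring.
  rewrite trD dSD detI; ring.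
have ED : 0 < (I 0 0 * \det I) ^+ 2 by rewrite exprn_gt0// mulr_gt0.
have P1 : 0 <= 4 * \det I * (I 0 0 * (S *m I) 0 1 - I 0 1 * (S *m I) 0 0) ^+ 2.
  by rewrite mulr_ge0 ?sqr_ge0// mulr_ge0// ltW.
have P2 := sqr_ge0 (I 0 0 * (I 0 0 * (S *m I) 1 1 - I 1 1 * (S *m I) 0 0) - 2 * I 0 1 * (I 0 0 * (S *m I) 0 1 - I 0 1 * (S *m I) 0 0)).
split=> //.
  by rewrite -subr_ge0 -(pmulr_rge0 _ ED) disc addr_ge0.
move=> E; move: disc; rewrite E subrr mulr0 => /esym/eqP; rewrite paddr_eq0// => /andP[/eqP z1 /eqP z2].
have f1 : I 0 0 * (S *m I) 0 1 = I 0 1 * (S *m I) 0 0.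
  by move/eqP: z1; rewrite mulf_eq0 sqrf_eq0 subr_eq0 mulf_eq0 (gt_eqF D0) pnatr_eq0 /= => /eqP.
have f2 : I 0 0 * (S *m I) 1 1 = I 1 1 * (S *m I) 0 0.
  move/eqP: z2; rewrite sqrf_eq0 f1 subrr mulr0 subr0 mulf_eq0 (gt_eqF E0) /= subr_eq0 => /eqP //.
pose c := (S *m I) 0 0 / I 0 0.
have uI : I \in unitmx by rewrite unitmxE unitfE gt_eqF.
have cI : S *m I = c%:M *m I.
  have cE i j : (c%:M *m I) i j = c * I i j by rewrite mul_scalar_mx mxE.
  apply: matrix2P; rewrite cE /c; first by rewrite divfK// gt_eqF.
  - by apply: (mulfI (lt0r_neq0 E0)); rewrite f1 mulrA [_ * (_ / _)]mulrC divfK ?gt_eqF// mulrC.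
  - by rewrite -sS -sI; apply: (mulfI (lt0r_neq0 E0)); rewrite f1 mulrA [_ * (_ / _)]mulrC divfK ?gt_eqF// mulrC.
  - by apply: (mulfI (lt0r_neq0 E0)); rewrite f2 mulrA [_ * (_ / _)]mulrC divfK ?gt_eqF// mulrC.
have Sc : S = c%:M by rewrite -[S](mulmxK uI) cI mulmxK.
by rewrite Sc mxtrace_scalar -[c *+ 2]mulr_natr -mulrA divff ?mulr1// pnatr_eq0.
Qed.

End TwoForms.

Lemma shape_of (R : realType) (M : set 'rV[R]_3) x q (S : 'M[R]_2) : row_free ('J x q) ->
  'J (inner_normal M \o x) q = - (S *m 'J x q) -> shape_mx M x q = S.
Proof.
move=> fJ E; rewrite /shape_mx E; move: ('J x q) fJ => J fJ.
by rewrite opprK -mulmxA mulmxVp// mulmx1.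
Qed.

Lemma first_formE (R : realType) (x : 'rV[R]_2 -> 'rV[R]_3) q :
  first_form x q = 'J x q *m ('J x q)^T.
Proof. by []. Qed.

Section Ovaloid.
Variable R : realType.
Variable M : set 'rV[R]_3.
Hypothesis ov : ovaloid M.
Local Notation N := (inner_normal M).
Implicit Types (U V : set 'rV[R]_2) (x y : 'rV[R]_2 -> 'rV[R]_3).

Lemma ov_surface : surface M. Proof. by case: ov. Qed.
Lemma ov_compact : compact M. Proof. by case: ov. Qed.

Lemma ov_posdef U x q : chart M U x -> U q -> posdef (second_form M x q).
Proof. by case: ov => _ _ h cx Uq; exact: h cx Uq. Qed.

Lemma ov_J_neq0 U x q : chart M U x -> U q -> 'J (N \o x) q <> 0.
Proof.
move=> cx Uq E; have n0 : rv2 (1 : R) 0 != 0 by apply: rv2_neq0; rewrite oner_eq0.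
by have := ov_posdef cx Uq n0; rewrite /second_form /shape_mx E oppr0 !mul0mx mulmx0 mul0mx mxE ltxx.
Qed.

(** At a point where N o x is not differentiable its Jacobian matrix is
    zero by [nondiffJ], and so would be the second fundamental form. *)
Lemma ov_diffN U x q : chart M U x -> U q -> differentiable (N \o x) q.
Proof.
move=> cx Uq; have [//|nd] := pselect (differentiable (N \o x) q).
by case: (ov_J_neq0 cx Uq); exact: nondiffJ.
Qed.

Lemma inner_normal_cases p : is_inner_normal M p (N p) \/ N p = 0.
Proof.
by rewrite /inner_normal; case: xgetP => [n _ Hn|]; [left|right].
Qed.

(** Where no interior normal exists, [inner_normal] takes the value 0.
    As N o x is continuous and takes only this value and unit vectors, it
    would vanish in a neighbourhood, and so would its Jacobian matrix. *)
Lemma ov_normal p : M p -> is_inner_normal M p (N p).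
Proof.
move=> Mp; have [//|N0] := inner_normal_cases p; exfalso.
have [_ _ /(_ p Mp)[U [x [q [cx Uq xq]]]]] := ov_surface.
apply: (ov_J_neq0 cx Uq).
have dN := ov_diffN cx Uq.
have /cvgrPdist_le := differentiable_continuous dN.
have e0 : 0 < 2^-1 :> R by rewrite invr_gt0.
move=> /(_ _ e0) H.
have Z : \forall r \near q, (fun=> 0) r = (N \o x) r.
  move: H; apply: filterS => r /=; rewrite xq N0 sub0r normrN => H.
  have [[n1 _ _]|->//] := inner_normal_cases (x r).
  have := dot_le (N (x r)) (N (x r)); rewrite n1 normr1 => h3.
  exfalso; have h4 : `|N (x r)| * `|N (x r)| <= 2^-1 * 2^-1 by rewrite ler_pM.
  by move: h3 h4; clear; move: (_ * `|_|) => u; lra.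
have dc : differentiable (fun=> 0 : 'rV[R]_3) q by exact: differentiable_cst.
have [_ ->] := near_eq_J Z dc.
apply/row_matrixP => i; rewrite rowE row0 -diffJ.
by have -> : 'd (fun=> 0 : 'rV[R]_3) q = 0 :> (_ -> _) by exact: diff_cst.
Qed.

Lemma ov_unit p : M p -> dot (N p) (N p) = 1. Proof. by move/ov_normal; case. Qed.

Lemma ov_N0 p : M p -> N p != 0.
Proof. by move=> Mp; rewrite -dot_eq0 ov_unit// oner_eq0. Qed.

Lemma ov_perp U x q : chart M U x -> U q -> 'J x q *m (N (x q))^T = 0.
Proof.
move=> cx Uq; have [_ H _] := ov_normal (chart_in cx Uq).
by apply/perp_col => w; apply: H; exists U, x, q; split=> //; exact: submxMl.
Qed.

Lemma ov_smoothN U x : chart M U x -> smooth_on U (N \o x).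
Proof.
move=> cx; apply: (smooth_normal (chart_open cx) (chart_smooth cx)).
- by move=> q; exact: chart_free cx.
- by move=> q; exact: ov_diffN cx.
- by move=> q Uq; exact/ov_unit/(chart_in cx).
- by move=> q; exact: ov_perp cx.
Qed.

(** Differentiate <N, N> = 1. *)
Lemma ov_JN_perp U x q : chart M U x -> U q -> 'J (N \o x) q *m (N (x q))^T = 0.
Proof.
move=> cx Uq; have dN := ov_diffN cx Uq.
apply/perp_col => w; rewrite -(deriveEjacobian w dN).
have := derive_dot w dN dN.
have -> : 'D_w (fun q => dot ((N \o x) q) ((N \o x) q)) q = 0.
  rewrite -(derive_cst (1 : R) q w); apply: near_eq_derive.
  have nU : \forall r \near q, U r by apply: open_nbhs_nbhs; split => //; exact: chart_open cx.
  by apply: filterS nU => r Ur; exact/ov_unit/(chart_in cx).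
rewrite [dot ((N \o x) q) _]dotC -mulr2n => /esym/eqP; rewrite mulrn_eq0 /= => /eqP; exact.
Qed.

Lemma ov_JN_sub U x q : chart M U x -> U q -> ('J (N \o x) q <= 'J x q)%MS.
Proof.
move=> cx Uq; apply/row_subP => i; apply: (perp_row (n := N (x q))).
- exact: chart_free cx Uq.
- exact/ov_N0/(chart_in cx).
- exact: ov_perp cx Uq.
- by rewrite rowE dot_mulmx (ov_JN_perp cx Uq) mulmx0 mxE.
Qed.

Lemma ov_JN U x q : chart M U x -> U q -> 'J (N \o x) q = - shape_mx M x q *m 'J x q.
Proof.
move=> cx Uq; have := ov_JN_sub cx Uq; rewrite /shape_mx.
move: ('J (N \o x) q) ('J x q) => A B AB.
by rewrite !mulNmx opprK mulmxKpV.
Qed.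

Lemma ov_IIE U x q : chart M U x -> U q ->
  second_form M x q = - ('J (N \o x) q *m ('J x q)^T).
Proof.
move=> cx Uq; rewrite (ov_JN cx Uq) /second_form /first_form.
move: (shape_mx M x q) ('J x q) => A B.
by rewrite !mulNmx opprK mulmxA.
Qed.

Lemma gram_entry (A B : 'M[R]_(2, 3)) i j : (A *m B^T) i j = dot (row i A) (row j B).
Proof. by rewrite dotE mxE; apply: eq_bigr => k _; rewrite !mxE. Qed.

Lemma ov_I_entry U x q i j : chart M U x -> U q ->
  first_form x q i j = dot ('D_(delta_mx 0 i) x q) ('D_(delta_mx 0 j) x q).
Proof.
by move=> cx Uq; rewrite gram_entry !(derive_row (chart_smooth cx) _ Uq).
Qed.

Lemma ov_II_entry U x q i j : chart M U x -> U q ->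
  second_form M x q i j = - dot ('D_(delta_mx 0 i) (N \o x) q) ('D_(delta_mx 0 j) x q).
Proof.
move=> cx Uq; rewrite (ov_IIE cx Uq) mxE gram_entry (derive_row (chart_smooth cx) _ Uq).
by rewrite (derive_row (ov_smoothN cx) _ Uq).
Qed.

(** Differentiate <N, x_j> = 0. *)
Lemma ov_II_hess U x q i j : chart M U x -> U q ->
  second_form M x q i j = dot (N (x q)) ('D_(delta_mx 0 i) (fun r => 'D_(delta_mx 0 j) x r) q).
Proof.
move=> cx Uq; rewrite (ov_II_entry _ _ cx Uq).
have oU := chart_open cx; have dN := ov_diffN cx Uq.
have dx : differentiable (fun r => 'D_(delta_mx 0 j) x r) q.
  have [_ H] := (Ck_smooth U x).1 (chart_smooth cx) 1%N; exact: (H _).1 q Uq.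
have := derive_dot (delta_mx 0 i) dN dx.
have -> : 'D_(delta_mx 0 i) (fun q => dot ((N \o x) q) ('D_(delta_mx 0 j) x q)) q = 0.
  rewrite -(derive_cst (0 : R) q (delta_mx 0 i)); apply: near_eq_derive.
  have nU : \forall r \near q, U r by exact: open_nbhs_nbhs.
  apply: filterS nU => r Ur; rewrite (derive_row (chart_smooth cx) _ Ur) rowE dotC dot_mulmx.
  by rewrite (ov_perp cx Ur) mulmx0 mxE.
by move/esym/eqP; rewrite addrC addr_eq0 => /eqP ->.
Qed.

Lemma mixed_partials U x q u v : open U -> smooth_on U x -> U q ->
  'D_u (fun r => 'D_v x r) q = 'D_v (fun r => 'D_u x r) q.
Proof.
move=> oU sx Uq.
have Cx n : Ck n U x by apply: (Ck_smooth U x).1.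
apply/rowP => k.
have C1 : Ck 1 U (fun r => x r 0 k) by apply: (Ck_rowP oU _ _).1.
have dD l m : derivable (fun r => 'D_l x r) q m.
  by apply: diff_derivable; have [_ H] := Cx 1%N; exact: (H _).1 q Uq.
have E l m : 'D_l (fun r => 'D_m x r) q 0 k =
   'D_l (fun r => 'D_m (fun r => x r 0 k) r) q.
  apply: (etrans (derive_coord _ (dD _ _))).
  apply: near_eq_derive.
  have nU : \forall r \near q, U r by exact: open_nbhs_nbhs.
  apply: filterS nU => r Ur; apply: derive_coord; apply: diff_derivable.
  exact: Ck_diff (Cx 0%N) Ur.
apply: (etrans (E _ _)); apply: (etrans _ (esym (E _ _))).
exact: clairaut oU Uq C1.
Qed.

Lemma ov_II_sym U x q i j : chart M U x -> U q -> second_form M x q i j = second_form M x q j i.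
Proof.
move=> cx Uq; apply: (etrans (ov_II_hess _ _ cx Uq)); apply: (etrans _ (esym (ov_II_hess _ _ cx Uq))).
exact: (congr1 (dot _) (mixed_partials _ _ (chart_open cx) (chart_smooth cx) Uq)).
Qed.

Lemma ov_I_sym x q i j : first_form x q i j = first_form x q j i.
Proof. by rewrite !gram_entry dotC. Qed.

Lemma ov_I_posdef U x q : chart M U x -> U q -> posdef (first_form x q).
Proof.
move=> cx Uq w w0.
have -> : (w *m first_form x q *m w^T) 0 0 = dot (w *m 'J x q) (w *m 'J x q).
  by rewrite /dot trmx_mul !mulmxA.
rewrite lt_neqAle dot_ge0 andbT eq_sym dot_eq0; apply: contra w0 => /eqP E.
by apply/eqP; apply: (row_free_inj (chart_free cx Uq)); rewrite /= E mul0mx.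
Qed.

Lemma ov_forms U x q : chart M U x -> U q ->
  [/\ 0 < \det (first_form x q), 0 < \det (shape_mx M x q), 0 < \tr (shape_mx M x q),
    4 * \det (shape_mx M x q) <= \tr (shape_mx M x q) ^+ 2 &
    4 * \det (shape_mx M x q) = \tr (shape_mx M x q) ^+ 2 ->
      shape_mx M x q = (\tr (shape_mx M x q) / 2)%:M].
Proof.
move=> cx Uq; apply: two_forms.
- exact: ov_I_posdef cx Uq.
- exact: ov_I_sym.
- exact: ov_posdef cx Uq.
- exact: ov_II_sym cx Uq.
Qed.

(** The Gauss map is a function on M, so that its Jacobian matrix changes
    in the same way as that of x. *)
Lemma ov_change U x V y q r A : chart M U x -> chart M V y -> U q -> V r -> x q = y r ->
  'J x q = A *m 'J y r -> A \in unitmx ->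
  [/\ first_form x q = A *m first_form y r *m A^T,
     shape_mx M x q = A *m shape_mx M y r *m invmx A &
     second_form M x q = A *m second_form M y r *m A^T].
Proof.
move=> cx cy Uq Vr xy JE uA.
have [dpsi JE' _ nr] := transition cx cy Uq Vr xy.
have AE : 'J (cinv V y \o x) q = A.
  apply: (row_free_inj (chart_free cy Vr)); rewrite /= -JE'; exact: JE.
have psiq : (cinv V y \o x) q = r by rewrite /= xy (cinvK cy).
have dNy : differentiable (N \o y) ((cinv V y \o x) q) by rewrite psiq; exact: ov_diffN cy Vr.
have JN : 'J (N \o x) q = A *m 'J (N \o y) r.
  have E : \forall p \near q, ((N \o y) \o (cinv V y \o x)) p = (N \o x) p.
    by apply: filterS nr => p [_ _] /= ->.
  have dc : differentiable ((N \o y) \o (cinv V y \o x)) q by exact: differentiable_comp.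
  have [_ ->] := near_eq_J E dc.
  have H := jacobian_comp dpsi dNy; rewrite psiq AE in H; exact: H.
have I1 : first_form x q = A *m first_form y r *m A^T.
  by rewrite /first_form JE trmx_mul !mulmxA.
have S1 : shape_mx M x q *m A = A *m shape_mx M y r.
  have h1 := ov_JN cx Uq; have h2 := ov_JN cy Vr; move: h1; rewrite JN h2 JE.
  have fy := chart_free cy Vr.
  move: (shape_mx M x q) (shape_mx M y r) ('J y r) fy => S T J fJ.
  rewrite !mulNmx mulmxN => /oppr_inj h; apply: (row_free_inj fJ).
  by rewrite /= -mulmxA -h mulmxA.
split=> //.
  by move: S1; move: (shape_mx M x q) => S S1; rewrite -S1 mulmxK.
rewrite /second_form I1; move: S1; move: (shape_mx M x q) (shape_mx M y r) (first_form y r) => S T I S1.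
by rewrite !mulmxA S1.
Qed.

End Ovaloid.

(** * Linearity and comparison of integrals *)

Section Total.
Variable R : realType.
Local Notation RR := (measurableTypeR R * measurableTypeR R)%type.
Local Notation l2 := (@lebesgue_measure R \x @lebesgue_measure R)%E.

Definition psum n (B : 'I_n -> set RR) (F : 'I_n -> RR -> R) : R :=
  \sum_(i < n) Rintegral l2 (B i) (F i).

Definition pintegrable n (B : 'I_n -> set RR) (F : 'I_n -> RR -> R) :=
  forall i, measurable (B i) /\ l2.-integrable (B i) (EFin \o F i).

Lemma psum_eq n (B : 'I_n -> set RR) F G : (forall i z, B i z -> F i z = G i z) ->
  psum B F = psum B G.
Proof.
by move=> FG; apply: eq_bigr => i _; apply: eq_Rintegral => z; rewrite inE; exact: FG.
Qed.

Lemma pintegrable_comb n (B : 'I_n -> set RR) F G (a b : R) :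
  pintegrable B F -> pintegrable B G ->
  pintegrable B (fun i z => a * F i z + b * G i z).
Proof.
move=> hF hG i; have [mB iF] := hF i; have [_ iG] := hG i; split=> //.
have := integrableD mB (integrableZl mB a iF) (integrableZl mB b iG).
by congr (_.-integrable _ _); apply/funext => z /=; rewrite EFinD !EFinM.
Qed.

Lemma psum_comb n (B : 'I_n -> set RR) F G (a b : R) :
  pintegrable B F -> pintegrable B G ->
  psum B (fun i z => a * F i z + b * G i z) = a * psum B F + b * psum B G.
Proof.
move=> hF hG; rewrite /psum !mulr_sumr -big_split /=; apply: eq_bigr => i _.
have [mB iF] := hF i; have [_ iG] := hG i.
have sc (c : R) (H : RR -> R) : l2.-integrable (B i) (EFin \o H) ->
    l2.-integrable (B i) (EFin \o (fun z => c * H z)).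
  move=> iH; have := integrableZl mB c iH.
  by congr (_.-integrable _ _); apply/funext => z /=; rewrite EFinM.
by rewrite RintegralD ?RintegralZl//; exact: sc.
Qed.

Lemma psum_le n (B : 'I_n -> set RR) F G : pintegrable B F -> pintegrable B G ->
  (forall i z, B i z -> F i z <= G i z) -> psum B F <= psum B G.
Proof.
move=> hF hG FG; apply: ler_sum => i _; have [mB iF] := hF i; have [_ iG] := hG i.
by apply: le_Rintegral => // z; exact: FG.
Qed.

Variable M : set 'rV[R]_3.
Hypotheses (sM : surface M) (cM : compact M).
Implicit Types (U V : set 'rV[R]_2) (x y : 'rV[R]_2 -> 'rV[R]_3).
Implicit Type dens : ('rV[R]_2 -> 'rV[R]_3) -> 'rV[R]_2 -> R.

Definition dsum dens n (x : 'I_n -> 'rV[R]_2 -> 'rV[R]_3) (B : 'I_n -> set RR) : R :=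
  psum B (fun i z => dens (x i) (plane z)).

Lemma decomp_plane n (U : 'I_n -> set 'rV[R]_2) (x : 'I_n -> 'rV[R]_2 -> 'rV[R]_3) B i z :
  decomposition M U x B -> B i z -> U i (plane z).
Proof. by move=> [_ mB _ _] Bz; apply: (mB i).2; exists z. Qed.

Lemma dens_integral_ge0 dens n (U : 'I_n -> set 'rV[R]_2) (x : 'I_n -> 'rV[R]_2 -> 'rV[R]_3) B i :
  density M dens -> decomposition M U x B ->
  (0 <= \int[l2]_(z in B i) (dens (x i) (plane z))%:E)%E.
Proof.
move=> [d0 _ _] D; have [cx mB _ _] := D.
by apply: integral_ge0 => z Bz; rewrite lee_fin; exact: d0 (cx i) (decomp_plane D Bz).
Qed.

Lemma dens_integral_fin dens n (U : 'I_n -> set 'rV[R]_2) (x : 'I_n -> 'rV[R]_2 -> 'rV[R]_3) B i :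
  density M dens -> decomposition M U x B ->
  (\int[l2]_(z in B i) (dens (x i) (plane z))%:E \is a fin_num)%E.
Proof.
move=> dd D; have := decomp_sum_fin sM cM dd D.
rewrite /decomp_sum sum_fin_num => /allP H; apply: H.
by apply/mapP; exists i => //; rewrite mem_filter mem_index_enum.
Qed.

Lemma dens_integrable dens n (U : 'I_n -> set 'rV[R]_2) (x : 'I_n -> 'rV[R]_2 -> 'rV[R]_3) B :
  density M dens -> decomposition M U x B ->
  pintegrable B (fun i z => dens (x i) (plane z)).
Proof.
move=> dd D i; have [cx mB _ _] := D; have [mBi Bi] := mB i; split => //.
have mf := density_measurable dd (cx i) mBi Bi.
apply/integrableP; split => //.
apply: (@le_lt_trans _ _ (\int[l2]_(z in B i) (dens (x i) (plane z))%:E)%E); last first.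
  by rewrite ltey_eq (dens_integral_fin _ dd D).
rewrite le_eqVlt; apply/orP; left; apply/eqP; apply: eq_integral => z; rewrite inE => Bz /=.
have [d0 _ _] := dd; congr (_%:E); apply: ger0_norm.
exact: d0 (cx i) (decomp_plane D Bz).
Qed.

Lemma dsumE dens n (U : 'I_n -> set 'rV[R]_2) (x : 'I_n -> 'rV[R]_2 -> 'rV[R]_3) B :
  density M dens -> decomposition M U x B -> (dsum dens x B)%:E = decomp_sum dens x B.
Proof.
move=> dd D; rewrite /dsum /psum /decomp_sum -sumEFin; apply: eq_bigr => i _.
by rewrite /Rintegral fineK// (dens_integral_fin _ dd D).
Qed.

Lemma dsum_indep dens n (U : 'I_n -> set 'rV[R]_2)
    (x : 'I_n -> 'rV[R]_2 -> 'rV[R]_3) B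
    m (V : 'I_m -> set 'rV[R]_2) (y : 'I_m -> 'rV[R]_2 -> 'rV[R]_3) C :
  density M dens -> decomposition M U x B -> decomposition M V y C ->
  dsum dens x B = dsum dens y C.
Proof.
by move=> dd D1 D2; apply: EFin_inj; rewrite (dsumE dd D1) (dsumE dd D2); exact: decomp_indep D1 D2.
Qed.

Lemma surface_integralE g f n (U : 'I_n -> set 'rV[R]_2)
    (x : 'I_n -> 'rV[R]_2 -> 'rV[R]_3) B :
  density M (fun x q => f (x q) * Num.sqrt (\det (g x q))) -> decomposition M U x B ->
  surface_integral M g f = dsum (fun x q => f (x q) * Num.sqrt (\det (g x q))) x B.
Proof.
move=> dd D; rewrite /surface_integral; set d := (fun x q => _).
have E : is_surface_integral M g f (dsum d x B).
  by have [? ? ? ?] := D; exists n, U, x, B; split.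
case: xgetP => [a _ [m [V [y [C [cy mC tC MC ->]]]]]|/(_ (dsum d x B))//].
by rewrite (dsum_indep dd D (And4 cy mC tC MC)).
Qed.

(** A decomposition that contains the whole domain of x0 reduces the claim
    to the integral over an open set of a continuous nonnegative function. *)
Lemma dens_zero dens U0 x0 q0 n (U : 'I_n -> set 'rV[R]_2)
    (x : 'I_n -> 'rV[R]_2 -> 'rV[R]_3) B : density M dens -> decomposition M U x B ->
  dsum dens x B = 0 -> chart M U0 x0 -> U0 q0 -> dens x0 q0 = 0.
Proof.
move=> dd D E c0 Uq0; have [d0 dc _] := dd.
apply/eqP; rewrite eq_le (d0 _ _ _ c0 Uq0) andbT leNgt; apply/negP => p0.
have [m [V [y [C [D' V0 y0 C0]]]]] := decomp_starting sM cM c0.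
rewrite (dsum_indep dd D D') in E.
have ge i : 0 <= Rintegral l2 (C i) (fun z => dens (y i) (plane z)).
  by rewrite /Rintegral fine_ge0// (dens_integral_ge0 _ dd D').
have E0 : (\int[l2]_(z in C ord0) (dens (y ord0) (plane z))%:E = 0)%E.
  rewrite -(fineK (dens_integral_fin ord0 dd D')); congr (_%:E).
  move/eqP: E; rewrite /dsum /psum psumr_eq0 => [/allP/(_ ord0 (mem_index_enum _))/=/eqP//|i _].
  exact: ge.
rewrite C0 y0 in E0.
have p2 : dens x0 q0 / 2 < dens x0 q0 by lra.
have : \forall q \near q0, U0 q /\ dens x0 q0 / 2 < dens x0 q.
  near=> q; split; near: q; first by apply: open_nbhs_nbhs; split => //; exact: chart_open c0.
  by apply: cvgr_gt p2; exact: dc c0 Uq0.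
move=> /nbhs_ballP[e /= e0 He].
pose Q := rect (q0 0 0 - e / 2) (q0 0 0 + e / 2) (q0 0 1 - e / 2) (q0 0 1 + e / 2).
have QU z : Q z -> U0 (plane z) /\ dens x0 q0 / 2 < dens x0 (plane z).
  rewrite /Q /rect /= !in_itv/= => -[/andP[z1 z2] /andP[z3 z4]].
  apply: He; rewrite -ball_normE /= -[q0]unplaneK; apply: (@le_lt_trans _ _ (e / 2)); last lra.
  by apply: plane_dist; rewrite ?ler_norml /=; try (apply/andP; split); lra.
have mQ : measurable Q by exact: measurable_rect.
have mU : measurable (@plane R @^-1` U0 : set RR) by apply: open_plane_measurable; exact: chart_open c0.
have mf : measurable_fun (@plane R @^-1` U0 : set RR) (fun z => (dens x0 (plane z))%:E).
  by apply: (density_measurable dd c0 mU) => _ [z Uz <-].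
have H1 : (\int[l2]_(z in Q) (dens x0 (plane z))%:E <= 0)%E.
  rewrite -E0; apply: ge0_subset_integral => //.
    by move=> z Uz; rewrite lee_fin; exact: d0 c0 Uz.
  by move=> z Qz; case: (QU z Qz).
have H2 : ((dens x0 q0 / 2)%:E * l2 Q <= \int[l2]_(z in Q) (dens x0 (plane z))%:E)%E.
  rewrite -integral_cst//; apply: ge0_le_integral => //.
  - by move=> z _; rewrite lee_fin; lra.
  - by apply: measurable_funS mf => // z Qz; case: (QU z Qz).
  - by move=> z Qz; rewrite lee_fin ltW//; case: (QU z Qz).
have := le_trans H2 H1; rewrite /Q l2_rect; [|lra|lra].
rewrite -EFinM lee_fin => H3.
have : 0 < dens x0 q0 / 2 * ((q0 0 0 + e / 2 - (q0 0 0 - e / 2)) * (q0 0 1 + e / 2 - (q0 0 1 - e / 2))).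
  by rewrite mulr_gt0 ?mulr_gt0//; lra.
by rewrite ltNge H3.
Unshelve. all: by end_near. Qed.

Lemma dens_sub d1 d2 : density M d1 -> density M d2 ->
  (forall U x q, chart M U x -> U q -> d1 x q <= d2 x q) -> density M (fun x q => d2 x q - d1 x q).
Proof.
move=> [a0 ac at_] [b0 bc bt] le; split=> [U x q cx Uq|U x q cx Uq|U x V y q r A cx cy Uq Vr xy JE uA].
- by rewrite subr_ge0 (le _ _ _ cx Uq).
- have h1 := ac _ _ _ cx Uq; have h2 := bc _ _ _ cx Uq.
  exact: (continuousB h2 h1).
- by rewrite (at_ _ _ _ _ _ _ _ cx cy Uq Vr xy JE uA) (bt _ _ _ _ _ _ _ cx cy Uq Vr xy JE uA) mulrBl.
Qed.

Lemma dens_le_eq d1 d2 n (U : 'I_n -> set 'rV[R]_2)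
    (x : 'I_n -> 'rV[R]_2 -> 'rV[R]_3) B : density M d1 -> density M d2 ->
  (forall U x q, chart M U x -> U q -> d1 x q <= d2 x q) -> decomposition M U x B ->
  dsum d2 x B <= dsum d1 x B -> forall U x q, chart M U x -> U q -> d1 x q = d2 x q.
Proof.
move=> dd1 dd2 le D E V y q cy Vq.
have i1 := dens_integrable dd1 D; have i2 := dens_integrable dd2 D.
have [cx _ _ _] := D.
have le' : dsum d1 x B <= dsum d2 x B.
  by apply: psum_le => // i z Bz; exact: le (cx i) (decomp_plane D Bz).
have Z : dsum (fun x q => d2 x q - d1 x q) x B = 0.
  have := psum_comb 1 (-1) i2 i1; rewrite mul1r mulN1r => /esym Z.
  transitivity (dsum d2 x B - dsum d1 x B); last by apply/eqP; rewrite subr_eq0 eq_le E le'.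
  by rewrite [RHS]Z; apply: psum_eq => i z _; rewrite mul1r mulN1r.
have := dens_zero (dens_sub dd1 dd2 le) D Z cy Vq.
by move/eqP; rewrite subr_eq0 => /eqP.
Qed.

Lemma dsum_gt0 dens n (U : 'I_n -> set 'rV[R]_2)
    (x : 'I_n -> 'rV[R]_2 -> 'rV[R]_3) B : density M dens -> decomposition M U x B ->
  (forall U x q, chart M U x -> U q -> 0 < dens x q) -> 0 < dsum dens x B.
Proof.
move=> dd D pos; rewrite lt_neqAle eq_sym; apply/andP; split; last first.
  by apply: sumr_ge0 => i _; rewrite /Rintegral fine_ge0// (dens_integral_ge0 _ dd D).
apply/negP => /eqP E; have [[p Mp] _ /(_ p Mp)[V [y [q [cy Vq _]]]]] := sM.
by have := pos _ _ _ cy Vq; rewrite (dens_zero dd D E cy Vq) ltxx.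
Qed.

End Total.

(** * The integrands H, sqrt K, K and H sqrt K *)

Local Opaque shape_mx first_form.

Section OvDens.
Variable R : realType.
Variable M : set 'rV[R]_3.
Hypothesis ov : ovaloid M.
Local Notation N := (inner_normal M).
Implicit Types (U V : set 'rV[R]_2) (x y : 'rV[R]_2 -> 'rV[R]_3).

Lemma near_eq_continuous (T : topologicalType) (f g : T -> R) q :
  (\forall r \near q, f r = g r) -> {for q, continuous f} -> {for q, continuous g}.
Proof.
move=> E cf; have E' := nbhs_singleton E.
have : g r @[r --> q] --> f q by apply: cvg_trans cf; exact: near_eq_cvg.
by rewrite E'.
Qed.

(** Expresses the trace of S by the entries of I and S I, which depend
    continuously on the point. *)
Lemma trace_forms (I S : 'M[R]_2) : I 0 1 = I 1 0 -> (S *m I) 0 1 = (S *m I) 1 0 ->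
  \tr S * \det I = (S *m I) 0 0 * I 1 1 - 2 * (S *m I) 0 1 * I 0 1 + (S *m I) 1 1 * I 0 0.
Proof.
move=> sI sS; have : (S *m I) 0 1 * I 0 1 = (S *m I) 1 0 * I 0 1 by rewrite sS.
by rewrite !mulmx2E trace2E det22 -sI; lra.
Qed.

Lemma first_form_diff U x q i j : chart M U x -> U q ->
  differentiable (fun r => first_form x r i j) q.
Proof.
move=> cx Uq; have oU := chart_open cx; have [_ H] := (Ck_smooth U x).1 (chart_smooth cx) 1%N.
have d k : differentiable (fun r => 'D_(delta_mx 0 k) x r) q by exact: (H _).1 q Uq.
refine (proj1 (near_eq_diff _ (differentiable_dot (d i) (d j)))).
have nU : \forall r \near q, U r by exact: open_nbhs_nbhs.
by apply: filterS nU => r Ur; exact: esym (ov_I_entry _ _ cx Ur).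
Qed.

Lemma second_form_diff U x q i j : chart M U x -> U q ->
  differentiable (fun r => second_form M x r i j) q.
Proof.
move=> cx Uq; have oU := chart_open cx; have [_ H] := (Ck_smooth U x).1 (chart_smooth cx) 1%N.
have [_ H'] := (Ck_smooth U (N \o x)).1 (ov_smoothN ov cx) 1%N.
have d k : differentiable (fun r => 'D_(delta_mx 0 k) x r) q by exact: (H _).1 q Uq.
have d' k : differentiable (fun r => 'D_(delta_mx 0 k) (N \o x) r) q by exact: (H' _).1 q Uq.
refine (proj1 (near_eq_diff _ (differentiableN (differentiable_dot (d' i) (d j))))).
have nU : \forall r \near q, U r by exact: open_nbhs_nbhs.
by apply: filterS nU => r Ur; exact: esym (ov_II_entry ov _ _ cx Ur).
Qed.

Lemma det_continuous (A : 'rV[R]_2 -> 'M[R]_2) q :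
  (forall i j, differentiable (fun r => A r i j) q) -> {for q, continuous (fun r => \det (A r))}.
Proof.
move=> dA; rewrite (_ : (fun r => _) = (fun r => A r 0 0 * A r 1 1 - A r 0 1 * A r 1 0)).
  have c i j := differentiable_continuous (dA i j).
  exact: (continuousB (continuousM (c 0 0) (c 1 1)) (continuousM (c 0 1) (c 1 0))).
by apply/funext => r; exact: det22.
Qed.

Lemma sqrt_det_continuous (A : 'rV[R]_2 -> 'M[R]_2) q :
  (forall i j, differentiable (fun r => A r i j) q) ->
  {for q, continuous (fun r => Num.sqrt (\det (A r)))}.
Proof.
move=> /det_continuous cA.
exact: (continuous_comp cA (@sqrt_continuous R _)).
Qed.

Lemma det_shape U x q : chart M U x -> U q ->
  \det (shape_mx M x q) = \det (second_form M x q) / \det (first_form x q).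
Proof.
move=> cx Uq; have [D0 _ _ _ _] := ov_forms ov cx Uq.
by rewrite /second_form det_mulmx mulfK// gt_eqF.
Qed.

Lemma trace_shape_continuous U x q : chart M U x -> U q ->
  {for q, continuous (fun r => \tr (shape_mx M x r))}.
Proof.
move=> cx Uq; have [D0 _ _ _ _] := ov_forms ov cx Uq.
pose g r := (second_form M x r 0 0 * first_form x r 1 1 - 2 * second_form M x r 0 1 * first_form x r 0 1 + second_form M x r 1 1 * first_form x r 0 0) / \det (first_form x r).
have nU : \forall r \near q, U r by apply: open_nbhs_nbhs; split => //; exact: chart_open cx.
have E : \forall r \near q, g r = \tr (shape_mx M x r).
  apply: filterS nU => r Ur; have [Dr _ _ _ _] := ov_forms ov cx Ur; rewrite /g -trace_forms.
  - by rewrite mulfK// gt_eqF.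
  - exact: ov_I_sym.
  - by have := ov_II_sym ov 0 1 cx Ur; exact.
have c1 i j := differentiable_continuous (first_form_diff i j cx Uq).
have c2 i j := differentiable_continuous (second_form_diff i j cx Uq).
have cd := det_continuous (fun i j => first_form_diff i j cx Uq).
have cg : {for q, continuous g}.
  apply: (continuousM _ (continuousV _ cd)); last by rewrite gt_eqF.
  apply: (continuousD _ (continuousM (c2 1 1) (c1 0 0))).
  apply: (continuousB (continuousM (c2 0 0) (c1 1 1))).
  apply: (continuousM _ (c1 0 1)); apply: (continuousM _ (c2 0 1)); exact: cst_continuous.
exact: near_eq_continuous E cg.
Qed.

Lemma det_shape_continuous U x q : chart M U x -> U q ->
  {for q, continuous (fun r => \det (shape_mx M x r))}.
Proof.
move=> cx Uq; have [D0 _ _ _ _] := ov_forms ov cx Uq.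
pose g r := \det (second_form M x r) / \det (first_form x r).
have nU : \forall r \near q, U r by apply: open_nbhs_nbhs; split => //; exact: chart_open cx.
have E : \forall r \near q, g r = \det (shape_mx M x r).
  by apply: filterS nU => r Ur; exact: esym (det_shape cx Ur).
have cd := det_continuous (fun i j => first_form_diff i j cx Uq).
have cd' := det_continuous (fun i j => second_form_diff i j cx Uq).
have cg : {for q, continuous g}.
  by apply: (continuousM cd' (continuousV _ cd)); rewrite gt_eqF.
exact: near_eq_continuous E cg.
Qed.

Lemma det_conj (A X : 'M[R]_2) : \det (A *m X *m A^T) = \det A ^+ 2 * \det X.
Proof. by rewrite !det_mulmx det_tr; ring. Qed.

Lemma sqrt_det_conj (A X : 'M[R]_2) : Num.sqrt (\det (A *m X *m A^T)) = Num.sqrt (\det X) * `|\det A|.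
Proof. by rewrite det_conj sqrtrM ?sqr_ge0// sqrtr_sqr mulrC. Qed.

Lemma mean_curvatureE U x q : chart M U x -> U q ->
  mean_curvature M (x q) = \tr (shape_mx M x q) / 2.
Proof.
move=> cx Uq; rewrite /mean_curvature; set S := [set h | _].
have Sq : S (\tr (shape_mx M x q) / 2) by exists U, x, q; split.
case: xgetP => [h _ [V [y [r [cy Vr yx ->]]]]|/(_ _ Sq)//].
have [_ JE uJ _] := transition cy cx Vr Uq yx.
have [_ -> _] := ov_change ov cy cx Vr Uq yx JE uJ.
by rewrite mxtrace_mulC mulmxA mulVmx// mul1mx.
Qed.

Lemma mean_curvature_continuous U x q : chart M U x -> U q ->
  {for q, continuous (fun r => mean_curvature M (x r))}.
Proof.
move=> cx Uq.
have nU : \forall r \near q, U r by apply: open_nbhs_nbhs; split => //; exact: chart_open cx.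
have E : \forall r \near q, \tr (shape_mx M x r) / 2 = mean_curvature M (x r).
  by apply: filterS nU => r Ur; exact: esym (mean_curvatureE cx Ur).
have cg : {for q, continuous (fun r => \tr (shape_mx M x r) / 2)}.
  by apply: (continuousM (trace_shape_continuous cx Uq)); exact: cst_continuous.
exact: near_eq_continuous E cg.
Qed.

Lemma mean_curvature_gt0 p : M p -> 0 < mean_curvature M p.
Proof.
move=> Mp; have [_ _ /(_ p Mp)[U [x [q [cx Uq <-]]]]] := ov_surface ov.
by rewrite (mean_curvatureE cx Uq) divr_gt0//; have [_ _] := ov_forms ov cx Uq.
Qed.

Lemma mean_curvature_bounded : exists C, forall p, M p -> mean_curvature M p <= C.
Proof.
apply: (compact_locbound (ov_compact ov)) => p Mp.
have [_ _ /(_ p Mp)[U [x [q [cx Uq xq]]]]] := ov_surface ov.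
exists (mean_curvature M p + 1).
have cH := mean_curvature_continuous cx Uq.
have : \forall r \near q, U r /\ mean_curvature M (x r) < mean_curvature M p + 1.
  near=> r; split; near: r; first by apply: open_nbhs_nbhs; split => //; exact: chart_open cx.
  by apply: (cvgr_lt _ cH); rewrite xq ltrDl.
move=> /nbhs_interior; rewrite /= => H.
pose V := interior [set r | U r /\ mean_curvature M (x r) < mean_curvature M p + 1].
have oV : open V by exact: open_interior.
have VU : V `<=` U by move=> r /interior_subset[].
have [W oW VW] := chart_image cx oV VU.
have pW : W p.
  have : (x @` V) p by exists q => //; exact: nbhs_singleton H.
  by rewrite VW => -[].
have nW : nbhs p W by exact: open_nbhs_nbhs.
apply: filterS nW => p' Wp' Mp'.
have : (x @` V) p' by rewrite VW.
by move=> [r /interior_subset[_ Hr] <-]; exact: ltW.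
Unshelve. all: by end_near. Qed.

Definition dens_H x q := mean_curvature M (x q) * Num.sqrt (\det (first_form x q)).
(** The factor 1 is the integrand of [area_II]. *)
Definition dens_II x q := 1 * Num.sqrt (\det (second_form M x q)).
Definition dens_K x q := \det (shape_mx M x q) * Num.sqrt (\det (first_form x q)).
Definition dens_HK x q := mean_curvature M (x q) * Num.sqrt (\det (second_form M x q)).

Lemma density_H : density M dens_H.
Proof.
split=> [U x q cx Uq|U x q cx Uq|U x V y q r A cx cy Uq Vr xy JE uA].
- by rewrite mulr_ge0// ltW// mean_curvature_gt0//; exact: chart_in cx Uq.
- apply: (continuousM (mean_curvature_continuous cx Uq)).
  by apply: sqrt_det_continuous => i j; exact: first_form_diff cx Uq.
- have [E _ _] := ov_change ov cx cy Uq Vr xy JE uA.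
  by rewrite /dens_H xy E sqrt_det_conj mulrA.
Qed.

Lemma density_II : density M dens_II.
Proof.
split=> [U x q cx Uq|U x q cx Uq|U x V y q r A cx cy Uq Vr xy JE uA].
- by rewrite mulr_ge0.
- apply: continuousM; first exact: cst_continuous.
  by apply: sqrt_det_continuous => i j; exact: second_form_diff cx Uq.
- have [_ _ E] := ov_change ov cx cy Uq Vr xy JE uA.
  by rewrite /dens_II E sqrt_det_conj mulrA.
Qed.

Lemma density_HK : density M dens_HK.
Proof.
split=> [U x q cx Uq|U x q cx Uq|U x V y q r A cx cy Uq Vr xy JE uA].
- by rewrite mulr_ge0// ltW// mean_curvature_gt0//; exact: chart_in cx Uq.
- apply: (continuousM (mean_curvature_continuous cx Uq)).
  by apply: sqrt_det_continuous => i j; exact: second_form_diff cx Uq.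
- have [_ _ E] := ov_change ov cx cy Uq Vr xy JE uA.
  by rewrite /dens_HK xy E sqrt_det_conj mulrA.
Qed.

Lemma density_K : density M dens_K.
Proof.
split=> [U x q cx Uq|U x q cx Uq|U x V y q r A cx cy Uq Vr xy JE uA].
- by rewrite mulr_ge0// ltW//; have [_] := ov_forms ov cx Uq.
- apply: (continuousM (det_shape_continuous cx Uq)).
  by apply: sqrt_det_continuous => i j; exact: first_form_diff cx Uq.
- have [E S _] := ov_change ov cx cy Uq Vr xy JE uA.
  rewrite /dens_K E S sqrt_det_conj mulrA; congr (_ * _ * _).
  by rewrite !det_mulmx det_inv mulrAC mulfV ?mul1r// -unitfE -unitmxE.
Qed.

Lemma dens_HE U x q : chart M U x -> U q ->
  dens_H x q = \tr (shape_mx M x q) / 2 * Num.sqrt (\det (first_form x q)).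
Proof. by move=> cx Uq; rewrite /dens_H (mean_curvatureE cx Uq). Qed.

Lemma sqrt_det_II U x q : chart M U x -> U q ->
  Num.sqrt (\det (second_form M x q)) = Num.sqrt (\det (shape_mx M x q)) * Num.sqrt (\det (first_form x q)).
Proof.
by move=> cx Uq; have [_ K0 _ _ _] := ov_forms ov cx Uq; rewrite /second_form det_mulmx sqrtrM// ltW.
Qed.

Lemma sqrtK_le_H U x q : chart M U x -> U q ->
  Num.sqrt (\det (shape_mx M x q)) <= mean_curvature M (x q).
Proof.
move=> cx Uq; rewrite (mean_curvatureE cx Uq); have [_ K0 T0 le _] := ov_forms ov cx Uq.
rewrite -(ler_pXn2r (ltn0Sn 1)) ?nnegrE ?sqrtr_ge0 ?divr_ge0 ?(ltW T0)//.
by rewrite sqr_sqrtr ?(ltW K0)// expr_div_n; lra.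
Qed.

Lemma dens_II_le_H U x q : chart M U x -> U q -> dens_II x q <= dens_H x q.
Proof.
move=> cx Uq; rewrite /dens_II mul1r (sqrt_det_II cx Uq) ler_wpM2r//.
exact: sqrtK_le_H cx Uq.
Qed.

Lemma dens_K_le_HK U x q : chart M U x -> U q -> dens_K x q <= dens_HK x q.
Proof.
move=> cx Uq; have [_ K0 _ _ _] := ov_forms ov cx Uq.
rewrite /dens_K /dens_HK (sqrt_det_II cx Uq) mulrA ler_wpM2r//.
rewrite -[in leLHS](sqr_sqrtr (ltW K0)) expr2 ler_wpM2r//.
exact: sqrtK_le_H cx Uq.
Qed.

Lemma dens_K_eq_HK U x q : chart M U x -> U q -> dens_K x q = dens_HK x q ->
  shape_mx M x q = (\tr (shape_mx M x q) / 2)%:M.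
Proof.
move=> cx Uq; have [I0 K0 T0 _ H] := ov_forms ov cx Uq.
rewrite /dens_K /dens_HK (sqrt_det_II cx Uq) (mean_curvatureE cx Uq) mulrA.
have sI : Num.sqrt (\det (first_form x q)) != 0 by rewrite sqrtr_eq0 -ltNge.
move/(mulIf sI) => E; apply: H.
have sK : Num.sqrt (\det (shape_mx M x q)) != 0 by rewrite sqrtr_eq0 -ltNge.
have E1 : Num.sqrt (\det (shape_mx M x q)) = \tr (shape_mx M x q) / 2.
  by apply: (mulIf sK); rewrite -E -expr2 sqr_sqrtr// ltW.
have := sqr_sqrtr (ltW K0); rewrite E1 expr_div_n => <-; by field.
Qed.

Lemma total_mean_curvatureE n (U : 'I_n -> set 'rV[R]_2) (x : 'I_n -> 'rV[R]_2 -> 'rV[R]_3) B :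
  decomposition M U x B -> total_mean_curvature M = dsum dens_H x B.
Proof.
move=> D; apply: (surface_integralE (ov_surface ov) (ov_compact ov) _ D).
exact: density_H.
Qed.

Lemma area_IIE n (U : 'I_n -> set 'rV[R]_2) (x : 'I_n -> 'rV[R]_2 -> 'rV[R]_3) B :
  decomposition M U x B -> area_II M = dsum dens_II x B.
Proof.
move=> D; apply: (surface_integralE (ov_surface ov) (ov_compact ov) _ D).
exact: density_II.
Qed.

End OvDens.

(** * Connectedness and the inside of a surface *)

Section Inside.
Variable R : realType.
Implicit Types (M A : set 'rV[R]_3) (u v p : 'rV[R]_3).

Lemma path_connected_image (T : topologicalType) (f : R -> T) :
  (forall s, 0 <= s <= 1 -> {for s, continuous f}) -> connected (f @` `[0, 1]%classic).
Proof.
move=> cf; apply: connected_continuous_connected; first exact: segment_connected.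
by apply: continuous_in_subspaceT => s; rewrite inE /= in_itv /=; exact: cf.
Qed.

Lemma inside_connected M A u v : connected A -> A `<=` ~` M -> A u -> A v ->
  inside M u -> inside M v.
Proof.
move=> cA AM Au Av [Mu bu]; split; first exact: AM.
suff -> : connected_component (~` M) v = connected_component (~` M) u by [].
by apply: same_connected_component; exists A.
Qed.

Lemma inside_path M (f : R -> 'rV[R]_3) : (forall s, 0 <= s <= 1 -> {for s, continuous f}) ->
  (forall s, 0 <= s <= 1 -> ~ M (f s)) -> inside M (f 0) <-> inside M (f 1).
Proof.
move=> cf H; have cA := path_connected_image cf.
have AM : f @` `[0, 1]%classic `<=` ~` M.
  by move=> _ [s s01 <-]; apply: H; move: s01; rewrite /= in_itv.
have A0 : (f @` `[0, 1]%classic) (f 0) by exists 0 => //; rewrite /= in_itv /= lexx ler01.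
have A1 : (f @` `[0, 1]%classic) (f 1) by exists 1 => //; rewrite /= in_itv /= lexx ler01.
by split; [exact: inside_connected cA AM A0 A1|exact: inside_connected cA AM A1 A0].
Qed.

(** The half-line is a connected unbounded subset of the complement. *)
Lemma ray_not_inside M c v : v != 0 -> (forall s, 0 <= s -> ~ M (c + s *: v)) -> ~ inside M c.
Proof.
move=> v0 H [_ [K [Kr HK]]].
have v1 : 0 < `|v| by rewrite normr_gt0.
pose L := `|K| + 1.
have L0 : 0 <= L by rewrite addr_ge0.
have LK : K < L by rewrite (le_lt_trans (ler_norm _))// ltrDl.
pose s := (L + `|c| + 1) / `|v|.
have s0 : 0 <= s by rewrite divr_ge0// ?addr_ge0// ltW.
pose f (t : R) := c + (t * s) *: v.
have cf : continuous f.
  move=> t; apply: cvgD; first exact: cvg_cst.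
  by apply: cvgZr_tmp; apply: cvgMr_tmp; exact: cvg_id.
have cA := path_connected_image (fun s _ => cf s).
have : connected_component (~` M) c (c + s *: v).
  exists (f @` `[0, 1]%classic); last first.
    by exists 1; rewrite /= ?in_itv /= ?lexx ?ler01// /f mul1r.
  split=> //.
    by exists 0; rewrite /= ?in_itv /= ?lexx ?ler01// /f mul0r scale0r addr0.
  move=> _ [t + <-]; rewrite /= in_itv /= => /andP[t0 _]; apply: H; exact: mulr_ge0.
move/(HK L LK); rewrite /= => Hs.
have : `|s *: v| <= `|c + s *: v| + `|c|.
  by rewrite -{1}[s *: v](addKr c) addrC -[X in _ <= _ + X]normrN (le_trans (ler_normD _ _))// addrC.
rewrite normrZ ger0_norm// /s divfK ?gt_eqF// => Hs'.
by have := le_trans Hs' (lerD Hs (lexx _)); rewrite -subr_ge0; lra.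
Qed.

Lemma outside_ball M c r z : (forall p, M p -> dot (p - c) (p - c) <= r) ->
  r < dot (z - c) (z - c) -> ~ inside M z.
Proof.
move=> Mr zr; have [E|z0] := eqVneq (z - c) 0.
  move: zr; rewrite E dot0l => r0 [_].
  have M0 : M = set0.
    by apply/seteqP; split => // p /Mr; rewrite leNgt (lt_le_trans r0 (dot_ge0 _)).
  suff : ~ inside M z.
    by move=> h b; apply: h; split => //; rewrite M0.
  apply: (@ray_not_inside _ _ (delta_mx 0 0)) => [|s _]; last by rewrite M0.
  by apply/eqP => /matrixP/(_ 0 0); rewrite !mxE eqxx => /eqP; rewrite oner_eq0.
apply: (@ray_not_inside _ _ (z - c)) => // s s0 /Mr; rewrite leNgt => /negP; apply.
have -> : z + s *: (z - c) - c = (1 + s) *: (z - c) by rewrite scalerDl scale1r addrAC.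
rewrite dotZl dotZr mulrA; apply: (lt_le_trans zr).
rewrite -[leLHS]mul1r ler_wpM2r ?dot_ge0//.
by rewrite (le_trans _ (ler_peMl _ _))// ?lerDl// addr_ge0.
Qed.

Section Homeo.
Variables (f g : 'rV[R]_3 -> 'rV[R]_3).
Hypotheses (cf : continuous f) (cg : continuous g) (fK : cancel f g) (gK : cancel g f).
Hypotheses (bf : forall A, bounded_set A -> bounded_set (f @` A)).

(** The image by f of a connected set that avoids g @` M avoids M. *)
Lemma component_homeo M u : connected_component (~` (g @` M)) (g u) `<=` g @` connected_component (~` M) u.
Proof.
move=> z [A [Au AM cA] Az]; exists (f z); last exact: fK.
exists (f @` A); last by exists z.
split; first by exists (g u).
  move=> _ [a Aa <-] Mfa; apply: (AM a Aa); exists (f a) => //.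
by apply: connected_continuous_connected cA _; exact: continuous_subspaceT.
Qed.
End Homeo.

Lemma bounded_subset (A B : set 'rV[R]_3) : A `<=` B -> bounded_set B -> bounded_set A.
Proof.
by move=> AB [K [Kr H]]; exists K; split=> // L /H HL z /AB /HL.
Qed.

Lemma inside_homeo_half (f g : 'rV[R]_3 -> 'rV[R]_3) M u : continuous f ->
  cancel f g -> cancel g f -> (forall A, bounded_set A -> bounded_set (g @` A)) ->
  inside M u -> inside (g @` M) (g u).
Proof.
move=> cf fK gK bg [Mu bu]; split.
  by move=> [a Ma /(can_inj gK) E]; apply: Mu; rewrite -E.
by apply: bounded_subset (bg _ bu); exact: component_homeo.
Qed.

Lemma inside_homeo (f g : 'rV[R]_3 -> 'rV[R]_3) M u : continuous f -> continuous g ->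
  cancel f g -> cancel g f -> (forall A, bounded_set A -> bounded_set (f @` A)) ->
  (forall A, bounded_set A -> bounded_set (g @` A)) ->
  inside (g @` M) (g u) <-> inside M u.
Proof.
move=> cf cg fK gK bf bg; split; last exact: inside_homeo_half cf fK gK bg.
move=> /(inside_homeo_half cg gK fK bf); rewrite gK.
suff -> : f @` (g @` M) = M by [].
apply/seteqP; split=> [_ [_ [a Ma <-] <-]|a Ma]; first by rewrite gK.
by exists (g a); [exists a|rewrite gK].
Qed.

(** The part of M where P holds and the part where it fails are both open
    in M. *)
Lemma connected_locally_const M (P : 'rV[R]_3 -> Prop) : connected M ->
  (forall p, M p -> \forall a \near p, M a -> (P a <-> P p)) ->
  forall p a, M p -> M a -> P p -> P a.
Proof.
move=> cM loc p a Mp Ma Pp.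
have op (Q : 'rV[R]_3 -> Prop) : (forall p, M p -> \forall a \near p, M a -> (Q a <-> Q p)) ->
    exists2 C : set 'rV[R]_3, open C & M `&` [set b | Q b] = M `&` C.
  move=> lQ; exists (interior [set b | M b -> Q b]); first exact: open_interior.
  apply/seteqP; split=> [b [Mb Qb]|b [Mb /interior_subset Hb]]; split => //; last exact: Hb.
  rewrite /interior /=; have := lQ b Mb; apply: filterS => b' h Mb'; exact/(h Mb').
suff E : M `&` [set b | P b] = M by move: Ma; rewrite -{1}E => -[].
apply: cM; first by exists p.
  exact: op.
have [|C oC E] := op (fun b => ~ P b).
  move=> b Mb; have := loc b Mb; apply: filterS => b' h Mb'; have {}h := h Mb'.
  by split=> n h'; apply: n; apply/h.
exists (~` C); first exact: open_closedC.
apply/seteqP; split=> b [Mb h]; split => //.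
  by move=> Cb; have : (M `&` C) b by []; rewrite -E => -[].
apply: contrapT => nP; apply: h.
have : (M `&` [set b | ~ P b]) b by [].
by rewrite E => -[].
Qed.

Lemma connected_locally_eq (T : Type) M (f : 'rV[R]_3 -> T) : connected M ->
  (forall p, M p -> \forall a \near p, M a -> f a = f p) ->
  forall p a, M p -> M a -> f a = f p.
Proof.
move=> cM loc p a Mp Ma; apply: (connected_locally_const (P := fun b => f b = f p) cM _ Mp Ma erefl).
by move=> b /loc; apply: filterS => b' h /h ->.
Qed.

End Inside.

(** * Lipschitz homeomorphisms and tangent cones *)

Section Lip.
Variable R : realType.
Implicit Types (M A : set 'rV[R]_3) (u v p : 'rV[R]_3).

Definition lip (L : R) (f : 'rV[R]_3 -> 'rV[R]_3) := forall a b, `|f a - f b| <= L * `|a - b|.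

Lemma lip_continuous L f : lip L f -> continuous f.
Proof.
move=> lf a; have F : Filter (nbhs a) by exact: nbhs_filter.
apply/(cvgrPdist_le (F := nbhs a)) => e e0; near=> b.
apply: (le_trans (lf a b)); apply: (@le_trans _ _ ((`|L| + 1) * `|a - b|)).
  by rewrite ler_wpM2r// (le_trans (ler_norm _))// lerDl.
have L0 : 0 < `|L| + 1 by rewrite ltr_wpDl.
rewrite mulrC -ler_pdivlMr//.
by near: b; apply: cvgr_dist_le => //; rewrite divr_gt0.
Unshelve. all: by end_near. Qed.

Lemma lip_bounded L f A : lip L f -> bounded_set A -> bounded_set (f @` A).
Proof.
move=> lf [K [Kr HK]]; exists (`|f 0| + `|L| * (`|K| + 1)); split; first exact: num_real.
move=> C HC _ [a Aa <-]; apply/ltW/(le_lt_trans _ HC).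
have Ka : `|a| <= `|K| + 1.
  by apply: (HK (`|K| + 1)) Aa; rewrite (le_lt_trans (ler_norm _))// ltrDl.
rewrite -[f a](subrK (f 0)) addrC (le_trans (ler_normD _ _))// lerD2l.
rewrite (le_trans (lf _ _))// subr0 (le_trans (ler_wpM2r _ (ler_norm L)))//.
by rewrite ler_wpM2l.
Qed.

(** The infimum of the cones z |-> f p + L |z - p| with apex over M. *)
Lemma mcshane (M : set 'rV[R]_3) (L : R) (f : 'rV[R]_3 -> R) : 0 <= L -> M !=set0 ->
  (forall a b, M a -> M b -> `|f a - f b| <= L * `|a - b|) ->
  exists g : 'rV[R]_3 -> R, (forall a, M a -> g a = f a) /\
    forall a b, `|g a - g b| <= L * `|a - b|.
Proof.
move=> L0 [p0 Mp0] lf.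
pose S (z : 'rV[R]_3) := [set f p + L * `|z - p| | p in M].
have tri (a b c : 'rV[R]_3) : L * `|a - c| <= L * `|a - b| + L * `|b - c|.
  by rewrite -mulrDr ler_wpM2l// -[a - c](subrKA b) ler_normD.
have low z p : M p -> f p0 - L * `|z - p0| <= f p + L * `|z - p|.
  move=> Mp; have := lf p0 p Mp0 Mp; rewrite ler_norml => /andP[_ h].
  by have := tri p0 z p; rewrite (distrC p0 z); lra.
have hS z : has_inf (S z).
  split; first by exists (f p0 + L * `|z - p0|); exists p0.
  by exists (f p0 - L * `|z - p0|) => _ [p Mp <-]; exact: low.
have half a b : inf (S a) <= inf (S b) + L * `|a - b|.
  rewrite -lerBlDr; apply: lb_le_inf; first by case: (hS b).
  move=> _ [p Mp <-]; rewrite lerBlDr; apply: (@le_trans _ _ (f p + L * `|a - p|)).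
    by apply: ge_inf; [case: (hS a)|exists p].
  by have := tri a b p; lra.
exists (fun z => inf (S z)); split=> [a Ma|a b].
  apply/eqP; rewrite eq_le; apply/andP; split.
    apply: (@le_trans _ _ (f a + L * `|a - a|)); last by rewrite subrr normr0 mulr0 addr0.
    by apply: ge_inf; [case: (hS a)|exists a].
  apply: lb_le_inf; first by case: (hS a).
  move=> _ [p Mp <-]; have := lf a p Ma Mp; rewrite ler_norml => /andP[_]; lra.
rewrite ler_norml; apply/andP; split.
  by have := half b a; rewrite (distrC b a); lra.
by have := half a b; lra.
Qed.

Lemma mcshane_row (M : set 'rV[R]_3) (L : R) (f : 'rV[R]_3 -> 'rV[R]_3) : 0 <= L -> M !=set0 ->
  (forall a b, M a -> M b -> `|f a - f b| <= L * `|a - b|) ->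
  exists g : 'rV[R]_3 -> 'rV[R]_3, (forall a, M a -> g a = f a) /\ lip L g.
Proof.
move=> L0 M0 lf.
have H (j : 'I_3) : exists g : 'rV[R]_3 -> R, (forall a, M a -> g a = f a 0 j) /\
    forall a b, `|g a - g b| <= L * `|a - b|.
  apply: (mcshane L0 M0) => a b Ma Mb; apply: le_trans (lf a b Ma Mb).
  by have := rV_coord_le (f a - f b) j; rewrite !mxE.
have [G HG] := choice H; exists (fun z => \row_j G j z); split=> [a Ma|a b].
  by apply/rowP => j; rewrite mxE (HG j).1.
by apply: rV_norm_le => [|j]; rewrite ?mulr_ge0// !mxE (HG j).2.
Qed.

(** Solving l z + F z = y amounts to finding a fixed point of
    z |-> (y - F z) / l, a contraction of ratio 1/2. *)
Lemma lip_perturb (l : R) (F : 'rV[R]_3 -> 'rV[R]_3) : 0 < l -> lip (l / 2) F ->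
  exists g, [/\ cancel (fun z => l *: z + F z) g, cancel g (fun z => l *: z + F z) & lip (2 / l) g].
Proof.
move=> l0 lF; pose Phi (z : 'rV[R]_3) := l *: z + F z.
have exp (a b : 'rV[R]_3) : `|a - b| <= 2 / l * `|Phi a - Phi b|.
  have : l * `|a - b| <= `|Phi a - Phi b| + `|F a - F b|.
    rewrite -{1}(gtr0_norm l0) -normrZ.
    have -> : l *: (a - b) = (Phi a - Phi b) - (F a - F b).
      by rewrite /Phi opprD addrACA addrK scalerBr.
    exact: ler_normB.
  move=> h; have h2 := lF a b; rewrite mulrAC ler_pdivlMr// mulrC.
  by move: h h2; clear; lra.
have surj (y : 'rV[R]_3) : exists z, Phi z = y.
  pose T (z : 'rV[R]_3) : 'rV[R]_3 := l^-1 *: (y - F z).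
  have lT (a b : 'rV[R]_3) : `|T a - T b| <= 2^-1 * `|a - b|.
    rewrite /T -scalerBr opprB addrC addrA subrK normrZ gtr0_norm ?invr_gt0//.
    rewrite -(ler_pM2l l0) mulVKf ?gt_eqF// distrC (le_trans (lF _ _))//.
    by rewrite mulrA.
  have mT : set_fun setT setT T by [].
  pose TF : {fun [set: 'rV[R]_3] >-> [set: 'rV[R]_3]} := HB.pack T (isFun.Build _ _ setT setT T mT).
  have cT : is_contraction TF.
    have h0 : 0 <= 2^-1 :> R by [].
    exists (NngNum h0); split; first by rewrite /= invf_lt1// ltr1n.
    by move=> [a b] _ /=; exact: lT.
  pose X : completeNormedModType R :=
    HB.pack ('rV[R]_3) (Complete.on 'rV[R]_3) (NormedModule.on 'rV[R]_3).
  have [z _ zT] : exists2 z, [set: 'rV[R]_3] z & z = TF z.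
    by apply: (@banach_fixed_point R X setT TF cT); [exact: closedT|exists 0].
  exists z; rewrite /Phi {1}zT /TF /= /T scalerA mulfV ?gt_eqF// scale1r subrK//.
have [g Hg] := choice surj.
exists g; split.
- by move=> z; apply/eqP; rewrite -subr_eq0 -normr_le0 (le_trans (exp _ _))// Hg subrr normr0 mulr0.
- exact: Hg.
- by move=> a b; rewrite (le_trans (exp _ _))// !Hg.
Qed.

End Lip.

Section Cone.
Variable R : realType.
Implicit Types (M : set 'rV[R]_3) (a n w : 'rV[R]_3).

(** To first order at a, M lies in the plane through a orthogonal to n. *)
Definition tangential M a n := forall e, 0 < e -> \forall b \near a, M b -> `|dot (b - a) n| <= e * `|b - a|.

Lemma dot_unit_norm n : dot n n = 1 -> `|n| <= 1.
Proof. by move=> n1; apply: norm_le_dot => //; rewrite n1 expr1n. Qed.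

Lemma tangential_opp M a n : tangential M a n -> tangential M a (- n).
Proof. by move=> t e e0; have := t e e0; apply: filterS => b h /h; rewrite dotNr normrN. Qed.

(** In a narrow cone around n the component along n dominates, contrary
    to tangency. *)
Lemma cone_free M a n : dot n n = 1 -> tangential M a n -> exists2 s1, 0 < s1 &
  forall s w, 0 < s < s1 -> `|w - n| <= 6^-1 -> ~ M (a + s *: w).
Proof.
move=> n1 tg; have e0 : 0 < 4^-1 :> R by rewrite invr_gt0.
have /nbhs_ballP[d /= d0 Hd] := tg _ e0.
exists (d / 2); first by rewrite divr_gt0.
move=> s w /andP[s0 s1] wn.
have nn := dot_unit_norm n1.
(* |w| <= 7/6 and <w, n> >= 1/2, so tangency with ratio 1/4 is violated *)
have w76 : `|w| <= 7 / 6.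
  have : `|w| <= `|w - n| + `|n| by rewrite -{1}[w](subrK n) ler_normD.
  by move: wn nn; clear; move: `|w| `|w - n| `|n| => x y z; lra.
have wd : 2^-1 <= dot w n.
  have : dot w n = 1 + dot (w - n) n by rewrite dotBl n1 addrC subrK.
  have := dot_unit_le (w - n) n1; rewrite ler_norml => /andP[h _] E.
  by move: h wn; rewrite E; clear; move: (dot (w - n) n) `|w - n| => x y; lra.
have sw : `|a + s *: w - a| = s * `|w| by rewrite addrC addKr normrZ gtr0_norm.
have := Hd (a + s *: w); rewrite -ball_normE /= distrC sw.
have sd : s * `|w| < d.
  have : s * `|w| <= s * (7 / 6) by rewrite ler_pM2l.
  by move: s0 s1 d0; clear; move: (s * `|w|) => x; lra.
move=> /(_ sd) H /H; rewrite addrC addKr dotZl normrM gtr0_norm//.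
rewrite [leRHS]mulrCA ler_pM2l// => h.
have := ler_norm (dot w n); move: h wd w76; clear; move: `|w| `|dot w n| (dot w n) => x y z; lra.
Qed.

(** The truncated cone is convex and avoids M, so it lies in one component
    of the complement. *)
Lemma cone_inside M a n : dot n n = 1 -> tangential M a n -> exists2 s1, 0 < s1 &
  forall s w s' w', 0 < s < s1 -> `|w - n| <= 6^-1 -> 0 < s' < s1 -> `|w' - n| <= 6^-1 ->
    inside M (a + s *: w) <-> inside M (a + s' *: w').
Proof.
move=> n1 tg; have [s1 s10 H] := cone_free n1 tg; exists s1 => // s w s' w' hs hw hs' hw'.
pose f (t : R) : 'rV[R]_3 := a + (s + t * (s' - s)) *: (w + t *: (w' - w)).
have f0 : f 0 = a + s *: w by rewrite /f mul0r addr0 scale0r addr0.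
have f1 : f 1 = a + s' *: w' by rewrite /f mul1r scale1r [s + _]addrC subrK [w + _]addrC subrK.
rewrite -f0 -f1; apply: inside_path.
  move=> t _; apply: cvgD; first exact: cvg_cst.
  apply: cvgZ.
    by apply: cvgD; [exact: cvg_cst|apply: cvgMr_tmp; exact: cvg_id].
  by apply: cvgD; [exact: cvg_cst|apply: cvgZr_tmp; exact: cvg_id].
move=> t /andP[t0 t1]; apply: H.
  move: hs hs' => /andP[? ?] /andP[? ?].
  have -> : s + t * (s' - s) = (1 - t) * s + t * s' by ring.
  have [->|tn] := eqVneq t 0; first by rewrite subr0 mul1r mul0r addr0; apply/andP.
  have tp : 0 < t by rewrite lt_neqAle eq_sym tn.
  have p1 : 0 < t * s' by rewrite mulr_gt0.
  have p2 : 0 <= (1 - t) * s by rewrite mulr_ge0// ?subr_ge0// ltW.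
  have p3 : t * s' < t * s1 by rewrite ltr_pM2l.
  have p4 : (1 - t) * s <= (1 - t) * s1 by rewrite ler_wpM2l ?subr_ge0// ltW.
  by apply/andP; split; lra.
have -> : w + t *: (w' - w) - n = (1 - t) *: (w - n) + t *: (w' - n).
  by rewrite scalerBl scale1r !scalerBr; apply/rowP => j; rewrite !mxE; ring.
rewrite (le_trans (ler_normD _ _))// !normrZ (ger0_norm t0) ger0_norm ?subr_ge0//.
have h1 : (1 - t) * `|w - n| <= (1 - t) * 6^-1 by rewrite ler_wpM2l ?subr_ge0.
have h2 : t * `|w' - n| <= t * 6^-1 by rewrite ler_wpM2l.
by rewrite (le_trans (lerD h1 h2))//; lra.
Qed.

End Cone.

(** * The interior normal of an ovaloid *)

Section Normal.
Variable R : realType.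
Variable M : set 'rV[R]_3.
Hypothesis ov : ovaloid M.
Local Notation N := (inner_normal M).
Implicit Types (U V : set 'rV[R]_2) (x y : 'rV[R]_2 -> 'rV[R]_3) (a b p : 'rV[R]_3).

(** Coordinates are Lipschitz, with a constant valid for all pairs of points
    near x q, by strict differentiability of x. *)
Lemma chart_coords U x q : chart M U x -> U q -> exists2 C, 0 < C &
  forall e, 0 < e -> exists2 rho, 0 < rho &
   forall a b, M a -> M b -> `|a - x q| < rho -> `|b - x q| < rho ->
    exists r s, [/\ U r /\ U s, x r = a, x s = b, `|s - r| <= C * `|b - a| & `|r - q| < e /\ `|s - q| < e].
Proof.
move=> cx Uq; have fJ := chart_free cx Uq.
have [k k0 Hk] := mulmx_norm_le (pinvmx ('J x q)).
have e0 : 0 < (2 * k)^-1 by rewrite invr_gt0 mulr_gt0.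
exists (2 * k); first exact: mulr_gt0.
have C1 := (Ck_smooth U x).1 (chart_smooth cx) 1%N.
have [r0 r00 Hr] := strict_diff (chart_open cx) Uq C1 e0.
move=> e e1; have m0 : 0 < Num.min e r0 by rewrite lt_min e1.
have oB : open (ball q (Num.min e r0)) by exact: ball_open.
have := cinv_near cx Uq oB (ballxx q m0).
move=> /nbhs_ballP[d /= d0 Hd]; exists d => // a b Ma Mb ad bd.
have := Hd a; rewrite -ball_normE /= distrC => /(_ ad Ma)[[Ur]]; rewrite -ball_normE /= distrC lt_min => /andP[re rr0] xr _.
have := Hd b; rewrite -ball_normE /= distrC => /(_ bd Mb)[[Us]]; rewrite -ball_normE /= distrC lt_min => /andP[se sr0] xs _.
exists (cinv U x a), (cinv U x b); split=> //.
move: (cinv U x a) (cinv U x b) Ur Us re rr0 se sr0 xr xs => r s Ur Us re rr0 se sr0 xr xs.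
have h := Hr r s rr0 sr0; rewrite xr xs in h.
have E : s - r = (b - a) *m pinvmx ('J x q) - (b - a - (s - r) *m 'J x q) *m pinvmx ('J x q).
  move: ('J x q) fJ => J fJ.
  by rewrite [(b - a - _) *m _]mulmxBl opprB addrCA subrr addr0 -mulmxA mulmxVp// mulmx1.
have h1 := Hk (b - a); have h2 := Hk (b - a - (s - r) *m 'J x q).
have : `|s - r| <= k * `|b - a| + k * ((2 * k)^-1 * `|s - r|).
  by rewrite {1}E (le_trans (ler_normB _ _))// lerD// (le_trans h2)// ler_pM2l.
have -> : k * ((2 * k)^-1 * `|s - r|) = `|s - r| / 2 by field; rewrite gt_eqF.
by move=> H'; rewrite -mulrA; move: H'; clear; lra.
Qed.

Lemma N_le1 p : M p -> `|N p| <= 1.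
Proof. by move=> /(ov_unit ov)/dot_unit_norm. Qed.

(** The vector b - a is almost tangent to M at p, and N a is close to N p. *)
Lemma tangential_unif p e : M p -> 0 < e -> exists2 rho, 0 < rho &
  forall a b, M a -> M b -> `|a - p| < rho -> `|b - p| < rho -> `|dot (b - a) (N a)| <= e * `|b - a|.
Proof.
move=> Mp e0; have [_ _ /(_ p Mp)[U [x [q [cx Uq <-]]]]] := ov_surface ov.
have [C C0 HC] := chart_coords cx Uq.
have [K K0 HK] := mulmx_norm_le ('J x q).
have e1 : 0 < e / (6 * C) by rewrite divr_gt0// mulr_gt0.
have e2 : 0 < e / (6 * K * C) by rewrite divr_gt0// !mulr_gt0.
have C1 := (Ck_smooth U x).1 (chart_smooth cx) 1%N.
have [r0 r00 Hr] := strict_diff (chart_open cx) Uq C1 e1.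
have : \forall r \near q, `|N (x q) - N (x r)| <= e / (6 * K * C).
  have /cvgrPdist_le := differentiable_continuous (ov_diffN ov cx Uq); exact.
move=> /nbhs_ballP[d /= d0 Hd].
have m0 : 0 < Num.min d r0 by rewrite lt_min d0.
have [rho rho0 Hrho] := HC _ m0; exists rho => // a b Ma Mb ap bp.
have [r [s [[Ur Us] xr xs sr []]]] := Hrho a b Ma Mb ap bp.
rewrite !lt_min => /andP[rd rr0] /andP[sd sr0].
have h := Hr r s rr0 sr0; rewrite xr xs in h.
have hN : `|N (x q) - N a| <= e / (6 * K * C).
  by rewrite -xr; apply: (Hd r); rewrite -ball_normE /= distrC.
have p0 : dot ((s - r) *m 'J x q) (N (x q)) = 0 by rewrite dot_mulmx (ov_perp ov cx Uq) mulmx0 mxE.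
have -> : dot (b - a) (N a) = dot (b - a - (s - r) *m 'J x q) (N a) - dot ((s - r) *m 'J x q) (N (x q) - N a).
  by move: ((s - r) *m _) p0 (b - a) => w p0 u; rewrite dotBl dotBr p0 sub0r opprK subrK.
have h1 := dot_unit_le (b - a - (s - r) *m 'J x q) (ov_unit ov Ma).
have h2 := dot_le ((s - r) *m 'J x q) (N (x q) - N a).
have h3 := HK (s - r).
apply: (le_trans (ler_normB _ _)).
have -> : e * `|b - a| = 3 * (e / (6 * C) * (C * `|b - a|)) + 3 * (K * (C * `|b - a|) * (e / (6 * K * C))).
  by field; rewrite !gt_eqF.
apply: lerD.
  by apply: (le_trans h1); rewrite ler_pM2l//; apply: (le_trans h); rewrite ler_pM2l.
apply: (le_trans h2); rewrite ler_pM2l//; apply: ler_pM => //.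
by apply: (le_trans h3); rewrite ler_pM2l.
Qed.

Lemma tangentialN p : M p -> tangential M p (N p).
Proof.
move=> Mp e e0; have [rho rho0 H] := tangential_unif Mp e0.
apply/nbhs_ballP; exists rho => // b; rewrite -ball_normE /= distrC => bp Mb.
by apply: H => //; rewrite subrr normr0.
Qed.

Lemma lip_loc p : M p -> exists2 L, 0 < L & exists2 rho, 0 < rho &
  forall a b, M a -> M b -> `|a - p| < rho -> `|b - p| < rho -> `|N b - N a| <= L * `|b - a|.
Proof.
move=> Mp; have [_ _ /(_ p Mp)[U [x [q [cx Uq <-]]]]] := ov_surface ov.
have [C C0 HC] := chart_coords cx Uq.
have [K K0 HK] := mulmx_norm_le ('J (N \o x) q).
have C1 := (Ck_smooth U (N \o x)).1 (ov_smoothN ov cx) 1%N.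
have [r0 r00 Hr] := strict_diff (chart_open cx) Uq C1 ltr01.
exists ((1 + K) * C); first by rewrite mulr_gt0// addr_gt0.
have [rho rho0 Hrho] := HC _ r00; exists rho => // a b Ma Mb ap bp.
have [r [s [[Ur Us] xr xs sr [rr0 sr0]]]] := Hrho a b Ma Mb ap bp.
have h := Hr r s rr0 sr0; rewrite /= xr xs mul1r in h.
have h3 := HK (s - r).
have : `|N b - N a| <= `|N b - N a - (s - r) *m 'J (N \o x) q| + `|(s - r) *m 'J (N \o x) q|.
  by rewrite -{1}[N b - N a](subrK ((s - r) *m 'J (N \o x) q)) ler_normD.
move=> h4; apply: (le_trans h4); apply: (le_trans (lerD h h3)).
by rewrite -mulrA -[X in X + _]mul1r -mulrDl ler_pM2l// addr_gt0.
Qed.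

(** Near the diagonal of M x M this is [lip_loc]; away from it, |a - b| is
    bounded below. *)
Lemma normal_lipschitz : exists2 L, 0 < L &
  forall a b, M a -> M b -> `|N a - N b| <= L * `|a - b|.
Proof.
pose f (ab : 'rV[R]_3 * 'rV[R]_3) := `|N ab.1 - N ab.2| / `|ab.1 - ab.2|.
have cMM := compact_setX (ov_compact ov) (ov_compact ov).
have [|L HL] := compact_locbound (f := f) cMM.
  move=> [p p'] [/= Mp Mp'].
  have key C rho : 0 < rho -> 0 <= C -> (forall a b, M a -> M b -> `|a - p| < rho -> `|b - p'| < rho ->
      `|N a - N b| <= C * `|a - b|) ->
      exists C0, \forall ab \near (p, p'), (M `*` M) ab -> f ab <= C0.
    move=> rho0 C0 H; exists C.
    apply/nbhs_ballP; exists rho => // -[a b] [/=]; rewrite -!ball_normE /= => ha hb [/= Ma Mb].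
    rewrite distrC in ha; rewrite distrC in hb.
    rewrite /f /=; have [->|ab] := eqVneq a b; first by rewrite !subrr normr0 mul0r.
    by rewrite ler_pdivrMr ?normr_gt0 ?subr_eq0//; exact: H.
  case: (eqVneq p p') key => [<-|pp'] key.
    have [L L0 [rho rho0 H]] := lip_loc Mp; apply: (key L rho rho0 (ltW L0)) => a b Ma Mb ap bp.
    exact: H.
  have d0 : 0 < `|p - p'| by rewrite normr_gt0 subr_eq0.
  apply: (key (4 / `|p - p'|) (`|p - p'| / 4)); [by rewrite divr_gt0|by rewrite divr_ge0|].
  move=> a b Ma Mb ap bp.
  have h1 : `|N a - N b| <= 2.
    by rewrite (le_trans (ler_normB _ _))// (le_trans (lerD (N_le1 Ma) (N_le1 Mb)))//; lra.
  have h2 : `|p - p'| <= `|a - p| + `|a - b| + `|b - p'|.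
    have -> : p - p' = (a - b) - (a - p) + (b - p').
      by rewrite opprB addrCA [a - b]addrC; apply/rowP => j; rewrite !mxE; ring.
    rewrite (le_trans (ler_normD _ _))// lerD2r (le_trans (ler_normB _ _))// addrC//.
  rewrite (le_trans h1)// mulrAC ler_pdivlMr//.
  by move: ap bp h2; clear; lra.
exists (`|L| + 1); first by rewrite ltr_wpDl.
move=> a b Ma Mb; have [->|ab] := eqVneq a b; first by rewrite !subrr !normr0 mulr0.
rewrite -ler_pdivrMr ?normr_gt0 ?subr_eq0//.
apply: (le_trans (HL (a, b) (conj Ma Mb))); rewrite (le_trans (ler_norm _))// lerDl//.
Qed.

(** A segment along the normal leaves M transversally, uniformly near p. *)
Lemma side_loc p : M p -> exists2 rho, 0 < rho & forall a s, M a -> `|a - p| < rho -> 0 < s < rho ->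
  ~ M (a - s *: N a).
Proof.
move=> Mp; have e0 : 0 < 2^-1 :> R by rewrite invr_gt0.
have [rho rho0 H] := tangential_unif Mp e0.
exists (rho / 2); first by rewrite divr_gt0.
move=> a s Ma ap /andP[s0 s1] Mb.
have N1 := N_le1 Ma.
have nb : `|a - s *: N a - p| < rho.
  rewrite addrAC (le_lt_trans (ler_normB _ _))// normrZ gtr0_norm//.
  have : s * `|N a| <= s by rewrite ler_piMr// ltW.
  by move: ap s1; clear; lra.
have na : `|a - p| < rho by move: ap rho0; clear; lra.
have := H a _ Ma Mb na nb.
have -> : a - s *: N a - a = - (s *: N a) by rewrite addrAC subrr sub0r.
rewrite dotNl dotZl (ov_unit ov Ma) mulr1 !normrN normrZ gtr0_norm// => h.
have : s * `|N a| <= s by rewrite ler_piMr// ltW.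
by move: h s0; clear; lra.
Qed.

(** Both sides of M at p could a priori belong to its inside, and the
    interior normal would be ambiguous. Whether this happens is locally
    constant along M. It does not at a point of M farthest from the origin,
    where one of the two sides lies outside of a ball that contains M. *)
Lemma outer_not_inside p : M p -> ~ (\forall s \near (0 : R)^'+, inside M (p - s *: N p)).
Proof.
move=> Mp Hp; pose P a := \forall s \near (0 : R)^'+, inside M (a - s *: N a).
have cM : connected M by have [_ ? _] := ov_surface ov.
(* whether the outer side is inside is locally constant *)
have loc b : M b -> \forall a \near b, M a -> (P a <-> P b).
  move=> Mb; have [rho rho0 H] := side_loc Mb.
  have at_s a : M a -> `|a - b| < rho -> P a <-> inside M (a - (rho / 2) *: N a).
    move=> Ma ab.
    have same s : 0 < s < rho -> inside M (a - s *: N a) <-> inside M (a - (rho / 2) *: N a).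
      move=> /andP[s0 s1]; pose f (t : R) := a - (s + t * (rho / 2 - s)) *: N a.
      have -> : a - s *: N a = f 0 by rewrite /f mul0r addr0.
      have -> : a - (rho / 2) *: N a = f 1 by rewrite /f mul1r [s + _]addrC subrK.
      apply: inside_path => t.
        move=> _; apply: cvgB; first exact: cvg_cst.
        by apply: cvgZr_tmp; apply: cvgD; [exact: cvg_cst|apply: cvgMr_tmp; exact: cvg_id].
      move=> /andP[t0 t1]; apply: H => //.
      have -> : s + t * (rho / 2 - s) = (1 - t) * s + t * (rho / 2) by ring.
      have [->|tn] := eqVneq t 0; first by rewrite subr0 mul1r mul0r addr0 s0.
      have tp : 0 < t by rewrite lt_neqAle eq_sym tn.
      have p1 : 0 < t * rho by rewrite mulr_gt0.
      have p2 : 0 <= (1 - t) * s by rewrite mulr_ge0// ?subr_ge0// ltW.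
      have p3 : (1 - t) * s <= (1 - t) * rho by rewrite ler_wpM2l ?subr_ge0// ltW.
      by apply/andP; split; lra.
    split=> [Pa|Ia].
      have : \forall s \near (0 : R)^'+, inside M (a - s *: N a) /\ 0 < s < rho.
        near=> s; split; near: s; first exact: Pa.
        by near=> s; apply/andP; split; near: s; [exact: nbhs_right_gt|exact: nbhs_right_lt].
      by move=> /filter_ex[s [Is hs]]; exact/(same s hs).
    rewrite /P; near=> s; apply/(same s) => //.
    by apply/andP; split; near: s; [exact: nbhs_right_gt|exact: nbhs_right_lt].
  have [_ _ /(_ b Mb)[U [x [q [cx Uq xq]]]]] := ov_surface ov.
  have nq : \forall r \near q, U r /\ `|x r - b| < rho.
    near=> r; split; near: r; first by apply: open_nbhs_nbhs; split => //; exact: chart_open cx.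
    have cq := differentiable_continuous (chart_diff cx Uq).
    by rewrite -xq; near=> r; rewrite distrC; near: r; apply: cvgr_dist_lt.
  move: nq => /nbhs_ballP[d /= d0 Hd].
  have oB : open (ball q d) by exact: ball_open.
  have := cinv_near cx Uq oB (ballxx q d0); rewrite xq; apply: filterS => a h Ma.
  have [[Ur Br] xr _] := h Ma; move: (cinv U x a) Ur Br xr => r Ur Br xr.
  have seg t : 0 <= t <= 1 -> U (q + t *: (r - q)) /\ `|x (q + t *: (r - q)) - b| < rho.
    move=> t01; apply: Hd; rewrite -ball_normE /= distrC; apply: seg_ball => //.
      by rewrite subrr normr0.
    by move: Br; rewrite -ball_normE /= distrC.
  have ab : `|a - b| < rho by have := seg 1; rewrite ler01 lexx scale1r addrC subrK xr => /(_ isT)[].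
  have bb : `|b - b| < rho by rewrite subrr normr0.
  apply: (iff_trans (at_s a Ma ab)); apply: (iff_trans _ (iff_sym (at_s b Mb bb))).
  pose f (t : R) := x (q + t *: (r - q)) - (rho / 2) *: N (x (q + t *: (r - q))).
  have -> : b - (rho / 2) *: N b = f 0 by rewrite /f scale0r addr0 xq.
  have -> : a - (rho / 2) *: N a = f 1 by rewrite /f scale1r addrC [q + _]addrC subrK xr addrC.
  apply: iff_sym; apply: inside_path => t t01; have [Ut bt] := seg t t01; last first.
    by apply: H => //; [exact: chart_in cx Ut|rewrite divr_gt0//= ltr_pdivrMr// ltr_pMr// ltr1n].
  have cl : {for t, continuous (fun t : R => q + t *: (r - q))}.
    by apply: cvgD; [exact: cvg_cst|apply: cvgZr_tmp; exact: cvg_id].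
  have c1 := continuous_comp cl (differentiable_continuous (chart_diff cx Ut)).
  have c2 := continuous_comp cl (differentiable_continuous (ov_diffN ov cx Ut)).
  by apply: cvgB; [exact: c1|apply: cvgZl_tmp; exact: c2].
(* but it fails at a point of M farthest from the origin *)
have [m Mm maxm] : exists2 m, M m & forall a, M a -> dot a a <= dot m m.
  have M0 : M !=set0 by exists p.
  have cd : {within M, continuous (fun a : 'rV[R]_3 => dot a a)}.
    by apply: continuous_subspaceT => a; apply: dot_continuous; exact: cvg_id.
  have [c cM' Hc] := compact_EVT_max M0 (ov_compact ov) cd; exists c; first by rewrite inE in cM'.
  by move=> a Ma; apply: Hc; rewrite inE.
have Pm : P m := connected_locally_const cM loc Mp Mm Hp.
have [_ _ In] := ov_normal ov Mm.
have out z : dot m m < dot z z -> ~ inside M z.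
  move=> h; apply: (@outside_ball _ M 0 (dot m m)); last by rewrite subr0.
  by move=> a Ma; rewrite subr0; exact: maxm.
have : \forall s \near (0 : R)^'+, [/\ inside M (m + s *: N m), inside M (m - s *: N m) & 0 < s].
  near=> s; split; near: s; [exact: In|exact: Pm|exact: nbhs_right_gt].
move=> /filter_ex[s [I1 I2 s0]].
have ss : 0 < s * s by rewrite mulr_gt0.
have [le0|ge0] := leP (dot m (N m)) 0.
  apply: (out _ _ I2); rewrite dotBl !dotBr !dotZl !dotZr (ov_unit ov Mm) (dotC (N m) m) mulr1.
  have : s * dot m (N m) <= 0 by rewrite pmulr_rle0.
  by move: ss; clear; move: (s * dot m (N m)) (s * s) => A B; lra.
apply: (out _ _ I1); rewrite dotDl !dotDr !dotZl !dotZr (ov_unit ov Mm) (dotC (N m) m) mulr1.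
have : 0 < s * dot m (N m) by rewrite mulr_gt0.
by move: ss; clear; move: (s * dot m (N m)) (s * s) => A B; lra.
Unshelve. all: by end_near. Qed.

End Normal.

(** * Algebra of parallel surfaces *)

Section Algebra2.
Variable R : realType.

Lemma det_par (S : 'M[R]_2) l t : \det (l%:M - t *: S) = l ^+ 2 - l * t * \tr S + t ^+ 2 * \det S.
Proof. by rewrite !det22 trace2E !mxE /= ?mulr1n ?mulr0n; ring. Qed.

(** By Cayley-Hamilton C = tr B - B is the adjugate of B, and
    det B X = X B C = S C. *)
Lemma trace_par (S X : 'M[R]_2) l t : X *m (l%:M - t *: S) = S ->
  \tr X * \det (l%:M - t *: S) = l * \tr S - 2 * t * \det S.
Proof.
set B := _ - _ => XB; pose C := (\tr B)%:M - B.
have BC : B *m C = (\det B)%:M.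
  by apply: matrix2P; rewrite mulmx2E det22 /C trace2E !mxE /= ?mulr1n ?mulr0n; ring.
have E : \det B *: X = S *m C by rewrite -XB -mulmxA BC mul_mx_scalar.
rewrite mulrC -mxtraceZ E /C /B !trace2E !mulmx2E det22 !mxE /= ?mulr1n ?mulr0n; ring.
Qed.

(** Cayley-Hamilton for S, which is self-adjoint for I. *)
Lemma shape_square (I S : 'M[R]_2) : I^T = I -> (S *m I)^T = S *m I ->
  S *m I *m S^T = \tr S *: (S *m I) - \det S *: I.
Proof.
move=> sI sP; rewrite -mulmxA -{1}sI -trmx_mul sP mulmxA.
have -> : S *m S = \tr S *: S - (\det S)%:M.
  by apply: matrix2P; rewrite mulmx2E det22 trace2E !mxE /= ?mulr1n ?mulr0n; ring.
by rewrite mulmxBl -scalemxAl mul_scalar_mx.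
Qed.

Lemma quadD (A B : 'M[R]_2) (w : 'rV[R]_2) :
  (w *m (A + B) *m w^T) 0 0 = (w *m A *m w^T) 0 0 + (w *m B *m w^T) 0 0.
Proof. by rewrite mulmxDr mulmxDl mxE. Qed.

Lemma quadZ (A : 'M[R]_2) (w : 'rV[R]_2) a :
  (w *m (a *: A) *m w^T) 0 0 = a * (w *m A *m w^T) 0 0.
Proof. by rewrite -scalemxAr -scalemxAl mxE. Qed.

Lemma posdef_ge0 (A : 'M[R]_2) (w : 'rV[R]_2) : posdef A -> 0 <= (w *m A *m w^T) 0 0.
Proof.
move=> pA; have [->|w0] := eqVneq w 0; first by rewrite !mul0mx mxE.
exact/ltW/pA.
Qed.

(** The form is l S I - t S I S^T. For t <= 0 both terms are nonnegative;
    for t > 0 it equals (l - t tr S) S I + t det S I by [shape_square]. *)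
Lemma posdef_par (I S : 'M[R]_2) l t : posdef I -> I^T = I -> posdef (S *m I) ->
  (S *m I)^T = S *m I -> 0 < \det S -> 0 < l -> 0 < l - t * \tr S ->
  posdef (S *m I *m (l%:M - t *: S)^T).
Proof.
move=> pI sI pP sP d0 l0 lt0 w w0.
have E : S *m I *m (l%:M - t *: S)^T = l *: (S *m I) + (- t) *: (S *m I *m S^T).
  by rewrite linearB /= linearZ /= tr_scalar_mx mulmxBr -scalemxAr mul_mx_scalar scaleNr.
have P0 := pP w w0; have I0 := posdef_ge0 w pI.
have [t0|t0] := leP t 0.
  rewrite E quadD !quadZ.
  have -> : w *m (S *m I *m S^T) *m w^T = (w *m S) *m I *m (w *m S)^T by rewrite trmx_mul !mulmxA.
  have := posdef_ge0 (w *m S) pI; move: (((w *m S) *m I *m _) 0 0) => Q Q0.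
  by apply: ltr_pwDl; [rewrite mulr_gt0|rewrite mulr_ge0// oppr_ge0].
rewrite E (shape_square sI sP) scalerBr scalerA addrA -scalerDl -[- (- t *: _)]scaleNr opprK scalerA.
rewrite quadD !quadZ mulNr; apply: ltr_pwDl; first by rewrite mulr_gt0.
by rewrite !mulr_ge0// ltW.
Qed.

Lemma posdef_conj (A X : 'M[R]_2) : A \in unitmx -> posdef X -> posdef (A *m X *m A^T).
Proof.
move=> uA pX w w0.
have -> : w *m (A *m X *m A^T) *m w^T = (w *m A) *m X *m (w *m A)^T by rewrite trmx_mul !mulmxA.
apply: pX; apply: contra w0 => /eqP E.
by rewrite -[w](mulmxK uA) E mul0mx.
Qed.

(** With H = tr S / 2 and K = det S, the difference
    (l - t H)^2 - det (l - t S) is t^2 (H^2 - K). *)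
Lemma sqrt_det_par (S : 'M[R]_2) l t : 0 < \det S -> 4 * \det S <= \tr S ^+ 2 -> 0 < l ->
  0 < l - t * \tr S ->
  0 < \det (l%:M - t *: S) /\ Num.sqrt (\det (l%:M - t *: S)) <= l - t * (\tr S / 2).
Proof.
move=> K0 KH l0 lt0; rewrite det_par.
have t2 : 0 <= t ^+ 2 * \det S by rewrite mulr_ge0 ?sqr_ge0// ltW.
have l2 : 0 < l * (l - t * \tr S) by rewrite mulr_gt0.
have B0 : 0 < l ^+ 2 - l * t * \tr S + t ^+ 2 * \det S.
  have -> : l ^+ 2 - l * t * \tr S = l * (l - t * \tr S) by ring.
  by rewrite ltr_pwDl.
split=> //.
have h0 : 0 <= l - t * (\tr S / 2) by move: l0 lt0; rewrite mulrA; clear; move: (t * \tr S) => u; lra.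
rewrite -(ger0_norm h0) -sqrtr_sqr ler_sqrt ?sqr_ge0//.
have : t ^+ 2 * (4 * \det S) <= t ^+ 2 * \tr S ^+ 2 by rewrite ler_wpM2l ?sqr_ge0.
have -> : (l - t * (\tr S / 2)) ^+ 2 = l ^+ 2 - l * t * \tr S + t ^+ 2 * \tr S ^+ 2 / 4 by field.
by rewrite mulrCA; clear; lra.
Qed.

Lemma jacobian_comb n m (f g : 'rV[R]_n -> 'rV[R]_m) q l t : differentiable f q -> differentiable g q ->
  differentiable (fun r => l *: f r + t *: g r) q /\
  'J (fun r => l *: f r + t *: g r) q = l *: 'J f q + t *: 'J g q.
Proof.
move=> df dg; apply: diffJ_crit => e e0.
have L0 : 0 < `|l| + `|t| + 1 by rewrite ltr_wpDl ?addr_ge0.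
have e1 : 0 < e / (`|l| + `|t| + 1) by rewrite divr_gt0.
have := diffJ_bound df e1; have := diffJ_bound dg e1; apply: filterS2 => b.
move: ('J f q) ('J g q) => A B hg hf.
have -> : l *: f b + t *: g b - (l *: f q + t *: g q) - (b - q) *m (l *: A + t *: B) =
   l *: (f b - f q - (b - q) *m A) + t *: (g b - g q - (b - q) *m B).
  rewrite mulmxDr -!scalemxAr !scalerBr; apply/matrixP => i j; rewrite !mxE; ring.
rewrite (le_trans (ler_normD _ _))// !normrZ.
have hf' : `|l| * `|f b - f q - (b - q) *m A| <= `|l| * (e / (`|l| + `|t| + 1) * `|b - q|).
  by rewrite ler_wpM2l.
have hg' : `|t| * `|g b - g q - (b - q) *m B| <= `|t| * (e / (`|l| + `|t| + 1) * `|b - q|).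
  by rewrite ler_wpM2l.
rewrite (le_trans (lerD hf' hg'))// -mulrDl mulrA ler_wpM2r// mulrCA ler_piMr ?(ltW e0)//.
by rewrite ler_pdivrMr// mul1r lerDl.
Qed.

End Algebra2.

(** * Parallel surfaces of an ovaloid *)

Lemma par_shape_alg (R : realType) (S C : 'M[R]_2) (J : 'M[R]_(2, 3)) : C \in unitmx ->
  - S *m J = - (S *m invmx C *m (C *m J)).
Proof. by move=> uC; rewrite mulmxA mulmxKV// mulNmx. Qed.

Lemma par_second_alg (R : realType) (S C I : 'M[R]_2) : C \in unitmx ->
  S *m invmx C *m (C *m I *m C^T) = S *m I *m C^T.
Proof. by move=> uC; rewrite !mulmxA mulmxKV. Qed.

Lemma transition_shape_alg (R : realType) (A S C : 'M[R]_2) (J : 'M[R]_(2, 3)) :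
  A \in unitmx -> C \in unitmx ->
  A *m (- S *m J) = - (A *m S *m invmx C *m invmx A *m (A *m (C *m J))).
Proof. by move=> uA uC; rewrite !mulmxA (mulmxKV uA) (mulmxKV uC) mulmxN mulNmx. Qed.

Lemma transition_second_alg (R : realType) (A S I : 'M[R]_2) : A \in unitmx ->
  A *m S *m invmx A *m (A *m I *m A^T) = A *m (S *m I) *m A^T.
Proof. by move=> uA; rewrite !mulmxA mulmxKV. Qed.

Section Parallel.
Variable R : realType.
Variable M : set 'rV[R]_3.
Hypothesis ov : ovaloid M.
Local Notation N := (inner_normal M).
Variables (L l t : R).
Hypotheses (L0 : 0 < L) (LN : forall a b, M a -> M b -> `|N a - N b| <= L * `|a - b|).
Hypotheses (l0 : 0 < l) (tL : `|t| * L <= l / 6).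
Hypothesis (tH : forall p, M p -> 0 < l - 2 * t * mean_curvature M p).
Implicit Types (U V : set 'rV[R]_2) (x y : 'rV[R]_2 -> 'rV[R]_3) (a b p : 'rV[R]_3).

(** The image by the homothety of ratio l of the parallel surface of M at
    signed distance t / l. *)
Definition par p := l *: p + t *: N p.
Local Notation M' := (par @` M).

(** Once N is extended to a Lipschitz map of the space, par becomes the
    restriction of a Lipschitz perturbation of a homothety. The last
    estimate controls the images of normal segments. *)
Lemma par_homeo : exists F G : 'rV[R]_3 -> 'rV[R]_3,
  [/\ (forall p, M p -> F p = par p), cancel F G, cancel G F, (exists C, lip C F) /\ (exists C, lip C G) &
   forall p v, `|F (p + v) - F p - l *: v| <= l / 6 * `|v|].
Proof.
have M0 : M !=set0 by have [] := ov_surface ov.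
have [Nt [NtN lNt]] := mcshane_row (ltW L0) M0 LN.
pose T z := t *: Nt z.
have lT6 : lip (l / 6) T.
  move=> a b; rewrite /T -scalerBr normrZ; have := lNt a b => h.
  apply: (@le_trans _ _ (`|t| * (L * `|a - b|))); first by rewrite ler_wpM2l.
  by rewrite mulrA ler_wpM2r.
have lT : lip (l / 2) T.
  by move=> a b; rewrite (le_trans (lT6 a b))// ler_wpM2r// ler_pM2l// lef_pV2 ?posrE// ler_nat.
have [G [FG GF lG]] := lip_perturb l0 lT.
exists (fun z => l *: z + T z), G; split=> //.
- by move=> p Mp; rewrite /T /par NtN.
- split; last by exists (2 / l).
  exists (l + l / 6) => a b; rewrite opprD addrACA -scalerBr (le_trans (ler_normD _ _))//.
  by rewrite normrZ gtr0_norm// mulrDl lerD2l.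
- move=> p v; have -> : l *: (p + v) + T (p + v) - (l *: p + T p) - l *: v = T (p + v) - T p.
    by rewrite scalerDr; apply/rowP => j; rewrite !mxE; ring.
  by rewrite (le_trans (lT6 _ _))// addrC addKr.
Qed.

Lemma par_inj a b : M a -> M b -> par a = par b -> a = b.
Proof.
have [F [G [FE FG _ _ _]]] := par_homeo => Ma Mb; rewrite -!FE// => E.
by rewrite -(FG a) E FG.
Qed.

(** The contribution of N is of second order, as
    <N b - N p, N p> = - |N b - N p|^2 / 2 for unit vectors. *)
Lemma par_tangential p : M p -> tangential M' (par p) (N p).
Proof.
move=> Mp e e0; have [F [G [FE FG GF [_ [C lG]] _]]] := par_homeo.
have C1 : 0 < `|C| + 1 by rewrite ltr_wpDl.
have lG' a b : `|G a - G b| <= (`|C| + 1) * `|a - b|.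
  by rewrite (le_trans (lG _ _))// ler_wpM2r// (le_trans (ler_norm _))// lerDl.
have e1 : 0 < e / (2 * (`|C| + 1) * l) by rewrite divr_gt0// !mulr_gt0.
pose D := (3 / 2 * L ^+ 2 * (`|t| + 1)).
have D0 : 0 < D by rewrite /D !mulr_gt0// ltr_wpDl.
have e2 : 0 < e / (2 * (`|C| + 1) * D) by rewrite divr_gt0// !mulr_gt0.
have cG : {for par p, continuous G} by exact: (lip_continuous lG).
have Gp : G (par p) = p by rewrite -FE// FG.
have near1 : \forall b \near G (par p), (M b -> `|dot (b - p) (N p)| <= e / (2 * (`|C| + 1) * l) * `|b - p|) /\
    `|b - p| <= e / (2 * (`|C| + 1) * D).
  rewrite Gp; near=> b; split; near: b; first exact: (tangentialN ov Mp e1).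
  by near=> b; rewrite distrC; near: b; apply: cvgr_dist_le.
have := near_continuous cG near1; apply: filterS => u h [b Mb E]; subst u.
have Gb : G (par b) = b by rewrite -FE// FG.
rewrite Gb in h; have [/(_ Mb) h1 h2] := h.
have bC : `|b - p| <= (`|C| + 1) * `|par b - par p| by rewrite -{1}Gb -{1}Gp.
have [w wE] : exists w, w = par b - par p by exists (par b - par p).
rewrite -wE in bC *.
have {}wE : w = l *: (b - p) + t *: (N b - N p) by rewrite wE /par opprD addrACA -!scalerBr.
have wd : dot w (N p) = l * dot (b - p) (N p) - t * (dot (N b - N p) (N b - N p) / 2).
  rewrite wE [dot (_ *: _ + _) _]dotDl !dotZl; congr (_ + _); rewrite -mulrN; congr (_ * _).
  rewrite !dotBl !dotBr (ov_unit ov Mb) (ov_unit ov Mp) (dotC (N p) (N b)); lra.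
have h3 : dot (N b - N p) (N b - N p) <= 3 * (L * `|b - p| * (L * `|b - p|)).
  rewrite (le_trans (ler_norm _))// (le_trans (dot_le _ _))// ler_pM2l//.
  by apply: ler_pM => //; exact: LN.
have h0 := dot_ge0 (N b - N p).
rewrite wd; apply: (le_trans (ler_normB _ _)).
have -> : `|l * dot (b - p) (N p)| = l * `|dot (b - p) (N p)| by rewrite normrM gtr0_norm.
have -> : `|t * (dot (N b - N p) (N b - N p) / 2)| = `|t| * (dot (N b - N p) (N b - N p) / 2).
  by rewrite normrM [X in _ * X]ger0_norm// divr_ge0.
have a1 : l * `|dot (b - p) (N p)| <= e / (2 * (`|C| + 1)) * `|b - p|.
  have -> : e / (2 * (`|C| + 1)) * `|b - p| = l * (e / (2 * (`|C| + 1) * l) * `|b - p|).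
    by field; rewrite !gt_eqF.
  by rewrite ler_pM2l.
have a2 : `|t| * (dot (N b - N p) (N b - N p) / 2) <= D * `|b - p| * `|b - p|.
  apply: (@le_trans _ _ ((`|t| + 1) * (3 * (L * `|b - p| * (L * `|b - p|)) / 2))).
    apply: ler_pM => //; first by rewrite divr_ge0.
      by rewrite lerDl.
    by rewrite ler_pM2r// invr_gt0.
  by rewrite le_eqVlt; apply/orP; left; apply/eqP; rewrite /D; field.
have a3 : D * `|b - p| * `|b - p| <= e / (2 * (`|C| + 1)) * `|b - p|.
  rewrite ler_wpM2r//; apply: (@le_trans _ _ (D * (e / (2 * (`|C| + 1) * D)))); first by rewrite ler_pM2l.
  by rewrite le_eqVlt; apply/orP; left; apply/eqP; field; rewrite !gt_eqF.
have -> : e * `|w| = e / (2 * (`|C| + 1)) * ((`|C| + 1) * `|w|) + e / (2 * (`|C| + 1)) * ((`|C| + 1) * `|w|).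
  by field; rewrite gt_eqF.
have e3 : 0 < e / (2 * (`|C| + 1)) by rewrite divr_gt0// mulr_gt0.
apply: lerD; first by rewrite (le_trans a1)// ler_pM2l.
by rewrite (le_trans a2)// (le_trans a3)// ler_pM2l.
Unshelve. all: by end_near. Qed.

(** The homeomorphism maps p + s n to a point of a narrow cone at par p
    with axis n, and this cone lies on one side by [cone_inside]. *)
Lemma par_side p n : M p -> dot n n = 1 -> tangential M' (par p) n ->
  (\forall s \near (0 : R)^'+, inside M (p + s *: n)) <->
  (\forall s \near (0 : R)^'+, inside M' (par p + s *: n)).
Proof.
move=> Mp n1 tg; have [F [G [FE FG GF [[CF lF] [CG lG]] Fv]]] := par_homeo.
have [s1 s10 Hs] := cone_inside n1 tg.
have ME : M' = F @` M by apply/seteqP; split=> _ [a Ma <-]; exists a => //; rewrite FE.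
(* the homeomorphism maps the normal half-line into a narrow cone *)
have step s : 0 < s -> l * s < s1 -> exists2 w, `|w - n| <= 6^-1 &
    inside M (p + s *: n) <-> inside M' (par p + (l * s) *: w).
  move=> s0 ls; have ls0 : 0 < l * s by rewrite mulr_gt0.
  exists ((l * s)^-1 *: (F (p + s *: n) - F p)).
    have -> : (l * s)^-1 *: (F (p + s *: n) - F p) - n = (l * s)^-1 *: (F (p + s *: n) - F p - l *: (s *: n)).
      by rewrite [in RHS]scalerBr !scalerA -mulrA mulVf ?scale1r// gt_eqF.
    rewrite normrZ gtr0_norm ?invr_gt0// mulrC ler_pdivrMr//.
    apply: (le_trans (Fv _ _)); rewrite normrZ gtr0_norm//.
    have := dot_unit_norm n1 => nn.
    have : s * `|n| <= s by rewrite ler_piMr// ltW.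
    move=> sn; have -> : 6^-1 * (l * s) = l / 6 * s by field.
    by rewrite ler_pM2l// divr_gt0.
  have -> : par p + (l * s) *: ((l * s)^-1 *: (F (p + s *: n) - F p)) = F (p + s *: n).
    by rewrite scalerA mulfV ?scale1r ?gt_eqF// (FE p Mp) addrC subrK.
  rewrite ME.
  apply: iff_sym; apply: (@inside_homeo _ G F) => //.
  - exact: lip_continuous lG.
  - exact: lip_continuous lF.
  - by move=> A; exact: lip_bounded.
  - by move=> A; exact: lip_bounded.
have inv s w s' : 0 < s < s1 -> `|w - n| <= 6^-1 -> 0 < s' < s1 ->
    inside M' (par p + s *: w) <-> inside M' (par p + s' *: n).
  by move=> h hw h'; apply: Hs => //; rewrite subrr normr0.
have small : \forall s \near (0 : R)^'+, 0 < s /\ l * s < s1.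
  near=> s; split; near: s; first exact: nbhs_right_gt.
  near=> s; rewrite mulrC -ltr_pdivlMr//; near: s; apply: nbhs_right_lt.
  by rewrite divr_gt0.
have small' : \forall s \near (0 : R)^'+, 0 < s < s1.
  near=> s; apply/andP; split; near: s; [exact: nbhs_right_gt|exact: nbhs_right_lt].
split=> H.
  have : \forall s \near (0 : R)^'+, inside M (p + s *: n) /\ (0 < s /\ l * s < s1).
    by near=> s; split; near: s.
  move=> /filter_ex[s [Is [s0 ls]]]; have [w wn Iw] := step s s0 ls.
  have ls0 : 0 < l * s < s1 by rewrite ls mulr_gt0.
  by apply: filterS small' => s' hs'; exact: (inv _ _ _ ls0 wn hs').1 (Iw.1 Is).
have : \forall s \near (0 : R)^'+, inside M' (par p + s *: n) /\ 0 < s < s1.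
  by near=> s; split; near: s.
move=> /filter_ex[s' [Is' hs']].
apply: filterS small => s [s0 ls]; have [w wn Iw] := step s s0 ls.
have ls0 : 0 < l * s < s1 by rewrite ls mulr_gt0.
exact: Iw.2 ((inv _ _ _ ls0 wn hs').2 Is').
Unshelve. all: by end_near. Qed.

Local Notation B x q := (l%:M - t *: shape_mx M x q).

Lemma par_J U x q : chart M U x -> U q ->
  differentiable (par \o x) q /\ 'J (par \o x) q = B x q *m 'J x q.
Proof.
move=> cx Uq; have [d E] := jacobian_comb l t (chart_diff cx Uq) (ov_diffN ov cx Uq); split; first exact: d.
apply: (etrans E); rewrite (ov_JN ov cx Uq).
move: (shape_mx M x q) ('J x q) => S J.
by rewrite mulmxBl mul_scalar_mx mulNmx scalerN -scalemxAl.
Qed.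

Lemma par_shape_pos U x q : chart M U x -> U q ->
  0 < l - t * \tr (shape_mx M x q).
Proof.
move=> cx Uq; have := tH (chart_in cx Uq); rewrite (mean_curvatureE ov cx Uq).
by have -> : 2 * t * (\tr (shape_mx M x q) / 2) = t * \tr (shape_mx M x q) by field.
Qed.

Lemma par_det U x q : chart M U x -> U q ->
  0 < \det (B x q) /\ Num.sqrt (\det (B x q)) <= l - t * (\tr (shape_mx M x q) / 2).
Proof.
move=> cx Uq; have [_ K0 _ KH _] := ov_forms ov cx Uq.
exact: sqrt_det_par K0 KH l0 (par_shape_pos cx Uq).
Qed.

Lemma par_unit U x q : chart M U x -> U q -> B x q \in unitmx.
Proof. by move=> cx Uq; rewrite unitmxE unitfE gt_eqF//; have [] := par_det cx Uq. Qed.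

Lemma par_free U x q : chart M U x -> U q -> row_free ('J (par \o x) q).
Proof.
move=> cx Uq; have [_ ->] := par_J cx Uq.
rewrite /row_free mxrankMfree ?(chart_free cx Uq)//.
by have := par_unit cx Uq; rewrite -row_free_unit.
Qed.

Lemma par_smooth U x : chart M U x -> smooth_on U (par \o x).
Proof.
move=> cx; have oU := chart_open cx; apply/Ck_smooth => n; apply: (Ck_add oU).
  by apply: (Ck_scale oU); [exact: Ck_cst|exact: (Ck_smooth U x).1 (chart_smooth cx) n].
by apply: (Ck_scale oU); [exact: Ck_cst|exact: (Ck_smooth U (N \o x)).1 (ov_smoothN ov cx) n].
Qed.

Lemma par_chart U x : chart M U x -> chart M' U (par \o x).
Proof.
move=> cx; split.
- exact: chart_open cx.
- exact: par_smooth.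
- move=> q r; rewrite !inE => Uq Ur /= E; apply: (chart_inj cx Uq Ur).
  by apply: par_inj E; exact: (chart_in cx).
- by move=> q; exact: par_free.
move=> V oV VU; have [W oW E] := chart_image cx oV VU.
have [F [G [FE FG GF [_ [C lG]] _]]] := par_homeo.
exists (G @^-1` W); first by apply: open_comp => // z _; exact: (lip_continuous lG).
apply/seteqP; split=> [_ [q Vq <-]|_ [[a Ma <-]]].
  have : (M `&` W) (x q) by rewrite -E; exists q.
  move=> [Mx Wx]; split; first by exists (x q).
  by rewrite /preimage /= -FE// FG.
rewrite /preimage /= -FE// FG => Wa.
have : (x @` V) a by rewrite E.
by move=> [q Vq qa]; exists q => //=; rewrite qa FE.
Qed.

Lemma par_perp U x q : chart M U x -> U q -> 'J (par \o x) q *m (N (x q))^T = 0.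
Proof. by move=> cx Uq; have [_ ->] := par_J cx Uq; rewrite -mulmxA (ov_perp ov cx Uq) mulmx0. Qed.

(** Tangent planes at corresponding points are parallel and the sides
    correspond by [par_side]; [outer_not_inside] excludes the opposite
    vector. *)
Lemma par_normal p : M p -> inner_normal M' (par p) = N p.
Proof.
move=> Mp; have [_ _ /(_ p Mp)[U [x [q [cx Uq xq]]]]] := ov_surface ov.
have cx' := par_chart cx.
have tg := par_tangential Mp.
have I1 : is_inner_normal M' (par p) (N p).
  split.
  - exact (ov_unit ov Mp).
    move=> _ [V [y [r [cy Vr yr /submxP[w ->]]]]].
    have yx : y r = (par \o x) q by rewrite yr /= xq.
    have [_ -> _ _] := transition cy cx' Vr Uq yx.
    by rewrite mulmxA dot_mulmx -xq (par_perp cx Uq) mulmx0 mxE.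
  apply/(par_side Mp (ov_unit ov Mp) tg).
  by have [_ _] := ov_normal ov Mp.
rewrite /inner_normal; case: xgetP => [n _ [n1 nt nI]|/(_ _ I1)//].
have Jn : 'J (par \o x) q *m n^T = 0.
  apply/perp_col => w; apply: nt; exists U, (par \o x), q; split=> //=; first by rewrite xq.
  exact: submxMl.
have JN := par_perp cx Uq; rewrite xq in JN.
have [//|nE] := perp_unique (par_free cx Uq) JN Jn (ov_unit ov Mp) n1.
exfalso; apply: (outer_not_inside ov Mp).
have tg' := tangential_opp tg.
rewrite nE in n1 nI; have := (par_side Mp n1 tg').2 nI.
by apply: filterS => s; rewrite scalerN.
Qed.

Lemma par_shape U x q : chart M U x -> U q ->
  shape_mx M' (par \o x) q = shape_mx M x q *m invmx (B x q).
Proof.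
move=> cx Uq; apply: shape_of; first exact: par_free cx Uq.
have E : \forall r \near q, (N \o x) r = (inner_normal M' \o (par \o x)) r.
  have nU : \forall r \near q, U r by apply: open_nbhs_nbhs; split => //; exact: chart_open cx.
  by apply: filterS nU => r Ur /=; rewrite par_normal//; exact: chart_in cx Ur.
have [_ E'] := near_eq_J E (ov_diffN ov cx Uq).
apply: (etrans E'); have [_ ->] := par_J cx Uq; rewrite (ov_JN ov cx Uq).
exact: par_shape_alg (par_unit cx Uq).
Qed.

Lemma par_first U x q : chart M U x -> U q ->
  first_form (par \o x) q = B x q *m first_form x q *m (B x q)^T.
Proof.
move=> cx Uq; apply: (etrans (first_formE _ _)); rewrite first_formE.
have [_ ->] := par_J cx Uq; move: (B x q) ('J x q) => S J.
by rewrite trmx_mul !mulmxA.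
Qed.

Lemma par_second U x q : chart M U x -> U q ->
  second_form M' (par \o x) q = second_form M x q *m (B x q)^T.
Proof.
move=> cx Uq; rewrite /second_form (par_shape cx Uq) (par_first cx Uq).
exact: par_second_alg (par_unit cx Uq).
Qed.

Lemma par_second_posdef U x q : chart M U x -> U q -> posdef (second_form M' (par \o x) q).
Proof.
move=> cx Uq; rewrite (par_second cx Uq) /second_form; have [_ K0 _ _ _] := ov_forms ov cx Uq.
have sym (A : 'M[R]_2) : (forall i j, A i j = A j i) -> A^T = A.
  by move=> sA; apply/matrixP => i j; rewrite mxE.
apply: posdef_par => //.
- exact: ov_I_posdef cx Uq.
- by apply: sym => i j; exact: ov_I_sym.
- exact (ov_posdef ov cx Uq).
- by apply: sym => i j; have := ov_II_sym ov i j cx Uq.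
- exact: par_shape_pos cx Uq.
Qed.

Lemma par_surface : surface M'.
Proof.
have [M0 cM H] := ov_surface ov; split.
- by case: M0 => p Mp; exists (par p); exists p.
- have [F [G [FE _ _ [[C lF] _] _]]] := par_homeo.
  have -> : M' = F @` M by apply/seteqP; split=> _ [a Ma <-]; exists a => //; rewrite FE.
  apply: connected_continuous_connected => //; apply: continuous_subspaceT.
  exact: lip_continuous lF.
move=> _ [p Mp <-]; have [U [x [q [cx Uq xq]]]] := H p Mp.
exists U, (par \o x), q; split=> //=; last by rewrite xq.
exact: par_chart.
Qed.

(** Positivity has to be verified in every chart y of the surface; the
    transition to a chart of the form par o x reduces it to
    [par_second_posdef]. *)
Lemma par_ovaloid : ovaloid M'.
Proof.
split; first exact: par_surface.
  have [F [G [FE _ _ [[C lF] _] _]]] := par_homeo.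
  have -> : M' = F @` M by apply/seteqP; split=> _ [a Ma <-]; exists a => //; rewrite FE.
  apply: continuous_compact; last exact: ov_compact.
  apply: continuous_subspaceT; exact: lip_continuous lF.
move=> V y r cy Vr; have [p Mp yr] := chart_in cy Vr.
have [_ _ /(_ p Mp)[U [x [q [cx Uq xq]]]]] := ov_surface ov.
have cx' := par_chart cx; have yx : y r = (par \o x) q by rewrite -yr /= xq.
have [dpsi JE uA nr] := transition cy cx' Vr Uq yx.
move: JE uA dpsi nr; set psi := cinv U (par \o x) \o y => JE uA dpsi nr.
have psir : psi r = q by rewrite /psi /= yx (cinvK cx').
have dN : differentiable (N \o x) (psi r) by rewrite psir; exact (ov_diffN ov cx Uq).
have E : \forall s \near r, ((N \o x) \o psi) s = (inner_normal M' \o y) s.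
  by apply: filterS nr => s [_ Us ys] /=; rewrite -ys /= par_normal//; exact: chart_in cx Us.
have [_ JN] := near_eq_J E (differentiable_comp dpsi dN).
have JN2 := jacobian_comp dpsi dN; rewrite psir in JN2.
have {}JN := etrans JN JN2.
have uB := par_unit cx Uq.
have [_ Jp] := par_J cx Uq.
have S1 : shape_mx M' y r = 'J psi r *m shape_mx M x q *m invmx (B x q) *m invmx ('J psi r).
  apply: shape_of; first exact: chart_free cy Vr.
  apply: (etrans JN); rewrite JE Jp (ov_JN ov cx Uq).
  exact: transition_shape_alg uA uB.
have I1 : first_form y r = 'J psi r *m first_form (par \o x) q *m ('J psi r)^T.
  rewrite !first_formE JE; move: ('J psi r) ('J (par \o x) q) => A J.
  by rewrite trmx_mul !mulmxA.
have -> : second_form M' y r = 'J psi r *m second_form M' (par \o x) q *m ('J psi r)^T.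
  rewrite /second_form S1 I1 (par_shape cx Uq) -[_ *m _ *m invmx (B x q)]mulmxA.
  exact: transition_second_alg uA.
exact: posdef_conj uA (par_second_posdef cx Uq).
Qed.

Lemma par_dens_H U x q : chart M U x -> U q ->
  dens_H M' (par \o x) q = l * dens_H M x q + (- t) * dens_K M x q.
Proof.
move=> cx Uq; rewrite (dens_HE par_ovaloid (par_chart cx) Uq) (dens_HE ov cx Uq) /dens_K.
rewrite (par_first cx Uq) sqrt_det_conj (par_shape cx Uq).
have [D0 _] := par_det cx Uq; rewrite gtr0_norm//.
have uB := par_unit cx Uq.
have XB : shape_mx M x q *m invmx (B x q) *m B x q = shape_mx M x q by rewrite mulmxKV.
have E := trace_par XB.
move: E; move: (\tr (_ *m invmx _)) (\det (B x q)) => T D E.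
have -> : T / 2 * (Num.sqrt (\det (first_form x q)) * D) = T * D / 2 * Num.sqrt (\det (first_form x q)) by ring.
by rewrite E; field.
Qed.

Lemma par_dens_II U x q : chart M U x -> U q ->
  dens_II M' (par \o x) q <= l * dens_II M x q + (- t) * dens_HK M x q.
Proof.
move=> cx Uq; rewrite /dens_II /dens_HK (par_second cx Uq) det_mulmx det_tr !mul1r.
have [D0 Dle] := par_det cx Uq; rewrite (mean_curvatureE ov cx Uq) mulrA -mulrDl.
have S0 : 0 <= \det (second_form M x q).
  rewrite /second_form det_mulmx; have [I0 K0 _ _ _] := ov_forms ov cx Uq.
  by rewrite mulr_ge0// ltW.
by rewrite sqrtrM// mulrC ler_wpM2r// mulNr.
Qed.

Lemma par_decomposition n (U : 'I_n -> set 'rV[R]_2) (x : 'I_n -> 'rV[R]_2 -> 'rV[R]_3) C :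
  decomposition M U x C -> decomposition M' U (fun i => par \o x i) C.
Proof.
move=> [cx mC tC MC]; split=> //.
- by move=> i; exact: par_chart.
- move=> i j ij; apply/seteqP; split=> // z [[_ [w Cw <-] <-] [_ [w' Cw' <-] /= E]].
  have Mi : M (x i (plane w)) by apply: chart_in (cx i) _; apply: (mC i).2; exists w.
  have Mj : M (x j (plane w')) by apply: chart_in (cx j) _; apply: (mC j).2; exists w'.
  have : (x i @` (@plane R @` C i) `&` x j @` (@plane R @` C j)) (x i (plane w)).
    split; first by exists (plane w) => //; exists w.
    by exists (plane w'); [exists w'|exact: par_inj Mj Mi E].
  by rewrite (tC i j ij).
apply/seteqP; split=> [_ [p + <-]|z [i _ [_ [w Cw <-] <-]]].
  rewrite [in X in X -> _]MC => -[i _ [_ [w Cw <-] <-]]; exists i => //.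
  by exists (plane w) => //; exists w.
exists (x i (plane w)) => //; apply: chart_in (cx i) _; apply: (mC i).2; exists w => //.
Qed.

Lemma par_total_mean_curvature n (U : 'I_n -> set 'rV[R]_2) (x : 'I_n -> 'rV[R]_2 -> 'rV[R]_3) C :
  decomposition M U x C ->
  total_mean_curvature M' = l * dsum (dens_H M) x C - t * dsum (dens_K M) x C.
Proof.
move=> D; rewrite (total_mean_curvatureE par_ovaloid (par_decomposition D)) -mulNr.
have sM := ov_surface ov; have cM := ov_compact ov; have [cx _ _ _] := D.
rewrite -(psum_comb _ _ (dens_integrable sM cM (density_H ov) D) (dens_integrable sM cM (density_K ov) D)).
by apply: psum_eq => i z Cz; exact: par_dens_H (cx i) (decomp_plane D Cz).
Qed.

Lemma par_area_II n (U : 'I_n -> set 'rV[R]_2) (x : 'I_n -> 'rV[R]_2 -> 'rV[R]_3) C :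
  decomposition M U x C ->
  area_II M' <= l * dsum (dens_II M) x C - t * dsum (dens_HK M) x C.
Proof.
move=> D; rewrite (area_IIE par_ovaloid (par_decomposition D)) -mulNr.
have sM := ov_surface ov; have cM := ov_compact ov; have [cx _ _ _] := D.
have i1 := dens_integrable sM cM (density_II ov) D; have i2 := dens_integrable sM cM (density_HK ov) D.
rewrite -(psum_comb _ _ i1 i2).
apply: psum_le; [|exact: pintegrable_comb i1 i2|].
  have ov' := par_ovaloid.
  exact (dens_integrable (ov_surface ov') (ov_compact ov') (density_II ov') (par_decomposition D)).
by move=> i z Cz; exact: par_dens_II (cx i) (decomp_plane D Cz).
Qed.

End Parallel.

(** * Critical ovaloids are umbilic *)

Section Critical.
Variable R : realType.
Variable M : set 'rV[R]_3.
Hypothesis ov : ovaloid M.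
Local Notation N := (inner_normal M).
Implicit Types (U V : set 'rV[R]_2) (x y : 'rV[R]_2 -> 'rV[R]_3) (a b p : 'rV[R]_3).

Lemma derive_ge_le (A : R -> R) (s : R) : is_derive (0 : R) (1 : R) A 0 ->
  (\forall t \near (0 : R), A t <= A 0 + t * s) -> 0 <= s.
Proof.
move=> [dA dA0] H; rewrite leNgt; apply/negP => s0.
have e0 : 0 < - s / 2 by rewrite divr_gt0// oppr_gt0.
have cA : (fun h => h^-1 *: ((A \o shift 0) (h *: 1) - A 0)) @ 0^' --> (0 : R).
  by rewrite -[X in _ --> X]dA0; exact: dA.
have /cvgrPdist_le /(_ _ e0) := cA.
move=> /nbhs_ballP[d1 /= d10 H1]; have /nbhs_ballP[d2 /= d20 H2] := H.
pose h := Num.min d1 d2 / 2.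
have m0 : 0 < Num.min d1 d2 by rewrite lt_min d10.
have h0 : 0 < h by rewrite divr_gt0.
have hm : h < Num.min d1 d2 by rewrite /h ltr_pdivrMr// ltr_pMr// ltr1n.
move: hm; rewrite lt_min => /andP[hd1 hd2].
have := H1 h; rewrite -ball_normE /= sub0r normrN gtr0_norm// => /(_ hd1) H1'.
have {}H1' := H1' (lt0r_neq0 h0).
have := H2 h; rewrite -ball_normE /= sub0r normrN gtr0_norm// => /(_ hd2) H2'.
move: H1'; rewrite sub0r normrN /= addr0 [h *: 1]mulr1 => H1'.
have : - (- s / 2) <= h^-1 * (A h - A 0).
  by move: H1'; rewrite ler_norml => /andP[].
rewrite [h^-1 * _]mulrC ler_pdivlMr// => H3.
have : s * h < s / 2 * h by rewrite ltr_pM2r//; move: s0; clear; lra.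
by move: H2' H3; rewrite (mulrC h); clear; lra.
Qed.

Lemma small_times (c L Hm : R) : 0 < c -> 0 < L -> \forall t \near (0 : R),
  [/\ 0 < 1 + t * c, `|t| * L <= (1 + t * c) / 6 &
    forall H, 0 <= H -> H <= Hm -> 0 < (1 + t * c) - 2 * t * H].
Proof.
move=> c0 L0; pose K := c + 6 * L + 2 * `|Hm|.
have K0 : 0 < K by rewrite /K ltr_wpDr ?mulr_ge0// addr_gt0// mulr_gt0.
have : \forall t \near (0 : R), `|0 - t| < K^-1.
  by apply/nbhs_ballP; exists K^-1 => [|t]; rewrite /= ?invr_gt0// -ball_normE.
apply: filterS => t; rewrite sub0r normrN -[_^-1]mul1r ltr_pdivlMr// => tK.
have tc : - (`|t| * c) <= t * c by rewrite -mulNr ler_wpM2r ?(ltW c0)// lerNl -normrN ler_norm.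
have t1 : 0 <= `|t| * c by rewrite mulr_ge0// ltW.
have t2 : 0 <= `|t| * L by rewrite mulr_ge0// ltW.
have t3 : 0 <= `|t| * `|Hm| by rewrite mulr_ge0.
have tK' : `|t| * c + 6 * (`|t| * L) + 2 * (`|t| * `|Hm|) < 1.
  by apply: le_lt_trans tK; rewrite /K le_eqVlt; apply/orP; left; apply/eqP; ring.
split.
- by move: t1 t2 t3 tK' tc; clear; move: (`|t| * c) (`|t| * L) (t * c) (`|t| * `|Hm|) => A1 A2 A3 A4; lra.
- by move: t1 t2 t3 tK' tc; clear; move: (`|t| * c) (`|t| * L) (t * c) (`|t| * `|Hm|) => A1 A2 A3 A4; lra.
move=> H H0 HH; have : t * H <= `|t| * `|Hm|.
  apply: (le_trans (ler_norm _)); rewrite normrM ler_wpM2l// ger0_norm//.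
  by rewrite (le_trans HH)// ler_norm.
rewrite -mulrA; move: t1 t2 t3 tK' tc; clear.
by move: (`|t| * c) (`|t| * L) (t * c) (`|t| * `|Hm|) (t * H) => A1 A2 A3 A4 A5; lra.
Qed.

Lemma smooth_sub (V W : normedModType R) (U1 U2 : set V) (f : V -> W) :
  U1 `<=` U2 -> smooth_on U2 f -> smooth_on U1 f.
Proof. by move=> U12 sf l q /U12; exact: sf. Qed.

Lemma par_deformation c : deformation M (fun t n => (1 + t * c) *: n + t *: N n).
Proof.
split; first by move=> n _; rewrite mul0r addr0 scale1r scale0r addr0.
exists 1 => // U x cx.
pose W := [set z : R * 'rV[R]_2 | U z.2].
apply: (@smooth_sub _ _ _ W); first by move=> z [].
have oU := chart_open cx.
have cs : continuous (snd : R * 'rV[R]_2 -> 'rV[R]_2) by move=> z; exact: cvg_snd.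
have cf : continuous (fst : R * 'rV[R]_2 -> R) by move=> z; exact: cvg_fst.
have oW : open W by apply: open_comp => // z _; exact: cs.
have C2 (f : 'rV[R]_2 -> 'rV[R]_3) n : Ck n U f -> Ck n W (fun z => f z.2).
  by move=> Cf; have := Ck_lin_comp (L := snd) oU cs Cf.
have C1 n : Ck n W (fun z => z.1) by have := Ck_linear (L := fst) n oW cf.
apply/Ck_smooth => n; apply: (Ck_add oW); apply: (Ck_scale oW).
- apply: (Ck_add oW); first exact: Ck_cst.
  by apply: (Ck_mul oW); [exact: C1|exact: Ck_cst].
- by apply: C2; exact: (Ck_smooth U x).1 (chart_smooth cx) n.
- exact: C1.
- by apply: (C2 (N \o x)); exact: (Ck_smooth U (N \o x)).1 (ov_smoothN ov cx) n.
Qed.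

(** With the integrals h, k, a and b of H, K, sqrt K and H sqrt K, the
    II-area along the deformation is at most a + t (k a / h - b), so that
    b h <= k a. Together with k <= b and a <= h this forces k = b, and the
    equality case of K <= H sqrt K holds everywhere. *)
Lemma critical_umbilic : critical_area_II M ->
  forall U x q, chart M U x -> U q -> shape_mx M x q = (\tr (shape_mx M x q) / 2)%:M.
Proof.
move=> crit; have sM := ov_surface ov; have cM := ov_compact ov.
have [n [U0 [x0 [C D]]]] : exists n (U : 'I_n.+1 -> set 'rV[R]_2) (x : 'I_n.+1 -> 'rV[R]_2 -> 'rV[R]_3) C, decomposition M U x C.
  have [[p Mp] _ /(_ p Mp)[U [x [q [cx _ _]]]]] := sM.
  by have [n [U1 [x1 [C [D _ _ _]]]]] := decomp_starting sM cM cx; exists n, U1, x1, C.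
have [L L0 LN] := normal_lipschitz ov.
have [Hm HmP] := mean_curvature_bounded ov.
have [h hE] : exists h, h = dsum (dens_H M) x0 C := ex_intro _ _ erefl.
have [k kE] : exists k, k = dsum (dens_K M) x0 C := ex_intro _ _ erefl.
have [a aE] : exists a : R, a = dsum (dens_II M) x0 C := ex_intro _ _ erefl.
have [b bE] : exists b : R, b = dsum (dens_HK M) x0 C := ex_intro _ _ erefl.
have dH := density_H ov; have dK := density_K ov; have dII := density_II ov; have dHK := density_HK ov.
have sI U x q : chart M U x -> U q -> 0 < Num.sqrt (\det (first_form x q)).
  by move=> cx Uq; rewrite sqrtr_gt0; have [] := ov_forms ov cx Uq.
have k0 : 0 < k.
  rewrite kE; apply: (dsum_gt0 sM cM dK D) => U x q cx Uq.
  by rewrite mulr_gt0//; [have [] := ov_forms ov cx Uq|exact: sI cx Uq].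
have h0 : 0 < h.
  rewrite hE; apply: (dsum_gt0 sM cM dH D) => U x q cx Uq.
  by rewrite mulr_gt0//; [exact (mean_curvature_gt0 ov (chart_in cx Uq))|exact: sI cx Uq].
have [cx0 _ _ _] := D.
have kb : k <= b.
  rewrite kE bE; apply: psum_le; [exact (dens_integrable sM cM dK D)|exact (dens_integrable sM cM dHK D)|].
  by move=> i z Cz; exact (dens_K_le_HK ov (cx0 i) (decomp_plane D Cz)).
have ah : a <= h.
  rewrite aE hE; apply: psum_le; [exact (dens_integrable sM cM dII D)|exact (dens_integrable sM cM dH D)|].
  by move=> i z Cz; exact (dens_II_le_H ov (cx0 i) (decomp_plane D Cz)).
pose c := k / h; have c0 : 0 < c by rewrite divr_gt0.
pose mu t p := (1 + t * c) *: p + t *: N p.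
have small : \forall t \near (0 : R), [/\ 0 < 1 + t * c, `|t| * L <= (1 + t * c) / 6 &
    forall p, M p -> 0 < (1 + t * c) - 2 * t * mean_curvature M p].
  have := small_times Hm c0 L0; apply: filterS => t [h1 h2 h3]; split => // p Mp.
  by apply: h3; [exact (ltW (mean_curvature_gt0 ov Mp))|exact: HmP].
have tmc : \forall t \near (0 : R), total_mean_curvature (mu t @` M) = total_mean_curvature M.
  apply: filterS small => t [l0 tL tH].
  have := par_total_mean_curvature ov L0 LN l0 tL tH D; rewrite (total_mean_curvatureE ov D) => E.
  apply: (etrans E); rewrite -hE -kE /c; field; exact: lt0r_neq0.
have dA := crit mu (par_deformation c) tmc.
have A0 : area_II (mu 0 @` M) = a.
  rewrite aE -(area_IIE ov D); congr area_II; apply/seteqP; split=> [_ [p Mp <-]|p Mp].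
    by rewrite /mu mul0r addr0 scale1r scale0r addr0.
  by exists p => //; rewrite /mu mul0r addr0 scale1r scale0r addr0.
have slope : 0 <= c * a - b.
  apply: (derive_ge_le dA); apply: filterS small => t [l0 tL tH].
  have := par_area_II ov L0 LN l0 tL tH D; rewrite -aE -bE => E.
  rewrite A0; apply: (le_trans E); rewrite le_eqVlt; apply/orP; left; apply/eqP; ring.
have bk : b <= k.
  move: slope; rewrite subr_ge0 /c => bc; apply: (le_trans bc).
  apply: (@le_trans _ _ (k / h * h)); last by rewrite divfK ?gt_eqF.
  by rewrite ler_pM2l.
rewrite bE kE in bk.
move=> U x q cx Uq; apply: (dens_K_eq_HK ov cx Uq).
by apply: (dens_le_eq sM cM dK dHK _ D bk cx Uq) => V y r cy Vr; exact (dens_K_le_HK ov cy Vr).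
Qed.

(** Constant in each chart by the mean value theorem, hence locally constant
    on the connected set M. *)
Lemma chart_const (f : 'rV[R]_3 -> R) :
  (forall U x q, chart M U x -> U q -> differentiable (f \o x) q /\ forall v, 'D_v (f \o x) q = 0) ->
  forall p a, M p -> M a -> f a = f p.
Proof.
move=> H; have [_ cM sM] := ov_surface ov; apply: connected_locally_eq cM _ => p Mp.
have [U [x [q [cx Uq xq]]]] := sM p Mp.
have nU : \forall r \near q, U r by apply: open_nbhs_nbhs; split=> //; exact: chart_open cx.
move: nU => /nbhs_ballP[d /= d0 Hd].
have oB : open (ball q d) by exact: ball_open.
have := cinv_near cx Uq oB (ballxx q d0); rewrite xq; apply: filterS => a h Ma.
have [[Ur Br] xr _] := h Ma; move: (cinv U x a) Ur Br xr => r Ur Br xr.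
have seg s : 0 <= s <= 1 -> U (q + s *: (r - q)).
  move=> s01; apply: Hd; rewrite -ball_normE /= distrC; apply: seg_ball => //.
    by rewrite subrr normr0.
  by move: Br; rewrite -ball_normE /= distrC.
have [|s s01] := @MVT_line _ _ (f \o x) q r.
  by move=> s /seg Us; have [] := H U x _ cx Us.
have [_ ->] := H U x _ cx (seg s s01).
by rewrite /= xr xq => /eqP; rewrite subr_eq0 => /eqP.
Qed.

(** * Umbilic ovaloids lie on spheres *)

Hypothesis umbilic : forall U x q, chart M U x -> U q -> shape_mx M x q = (\tr (shape_mx M x q) / 2)%:M.
Local Notation H := (mean_curvature M).

Lemma umbilic_derive_normal U x q v : chart M U x -> U q -> 'D_v (N \o x) q = - (H (x q) *: 'D_v x q).
Proof.
move=> cx Uq.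
have E1 := deriveEjacobian v (ov_diffN ov cx Uq); have E2 := deriveEjacobian v (chart_diff cx Uq).
apply: (etrans E1); rewrite (ov_JN ov cx Uq) (umbilic cx Uq) -(mean_curvatureE ov cx Uq).
have alg (h : R) (w : 'rV[R]_2) (J : 'M[R]_(2, 3)) : w *m (- h%:M *m J) = - (h *: (w *m J)).
  by rewrite mulNmx mul_scalar_mx mulmxN -scalemxAr.
apply: (etrans (alg _ _ _)); congr (- (_ *: _)); exact: esym E2.
Qed.

Lemma umbilic_diff_H U x q : chart M U x -> U q -> differentiable (H \o x) q.
Proof.
move=> cx Uq.
have I0 r : U r -> first_form x r 0 0 != 0.
  move=> Ur; have n1 : (1 != 0 :> R) by exact: oner_neq0.
  have := posdef_quad (a := 1) (b := 0) (ov_I_posdef cx Ur); rewrite n1 => /(_ isT) h.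
  by apply: lt0r_neq0; move: h; rewrite expr1n expr0n /= !mul1r !mul0r !addr0.
have d1 := first_form_diff 0 0 cx Uq; have d2 := second_form_diff ov 0 0 cx Uq.
refine (proj1 (near_eq_diff _ (differentiableM d2 (differentiableV d1 (I0 q Uq))))).
have nU : \forall r \near q, U r by apply: open_nbhs_nbhs; split=> //; exact: chart_open cx.
apply: filterS nU => r Ur.
change (second_form M x r 0 0 * (first_form x r 0 0)^-1 = H (x r)).
rewrite /second_form (umbilic cx Ur) -(mean_curvatureE ov cx Ur).
by rewrite mul_scalar_mx mxE mulfK// I0.
Qed.

Lemma scaled_row_eq (a b : R) (u v : 'rV[R]_3) :
  (forall i, a * u 0 i = b * v 0 i) -> a *: u = b *: v.
Proof. by move=> E; apply/rowP => i; rewrite !mxE. Qed.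

Lemma codazzi_alg (h A1 A2 B1 B2 X1 X2 : R) : A1 = A2 ->
  - (h * A1 + B1 * X1) = - (h * A2 + B2 * X2) -> X1 * B1 = X2 * B2.
Proof. by move=> -> /oppr_inj/addrI E; rewrite mulrC E mulrC. Qed.

(** The Codazzi equations: in D_v N = - H D_v x the second derivatives of N
    and of x are symmetric, which leaves D_w H D_v x = D_v H D_w x, and the
    partial derivatives of x are independent. *)
Lemma umbilic_dH U x q u : chart M U x -> U q -> 'D_u (H \o x) q = 0.
Proof.
move=> cx Uq; have oU := chart_open cx; have fJ := chart_free cx Uq.
have nU : \forall r \near q, U r by exact: open_nbhs_nbhs.
have [_ Cx] := (Ck_smooth U x).1 (chart_smooth cx) 1%N.
have [_ CN] := (Ck_smooth U (N \o x)).1 (ov_smoothN ov cx) 1%N.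
have dx v : differentiable (fun r => 'D_v x r) q by exact: (Cx v).1 q Uq.
have dN v : differentiable (fun r => 'D_v (N \o x) r) q by exact: (CN v).1 q Uq.
have dH := umbilic_diff_H cx Uq.
have E v w i : 'D_w (fun r => 'D_v (N \o x) r) q 0 i =
   - (H (x q) * 'D_w (fun r => 'D_v x r) q 0 i + 'D_v x q 0 i * 'D_w (H \o x) q).
  have dxi : differentiable (fun r => 'D_v x r 0 i) q by exact: (diff_rowP _ _).1 (dx v) i.
  have dNw : derivable (fun r => 'D_v (N \o x) r) q w by exact: diff_derivable.
  have dxw : derivable (fun r => 'D_v x r) q w by exact: diff_derivable.
  apply: (etrans (derive_coord _ dNw)).
  transitivity ('D_w (fun r => - ((H \o x) r * 'D_v x r 0 i)) q).
    by apply: near_eq_derive; apply: filterS nU => r Ur; rewrite (umbilic_derive_normal v cx Ur) !mxE.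
  rewrite deriveN; last by apply: diff_derivable; exact: differentiableM.
  rewrite derive_mulR; [|exact: diff_derivable|exact: diff_derivable].
  by rewrite (derive_coord i dxw).
have sym v w : 'D_w (H \o x) q *: 'D_v x q = 'D_v (H \o x) q *: 'D_w x q.
  apply: scaled_row_eq => i.
  have m1 := congr1 (fun z : 'rV[R]_3 => z 0 i) (mixed_partials w v oU (ov_smoothN ov cx) Uq).
  have m2 := congr1 (fun z : 'rV[R]_3 => z 0 i) (mixed_partials w v oU (chart_smooth cx) Uq).
  exact: codazzi_alg m2 (etrans (esym (E v w i)) (etrans m1 (E w v i))).
have symJ v w : 'D_w (H \o x) q *: v = 'D_v (H \o x) q *: w.
  apply: (row_free_inj fJ); rewrite /= -!scalemxAl.
  have := sym v w; rewrite (deriveEjacobian v (chart_diff cx Uq)) (deriveEjacobian w (chart_diff cx Uq)).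
  exact.
have e01 := symJ (delta_mx 0 1) (delta_mx 0 0).
have z0 : 'D_(delta_mx 0 0) (H \o x) q = 0.
  by move/rowP/(_ 1): e01; rewrite !mxE /= mulr1 mulr0.
have := symJ (delta_mx 0 0) u; rewrite z0 scale0r => /rowP/(_ 0).
by rewrite !mxE /= mulr1.
Qed.

(** With the constant k = H, the vector N + k p is constant, so that M is
    contained in the sphere of radius 1 / k around (N + k p) / k. *)
Lemma umbilic_in_sphere : exists c r, 0 < r /\ M `<=` sphere c r.
Proof.
have [[p Mp] _ _] := ov_surface ov.
have HC : forall a, M a -> H a = H p.
  move=> a Ma; apply: (chart_const _ Mp Ma) => U x q cx Uq; split; first exact: umbilic_diff_H cx Uq.
  by move=> v; exact: umbilic_dH cx Uq.
have k0 := mean_curvature_gt0 ov Mp; set k := H p in HC k0.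
have NC a : M a -> N a + k *: a = N p + k *: p.
  move=> Ma; apply/rowP => i.
  apply: (chart_const (f := fun a => (N a + k *: a) 0 i) _ Mp Ma) => U x q cx Uq.
  have dN := ov_diffN ov cx Uq; have dx := chart_diff cx Uq.
  have dF : differentiable (fun r => (N \o x) r + k *: x r) q.
    by apply: differentiableD => //; exact: differentiableZ.
  split; first exact: (diff_rowP _ _).1 dF i.
  move=> v; have dFv : derivable (fun r => (N \o x) r + k *: x r) q v by exact: diff_derivable.
  apply: (etrans (esym (derive_coord i dFv))).
  have -> : 'D_v (fun r => (N \o x) r + k *: x r) q = 'D_v (N \o x) q + k *: 'D_v x q.
    have d1 : derivable (N \o x) q v by exact: diff_derivable.
    have d2 : derivable x q v by exact: diff_derivable.
    have dk : derivable (k \*: x) q v by exact: derivableZ.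
    apply: (etrans (deriveD d1 dk)); congr (_ + _); exact: deriveZ.
  by rewrite (umbilic_derive_normal v cx Uq) (HC _ (chart_in cx Uq)) addNr mxE.
exists (k^-1 *: (N p + k *: p)), k^-1; split; first by rewrite invr_gt0.
move=> a Ma; rewrite /sphere /= -(NC a Ma).
have -> : a - k^-1 *: (N a + k *: a) = - (k^-1 *: N a).
  by rewrite scalerDr scalerA mulVf ?gt_eqF// scale1r opprD addrCA subrr addr0.
by rewrite dotNl dotNr opprK dotZl dotZr (ov_unit ov Ma) mulr1 expr2.
Qed.

End Critical.

(** * Spheres with a missing point *)

Section Puncture.
Variable R : realType.

(** The half-line from the centre leaves the ball at z. *)
Lemma missing_point_not_inside (M : set 'rV[R]_3) c r z : M `<=` sphere c r ->
  sphere c r z -> ~ M z -> 0 < r -> ~ inside M z.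
Proof.
move=> MS Sz Mz r0; have zc : z - c != 0 by rewrite -dot_eq0 Sz; exact: lt0r_neq0 (exprn_gt0 _ r0).
apply: (@ray_not_inside _ _ _ (z - c)) => // s s0 Ms.
have [s00|sn] := eqVneq s 0; first by apply: Mz; move: Ms; rewrite s00 scale0r addr0.
have sp : 0 < s by rewrite lt_neqAle eq_sym sn.
move: (MS _ Ms); rewrite /sphere /=.
have -> : z + s *: (z - c) - c = (1 + s) *: (z - c) by rewrite scalerDl scale1r addrAC.
rewrite dotZl dotZr Sz => /eqP; rewrite mulrA -subr_eq0.
have -> : (1 + s) * (1 + s) * r ^+ 2 - r ^+ 2 = s * (2 + s) * r ^+ 2 by ring.
by apply/negP/lt0r_neq0; rewrite !mulr_gt0// ?exprn_gt0// addr_gt0.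
Qed.

(** Points of the open ball reach infinity through the missing point z. *)
Lemma punctured_sphere_inside (M : set 'rV[R]_3) c r z : M `<=` sphere c r ->
  sphere c r z -> ~ M z -> 0 < r -> forall u, ~ inside M u.
Proof.
move=> MS Sz Mz r0 u; have rayz := missing_point_not_inside MS Sz Mz r0.
have [lt|gt|eq] := ltrgtP (dot (u - c) (u - c)) (r ^+ 2); last 2 first.
- by apply: outside_ball gt => p /MS; rewrite /sphere /= => ->.
- by move=> Iu; have [Mu _] := Iu; exact: missing_point_not_inside MS eq Mu r0 Iu.
(* in the ball: the segment to the missing point z *)
pose f (s : R) := u + s *: (z - u).
suff h : inside M (f 0) <-> inside M (f 1).
  by move: h; rewrite /f scale0r addr0 scale1r addrC subrK => h /h.
apply: inside_path => s.
  by move=> _; apply: cvgD; [exact: cvg_cst|apply: cvgZr_tmp; exact: cvg_id].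
move=> /andP[s0 s1] Ms; have [s11|sn] := eqVneq s 1.
  by apply: Mz; move: Ms; rewrite /f s11 scale1r addrC subrK.
have sl : s < 1 by rewrite lt_neqAle sn.
move: (MS _ Ms); rewrite /sphere /=.
have -> : f s - c = (1 - s) *: (u - c) + s *: (z - c).
  by rewrite /f; apply/rowP => j; rewrite !mxE; ring.
have SB : dot (z - c) (z - c) = r ^+ 2 by exact: Sz.
move: (u - c) (z - c) lt SB => A B lt SB.
have AB : 2 * dot A B <= dot A A + dot B B.
  by have := dot_ge0 (A - B); rewrite dotBl !dotBr (dotC B A); lra.
rewrite dotDl !dotDr !dotZl !dotZr (dotC B A) SB => E.
have p1 : (1 - s) * s * (2 * dot A B) <= (1 - s) * s * (dot A A + r ^+ 2).
  by rewrite -SB ler_wpM2l// mulr_ge0// subr_ge0 ltW.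
have p2 : (1 - s) * dot A A < (1 - s) * r ^+ 2 by rewrite ltr_pM2l// subr_gt0.
move: p1 p2 E; move: (dot A A) (dot A B) (r ^+ 2) => a b q; clear => p1 p2 E.
have E2 : (1 - s) * ((1 - s) * a) + (1 - s) * (s * (2 * b)) + s * (s * q) = q by rewrite -[RHS]E; ring.
have p1' : (1 - s) * (s * (2 * b)) <= (1 - s) * (s * (a + q)) by rewrite !mulrA in p1 *.
have E3 : (1 - s) * ((1 - s) * a) + (1 - s) * (s * (a + q)) + s * (s * q) = (1 - s) * a + s * q by ring.
have E4 : (1 - s) * q + s * q = q by ring.
lra.
Qed.

End Puncture.

(** * Critical ovaloids are spheres *)

Theorem theorem10 (R : realType) (M : set 'rV[R]_3) :
  ovaloid M -> critical_area_II M ->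
  exists (c : 'rV[R]_3) (r : R), 0 < r /\ M = sphere c r.
Proof.
move=> ov /(critical_umbilic ov) umbilic; have [c [r [r0 MS]]] := umbilic_in_sphere ov umbilic.
exists c, r; split=> //; apply/seteqP; split=> // z Sz; apply: contrapT => Mz.
have [[p Mp] _ _] := ov_surface ov; have [_ _ In] := ov_normal ov Mp.
have [s Is] := filter_ex In.
exact: punctured_sphere_inside MS Sz Mz r0 _ Is.
Qed.
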